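(* Let $E\subset\mathbb{R}^d$, $\mu$, $A$, $B$, $(T_t)_{t>0}$ and $\rho$ be as in the context. For $r>0$ let $E_r:=\{x\in E:\rho(x)<r\}$ and $$v_1(r):=\int_{E_r}\langle A(x)\nabla\rho(x),\nabla\rho(x)\rangle\,\mu(dx),\quad v_2(r):=\int_{E_r}\rho(x)\,|\langle B(x),\nabla\rho(x)\rangle|\,\mu(dx),\quad v(r):=v_1(r)+v_2(r).$$ If the sequence $(a_n)_{n\ge1}$ defined by $$a_n:=\int_1^n\frac{r}{v(r)}\,dr,\quad n\ge1,$$ satisfies $\lim_{n\to\infty}a_n=\infty$ and $\lim_{n\to\infty}\frac{\log(v_2(n)\vee1)}{a_n}=0$, then $(T_t)_{t>0}$ is not transient. In particular, if $(T_t)_{t>0}$ is additionally strictly irreducible, then $(T_t)_{t>0}$ is recurrent.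
   Context: Setting. $E\subset\mathbb{R}^d$ is either open or closed; if $E$ is closed, $dx(\partial E)=0$. $\varphi\in L^1_{loc}(E,dx)$, $\varphi>0$ $dx$-a.e., and $d\mu:=\varphi\,dx$, a $\sigma$-finite measure on $\mathcal{B}(E)$ with full support. $C_0^\infty(E)$ is the set of smooth functions with compact support in $E$ if $E$ is open, and the set of restrictions to $E$ of functions in $C_0^\infty(\mathbb{R}^d)$ if $E$ is closed. $\langle\cdot,\cdot\rangle$ and $|\cdot|$ are the Euclidean inner product and norm. $V\subset\subset E$ means $V$ is relatively open in $E$ with compact closure contained in $E$ (also called relatively compact open in $E$). $A=(a_{ij})_{1\le i,j\le d}$ with $a_{ij}\in L^1_{loc}(E,\mu)$ is a possibly non-symmetric matrix with symmetric part $\tilde a_{ij}=\frac12(a_{ij}+a_{ji})$, and for each $V\subset\subset E$ there is $\nu_V>0$ with $\nu_V^{-1}|\xi|^2\le\sum_{i,j}\tilde a_{ij}(x)\xi_i\xi_j\le\nu_V|\xi|^2$ for all $\xi\in\mathbb{R}^d$, $x\in V$. The form $\mathcal{E}^0(f,g):=\int_E\langle A\nabla f,\nabla g\rangle\,d\mu$, $f,g\in C_0^\infty(E)$, is assumed closable on $L^2(E,\mu)$ and to satisfy the strong sector condition $|\mathcal{E}^0(f,g)|\le K\mathcal{E}^0(f,f)^{1/2}\mathcal{E}^0(g,g)^{1/2}$ for some $K>0$; its closure is $(\mathcal{E}^0,D(\mathcal{E}^0))$, with generator $(L^0,D(L^0))$. $\nabla$ is the weak gradient, extended to $D(\mathcal{E}^0)$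 as $L^2_{loc}(E,\mathbb{R}^d,\mu)$-limit along $\mathcal{E}^0_1$-approximating sequences in $C_0^\infty(E)$. For $V\subset\subset E$, $C_0^\infty(V):=\{u\in C_0^\infty(E):\mathrm{supp}(u)\subset V\}$, $(\mathcal{E}^{0,V},D(\mathcal{E}^{0,V}))$ is the closure of $(\mathcal{E}^0,C_0^\infty(V))$ on $L^2(V,\mu)$, and $D(\mathcal{E}^{0,E}):=\bigcup_{V\subset\subset E}D(\mathcal{E}^{0,V})\subset D(\mathcal{E}^0)$. For a function space $W$: $W_b$ is the set of $\mu$-a.e. bounded elements, $W_0$ the set of elements with compact support in $E$ (support of $|u|d\mu$), $W_{0,b}=W_0\cap W_b$. $B=(B_1,\dots,B_d)\in L^2_{loc}(E,\mathbb{R}^d,\mu)$ is $\mu$-divergence free: $\int_E\langle B,\nabla f\rangle\,d\mu=0$ for all $f\in C_0^\infty(E)$. It is assumed that $D(L^0)_{0,b}$ is a dense subset of $L^1(E,\mu)$. The operator $\overline{L}$ and the semigroups. For $V\subset\subset E$ let $(L^{0,V},D(L^{0,V}))$ be the generator of $(\mathcal{E}^{0,V},D(\mathcal{E}^{0,V}))$ on $L^2(V,\mu)$. The operator $L^Vu:=L^{0,V}u+\langle B,\nabla u\rangle$, $u\in D(L^{0,V})_b$, is closable on $L^1(V,\mu)$ and its closure $\overline{L}^V$ generates a sub-Markovian $C_0$-resolvent of contractions $(\overline{G}^V_\alpha)_{\alpha>0}$. For open $V_n\subset\subset E$ with $\overline{V}_n\subset V_{n+1}$, $\bigcup_nV_n=E$,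 and $f\in L^1(E,\mu)$, the limit $\overline{G}_\alpha f:=\lim_{n\to\infty}\overline{G}^{V_n}_\alpha(f1_{V_n})$ exists $\mu$-a.e., is independent of the choice of $(V_n)$, and $(\overline{G}_\alpha)_{\alpha>0}$ is a sub-Markovian $C_0$-resolvent of contractions on $L^1(E,\mu)$. $(\overline{L},D(\overline{L}))$ is its generator and $(\overline{T}_t)_{t>0}$ the corresponding sub-Markovian $C_0$-semigroup of contractions on $L^1(E,\mu)$. $(\overline L,D(\overline L))$ extends $L^0u+\langle B,\nabla u\rangle$, $u\in D(L^0)_{0,b}$; moreover $D(\overline{L})_b\subset D(\mathcal{E}^0)$, and for $u\in D(\overline{L})_b$, $v\in D(\mathcal{E}^{0,E})_b$, $\mathcal{E}^0(u,v)-\int_E\langle B,\nabla u\rangle v\,d\mu=-\int_E\overline{L}u\,v\,d\mu$ and $\mathcal{E}^0(u,u)\le-\int_E\overline{L}u\,u\,d\mu$. $(T_t)_{t>0}$ is the unique sub-Markovian $C_0$-semigroup of contractions on $L^2(E,\mu)$ with $T_t=\overline{T}_t$ on $L^1(E,\mu)\cap L^2(E,\mu)$. Recurrence, transience, irreducibility. For $f\in L^1(E,\mu)$, $f\ge0$, $Gf:=\lim_{N\to\infty}\int_0^N\overline{T}_tf\,dt\in[0,\infty]$. $(T_t)_{t>0}$ is transient if there is $g\in L^1(E,\mu)$, $g>0$ $\mu$-a.e., with $Gg<\infty$ $\mu$-a.e.; it is recurrent if for every $f\in L^1(E,\mu)$ with $f\ge0$ $\mu$-a.e. one has $Gf(x)\in\{0,\infty\}$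 for $\mu$-a.e. $x$. $B_0\in\mathcal{B}(E)$ is weakly invariant if $T_t(f1_{B_0})=0$ $\mu$-a.e. on $E\setminus B_0$ for any $t>0$, $f\in L^2(E,\mu)$; $(T_t)_{t>0}$ is strictly irreducible if every weakly invariant $B_0$ satisfies $\mu(B_0)=0$ or $\mu(E\setminus B_0)=0$. The function $\rho$. It is assumed that $\rho$ is a non-negative continuous function on $E$ with $\nabla\rho\in L^\infty_{loc}(E,\mathbb{R}^d,\mu)$ such that for each $r>0$, $E_r=\{x\in E:\rho(x)<r\}$ is a relatively compact open set in $E$, and $\bigcup_{r>0}E_r=E$. It is also assumed that $v_1(r)>0$ for $r>0$. $a\vee b=\max\{a,b\}$. *)

(* Defs.v *)
From HB Require Import structures.
From mathcomp Require Import all_boot all_order all_algebra.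
From mathcomp Require Import all_classical all_reals all_analysis.
From mathcomp Require Import measurable_realfun.

Set Implicit Arguments.
Unset Strict Implicit.
Unset Printing Implicit Defensive.
Import Order.TTheory GRing.Theory Num.Theory.
Import numFieldNormedType.Exports.
Local Open Scope classical_set_scope.
Local Open Scope ring_scope.

(* 'rV[R]_d carries its Borel sigma-algebra. *)
HB.instance Definition _ (R : realType) (m n : nat) :=
  @isMeasurable.Build (sigma_display (@open 'M[R]_(m, n)))
    'M[R]_(m, n) <<s (@open 'M[R]_(m, n))>>
    (@sigma_algebra0 _ _ _) (@sigma_algebraC _ _ ) (@sigma_algebra_bigcup _ _ _).

Lemma open_measurable_mx (R : realType) m n (U : set 'M[R]_(m, n)) :
  open U -> measurable U.
Proof. exact: sub_sigma_algebra. Qed.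

Lemma measurable_coord (R : realType) d (i : 'I_d) :
  measurable_fun [set: 'rV[R]_d] (fun x : 'rV[R]_d => x ord0 i).
Proof.
apply: (measurability _ (RGenOpens.measurableE R)).
move=> _ [_ [a [b ->]] <-]; rewrite setTI.
apply: open_measurable_mx; apply: open_comp; last exact: interval_open.
by move=> x _; apply: coord_continuous.
Qed.

Lemma measurable_fun_rV (R : realType) d0 (T : measurableType d0) d
    (f : T -> 'rV[R]_d) :
  (forall i, measurable_fun setT (fun x => f x ord0 i)) -> measurable_fun setT f.
Proof.
move=> mf; apply: (measurability (@open 'rV[R]_d)) => //.
move=> _ [U oU <-]; rewrite setTI.
pose Q (k : 'rV[rat]_d * nat) : set 'rV[R]_d :=
  ball (map_mx (ratr : rat -> R) k.1) (k.2.+1%:R^-1 : R).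
pose P (k : 'rV[rat]_d * nat) : set 'rV[R]_d :=
  if `[< Q k `<=` U >] then Q k else set0.
have -> : U = \bigcup_k P k.
  apply/seteqP; split => [x Ux|x [k _]]; last first.
    by rewrite /P; case: asboolP => // + Qx; exact.
  have /nbhs_ballP[e /= e0 eU] : nbhs x U by exact: open_nbhs_nbhs.
  have [n ne] : exists n : nat, (n.+1%:R^-1 : R) < e / 2.
    have e20 : 0 < e / 2 by rewrite divr_gt0.
    have := near_infty_natSinv_lt (PosNum e20).
    by case=> N _ HN; exists N; exact: HN N (leqnn _).
  have n0 : (0 : R) < n.+1%:R^-1 by [].
  have h (i : 'I_d) : exists q : rat, `|ratr q - x ord0 i| < (n.+1%:R^-1 : R).
    have [q] := @rat_in_itvoo R (x ord0 i - n.+1%:R^-1) (x ord0 i + n.+1%:R^-1)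
      ltac:(by rewrite ltrBlDr -addrA ltrDl addr_gt0).
    by rewrite in_itv/= => /andP[q1 q2]; exists q; rewrite ltr_norml ltrBrDl q1 ltrBlDl.
  have [q qx] := choice h.
  exists (\row_i q i, n) => //; rewrite /P ifT.
    split=> // i j; rewrite ord1 !mxE /ball/=; exact: qx.
  apply/asboolP => y [_ Qy]; apply: eU.
  split=> // i j; rewrite ord1; have := Qy ord0 j; rewrite !mxE /ball /= => yq.
  have := qx j => qj.
  rewrite (le_lt_trans (ler_distD (ratr (q j)) _ _))//.
  rewrite (splitr e) ltrD//; last exact: lt_trans yq ne.
  by rewrite distrC; exact: lt_trans qj ne.
rewrite preimage_bigcup.
apply: countable_bigcupT_measurable => // k; rewrite /P; case: ifP => _; last first.
  by rewrite preimage_set0.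
have -> : f @^-1` Q k = \bigcap_(i in [set: 'I_d])
   ((fun x => f x ord0 i) @^-1` ball (ratr (k.1 ord0 i) : R) (k.2.+1%:R^-1 : R)).
  apply/seteqP; split => x /=.
    by move=> [_ +] i _; move=> /(_ ord0 i); rewrite !mxE.
  by move=> h; split => // i j; rewrite ord1 mxE; exact: h.
apply: fin_bigcap_measurable => // i _.
rewrite -[X in measurable X]setTI; apply: mf => //.
by apply: open_measurable; exact: ball_open.
Qed.

Section lebesgue_step.
Variables (R : realType) (n : nat).
Variable m1 : {sigma_finite_measure set (measurableTypeR R) -> \bar R}.
Variable m : {sigma_finite_measure set 'rV[R]_n -> \bar R}.

Definition cons_rV (p : measurableTypeR R * 'rV[R]_n) : 'rV[R]_n.+1 :=
  \row_i oapp (p.2 ord0) p.1 (unlift ord0 i).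

Definition uncons_rV (x : 'rV[R]_n.+1) : measurableTypeR R * 'rV[R]_n :=
  (x ord0 ord0, \row_i x ord0 (lift ord0 i)).

Lemma cons_rVK : cancel cons_rV uncons_rV.
Proof.
move=> [a y]; rewrite /uncons_rV /cons_rV mxE unlift_none/=; congr pair.
by apply/rowP => i; rewrite !mxE liftK.
Qed.

Lemma uncons_rVK : cancel uncons_rV cons_rV.
Proof.
move=> x; apply/rowP => i; rewrite !mxE; case: unliftP => [j ->|->]//=.
by rewrite mxE.
Qed.

Lemma measurable_cons_rV : measurable_fun setT cons_rV.
Proof.
apply: measurable_fun_rV => i; rewrite /cons_rV.
under eq_fun do rewrite mxE.
case: unlift => [j|]/=; last exact: measurable_fst.
exact: (measurableT_comp (measurable_coord j) measurable_snd).
Qed.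

Lemma measurable_uncons_rV : measurable_fun setT uncons_rV.
Proof.
apply/measurable_fun_pairP; split; first exact: measurable_coord.
apply: measurable_fun_rV => i; rewrite /comp/=.
under eq_fun do rewrite mxE.
exact: measurable_coord.
Qed.

Definition lebesgue_step : set 'rV[R]_n.+1 -> \bar R :=
  pushforward (m1 \x m)%E cons_rV.


Let lebesgue_step0 : lebesgue_step set0 = 0%E.
Proof. by rewrite /lebesgue_step /pushforward preimage_set0 measure0. Qed.

Let lebesgue_step_ge0 A : (0 <= lebesgue_step A)%E.
Proof. by rewrite /lebesgue_step /pushforward; exact: (measure_ge0 (m1 \x m)%E). Qed.

Let lebesgue_step_sigma_additive : semi_sigma_additive lebesgue_step.
Proof.
have mc (A : set 'rV[R]_n.+1) : measurable A -> measurable (cons_rV @^-1` A).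
  by move=> mA; rewrite -[X in measurable X]setTI; exact: measurable_cons_rV.
move=> F mF tF mUF; rewrite /lebesgue_step /pushforward preimage_bigcup.
apply: measure_semi_sigma_additive; first by move=> i; exact: mc.
- apply/trivIsetP => /= i j _ _ ij; rewrite -preimage_setI.
  by move/trivIsetP : tF => /(_ _ _ _ _ ij) ->//; rewrite preimage_set0.
- by rewrite -preimage_bigcup; exact: mc.
Qed.

HB.instance Definition _ := isMeasure.Build _ _ _ lebesgue_step
  lebesgue_step0 lebesgue_step_ge0 lebesgue_step_sigma_additive.

Let lebesgue_step_sigma_finite : sigma_finite setT lebesgue_step.
Proof.
have /sigma_finiteP[F [TF ndF Foo]] := sigma_finiteT m1.
have /sigma_finiteP[G [TG ndG Goo]] := sigma_finiteT m.
exists (fun k => uncons_rV @^-1` (F k `*` G k)).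
  rewrite -preimage_bigcup (_ : \bigcup_k _ = setT) ?preimage_setT//.
  rewrite -subTset => -[x y] _.
  have [k _ Fkx] : (\bigcup_k F k) x by rewrite -TF.
  have [l _ Gly] : (\bigcup_k G k) y by rewrite -TG.
  exists (maxn k l) => //; split => /=.
  - by move: x Fkx; exact/subsetPset/ndF/leq_maxl.
  - by move: y Gly; exact/subsetPset/ndG/leq_maxr.
move=> k; have [mF Fy] := Foo k; have [mG Gy] := Goo k; split.
  rewrite -[X in measurable X]setTI; apply: measurable_uncons_rV => //.
  exact: measurableX.
rewrite /lebesgue_step /pushforward -comp_preimage.
rewrite (_ : uncons_rV \o cons_rV = id); last by apply/funext => x; exact: cons_rVK.
by rewrite preimage_id product_measure1E// lte_mul_pinfty// ge0_fin_numE.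
Qed.

HB.instance Definition _ := Measure_isSigmaFinite.Build _ _ _ lebesgue_step
  lebesgue_step_sigma_finite.

End lebesgue_step.

(* d-dimensional Lebesgue measure, as an iterated product. *)
Fixpoint lebesgue_rV (R : realType) (d : nat) :
    {sigma_finite_measure set 'rV[R]_d -> \bar R} :=
  match d with
  | 0 => [the {sigma_finite_measure set 'rV[R]_0 -> \bar R} of \d_(0 : 'rV[R]_0)]
  | n.+1 => [the {sigma_finite_measure set 'rV[R]_n.+1 -> \bar R} of
              lebesgue_step lebesgue_measure (lebesgue_rV R n)]
  end.

Lemma lebesgue_rV_box (R : realType) (d : nat) (a b : 'rV[R]_d) :
  (forall i, a ord0 i <= b ord0 i) ->
  lebesgue_rV R d [set x | forall i, a ord0 i < x ord0 i <= b ord0 i]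
  = (\prod_i (b ord0 i - a ord0 i))%:E.
Proof.
elim: d a b => [|n IH] a b ab.
  by rewrite big_ord0/= diracE mem_set//=; case.
pose a' : 'rV[R]_n := \row_i a ord0 (lift ord0 i).
pose b' : 'rV[R]_n := \row_i b ord0 (lift ord0 i).
pose S := [set x : 'rV[R]_n | forall i, a' ord0 i < x ord0 i <= b' ord0 i].
have mS : measurable S.
  rewrite (_ : S = \bigcap_(i in [set: 'I_n])
      ((fun x : 'rV[R]_n => x ord0 i) @^-1` `]a' ord0 i, b' ord0 i])).
    apply: fin_bigcap_measurable => // i _; rewrite -[X in measurable X]setTI.
    exact: measurable_coord.
  apply/seteqP; split => x h i /=; first by move=> _; rewrite in_itv; exact: h.
  by have := h i Logic.I; rewrite /= in_itv.
transitivity ((lebesgue_measure \x lebesgue_rV R n)%E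
    (`]a ord0 ord0, b ord0 ord0] `*` S)).
  congr (product_measure1 _ _ _); apply/seteqP; split => -[x y] /=.
    move=> h; split; first by have := h ord0; rewrite mxE unlift_none in_itv.
    by move=> i; have := h (lift ord0 i); rewrite !mxE liftK.
  move=> [hx hy] i; rewrite mxE; case: unliftP => [j ->|->]/=.
    by have := hy j; rewrite !mxE.
  by move: hx; rewrite in_itv.
rewrite product_measure1E// IH; last by move=> i; rewrite !mxE.
rewrite [X in (X * _)%E](_ : _ = (b ord0 ord0 - a ord0 ord0)%:E); last first.
  apply: (etrans (@lebesgue_measure_itv R `]a ord0 ord0, b ord0 ord0]%R)).
  rewrite /= lte_fin; case: ltP => [_|ba]//.
  have /eqP -> : b ord0 ord0 == a ord0 ord0 by rewrite eq_le ba ab.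
  by rewrite subrr.
by rewrite big_ord_recl -EFinM; under [in LHS]eq_bigr do rewrite !mxE.
Qed.

Section calculus.
Context {R : realType} {d : nat}.
Local Notation Rd := 'rV[R]_d.
Implicit Types (E V K : set Rd) (f : Rd -> R).

(* The library norm on 'rV[R]_d is the sup norm, hence a separate Euclidean one. *)
Definition dotp (x y : Rd) : R := \sum_i x ord0 i * y ord0 i.
Definition enorm (x : Rd) : R := Num.sqrt (dotp x x).

(* M acting on the column vector x^T, the result being written as a row. *)
Definition mx_apply (M : 'M[R]_d) (x : Rd) : Rd := x *m M^T.

Definition sym_part (M : 'M[R]_d) : 'M[R]_d := 2^-1 *: (M + M^T).

Definition partial_derivative (i : 'I_d) f : Rd -> R :=
  fun x => 'D_(delta_mx ord0 i) f x.

Definition grad f (x : Rd) : Rd := \row_i partial_derivative i f x.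

Fixpoint Ck (k : nat) f : Prop :=
  match k with
  | 0 => continuous f
  | k'.+1 => (forall i x, derivable f x (delta_mx ord0 i)) /\
             (forall i, Ck k' (partial_derivative i f))
  end.

Definition smooth f := forall k, Ck k f.

Definition supp E f : set Rd := closure (E `&` [set x | f x != 0]).

(* C_0^oo(E): for E open, f is the extension by zero of the test function; for
   E closed, f stands for its restriction to E.  Only f on E and its gradient
   off the boundary of E matter below, since mu does not charge the boundary
   of a closed E. *)
Definition test_fun E f :=
  [/\ smooth f, compact (supp setT f) & open E -> supp setT f `<=` E].

(* V relatively open in E, with compact closure contained in E *)
Definition rel_compact_open E V :=
  [/\ exists2 U, open U & V = E `&` U, compact (closure V) & closure V `<=` E].

Definition exhaustion E (V_ : nat -> set Rd) :=
  [/\ forall n, rel_compact_open E (V_ n),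
      forall n, closure (V_ n) `<=` V_ n.+1
    & \bigcup_n V_ n = E].

Definition open_or_closed_null_boundary E :=
  open E \/ (closed E /\ lebesgue_rV R d (closure E `\` E°) = 0%E).

Definition L1loc (m : {measure set Rd -> \bar R}) E f :=
  forall K, compact K -> K `<=` E -> m.-integrable K (EFin \o f).

Definition L2loc (m : {measure set Rd -> \bar R}) E f :=
  forall K, compact K -> K `<=` E ->
    measurable_fun K f /\ m.-integrable K (fun x => (f x ^+ 2)%:E).

Definition Linfloc (m : {measure set Rd -> \bar R}) E f :=
  forall K, compact K -> K `<=` E -> measurable_fun K f /\
    exists M : R, {ae m, forall x, K x -> `|f x| <= M}.

End calculus.

(* Every measure mu below satisfies mu (~` E) = 0, so L^p(E, mu) is
   represented by functions on the whole of R^d, up to mu-a.e. equality, and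
   L^p(V, mu) by those vanishing mu-a.e. outside V.  Operators on these spaces
   are maps on representatives. *)
Section Lp_operators.
Context {R : realType} {d : nat}.
Local Notation Rd := 'rV[R]_d.
Variable mu : {sigma_finite_measure set Rd -> \bar R}.
Local Notation F := (Rd -> R).
Implicit Types (p : \bar R) (V : set Rd) (f g u w : F) (S : F -> F).

Definition Lp_on p V f :=
  f \in Lfun mu p /\ {ae mu, forall x, ~ V x -> f x = 0}.

Definition Lp_cvg p (f_ : nat -> F) f :=
  'N[mu]_p[(fun x => (f_ n x - f x)%:E)]%E @[n --> \oo] --> 0%E.

Definition ae_bounded f := exists M : R, {ae mu, forall x, `|f x| <= M}.

(* support in E of the measure |u| dmu *)
Definition msupp (E : set Rd) u : set Rd :=
  [set x | E x /\ forall U, open U -> U x ->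
             (0 < \int[mu]_(y in E `&` U) `|u y|%:E)%E].

Definition linear_contraction p V S :=
  [/\ forall f, Lp_on p V f -> Lp_on p V (S f),
      forall (c : R) f g, Lp_on p V f -> Lp_on p V g ->
        S (fun x => c * f x + g x) = (fun x => c * S f x + S g x) %[ae mu]
    & forall f, Lp_on p V f -> ('N[mu]_p[EFin \o S f] <= 'N[mu]_p[EFin \o f])%E].

Definition sub_markovian p V S :=
  forall f, Lp_on p V f -> {ae mu, forall x, 0 <= f x <= 1} ->
    {ae mu, forall x, 0 <= S f x <= 1}.

Definition sub_markovian_C0_resolvent p V (G : R -> F -> F) :=
  [/\ forall a, 0 < a -> linear_contraction p V (fun f x => a * G a f x),
      forall a, 0 < a -> sub_markovian p V (fun f x => a * G a f x),
      forall a b f, 0 < a -> 0 < b -> Lp_on p V f ->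
        (fun x => G a f x - G b f x) = (fun x => (b - a) * G a (G b f) x) %[ae mu]
    & forall f, Lp_on p V f ->
        'N[mu]_p[(fun x => (a * G a f x - f x)%:E)]%E @[a --> +oo] --> 0%E].

Definition sub_markovian_C0_semigroup p V (T : R -> F -> F) :=
  [/\ forall t, 0 < t -> linear_contraction p V (T t),
      forall t, 0 < t -> sub_markovian p V (T t),
      forall s t f, 0 < s -> 0 < t -> Lp_on p V f ->
        T (s + t) f = T s (T t f) %[ae mu]
    & forall f, Lp_on p V f ->
        'N[mu]_p[(fun x => (T t f x - f x)%:E)]%E @[t --> 0^'+] --> 0%E].

(* Unbounded operators on L^1(V, mu) are given by their graphs. *)
Definition graph_closure V (L : F -> F -> Prop) u w :=
  [/\ Lp_on 1 V u, Lp_on 1 V w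
    & exists u_ w_ : nat -> F,
        [/\ forall n, L (u_ n) (w_ n), Lp_cvg 1 u_ u & Lp_cvg 1 w_ w]].

Definition graph_closable V (L : F -> F -> Prop) :=
  forall w, graph_closure V L (cst 0) w -> w = cst 0 %[ae mu].

(* G a = (a - L)^-1 on L^1(V, mu), for the operator L with the given graph *)
Definition resolvent_of V (L : F -> F -> Prop) (G : R -> F -> F) :=
  forall a, 0 < a ->
    (forall f, Lp_on 1 V f -> L (G a f) (fun x => a * G a f x - f x)) /\
    (forall u w, L u w -> G a (fun x => a * u x - w x) = u %[ae mu]).

Definition resolvent_generator V (G : R -> F -> F) u w :=
  [/\ Lp_on 1 V u, Lp_on 1 V w
    & forall a, 0 < a -> u = G a (fun x => a * u x - w x) %[ae mu]].

(* G a f = \int_0^oo exp(-a t) T_t f dt; the L^1-valued integral is identified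
   through its integrals over all measurable sets *)
Definition resolvent_of_semigroup V (T G : R -> F -> F) :=
  forall a f (S : set Rd), 0 < a -> Lp_on 1 V f -> measurable S ->
    \int[mu]_(x in S) G a f x =
    \int[lebesgue_measure]_(t in `]0, +oo[)
       (expR (- (a * t)) * \int[mu]_(x in S) T t f x).

(* \int_0^N T_t f dt, the L^1-valued integral being identified as above *)
Definition time_integral V (T : R -> F -> F) (N : R) f : F :=
  get [set h | Lp_on 1 V h /\ forall S : set Rd, measurable S ->
    \int[mu]_(x in S) h x =
    \int[lebesgue_measure]_(t in `]0, N]) \int[mu]_(x in S) T t f x].

Definition potential V (T : R -> F -> F) f (x : Rd) : \bar R :=
  limn (fun N : nat => (time_integral V T N%:R f x)%:E).

Definition transient E (T : R -> F -> F) :=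
  exists g, [/\ Lp_on 1 E g, {ae mu, forall x, E x -> 0 < g x}
    & {ae mu, forall x, E x -> (potential E T g x < +oo)%E}].

Definition recurrent E (T : R -> F -> F) :=
  forall f, Lp_on 1 E f -> {ae mu, forall x, E x -> 0 <= f x} ->
    {ae mu, forall x, E x -> potential E T f x = 0%E \/ potential E T f x = +oo%E}.

Definition weakly_invariant E (T : R -> F -> F) (B0 : set Rd) :=
  [/\ measurable B0, B0 `<=` E
    & forall t f, 0 < t -> Lp_on 2%:E E f ->
        {ae mu, forall x, (E `\` B0) x -> T t (fun y => f y * \1_B0 y) x = 0}].

Definition strictly_irreducible E (T : R -> F -> F) :=
  forall B0, weakly_invariant E T B0 -> mu B0 = 0%E \/ mu (E `\` B0) = 0%E.

End Lp_operators.

Section forms.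
Context {R : realType} {d : nat}.
Local Notation Rd := 'rV[R]_d.
Variables (mu : {sigma_finite_measure set Rd -> \bar R}) (E : set Rd).
Variables (A : Rd -> 'M[R]_d) (B : Rd -> Rd).
Local Notation F := (Rd -> R).
Implicit Types (V : set Rd) (f g u v w h : F).

Definition locally_elliptic :=
  forall V, rel_compact_open E V -> exists2 nu : R, 0 < nu &
    forall x (xi : Rd), V x ->
      nu^-1 * enorm xi ^+ 2
        <= \sum_i \sum_j sym_part (A x) i j * xi ord0 i * xi ord0 j
        <= nu * enorm xi ^+ 2.

Definition form0 f g : R :=
  \int[mu]_(x in E) dotp (mx_apply (A x) (grad f x)) (grad g x).

Definition form0_cauchy (f_ : nat -> F) :=
  forall e : R, 0 < e -> exists N, forall m n, (N <= m)%N -> (N <= n)%N ->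
    form0 (f_ m \- f_ n) (f_ m \- f_ n) < e.

Definition strong_sector :=
  exists2 K : R, 0 < K & forall f g, test_fun E f -> test_fun E g ->
    `|form0 f g| <= K * Num.sqrt (form0 f f) * Num.sqrt (form0 g g).

Definition form0_closable :=
  forall f_ : nat -> F, (forall n, test_fun E (f_ n)) -> form0_cauchy f_ ->
    Lp_cvg mu 2%:E f_ (cst 0) -> form0 (f_ n) (f_ n) @[n --> \oo] --> (0 : R).

(* f_ in C_0^oo(V) approximates u in the norm of the form plus L^2 *)
Definition form_approx V (f_ : nat -> F) u :=
  [/\ forall n, test_fun E (f_ n) /\ supp E (f_ n) `<=` V,
      form0_cauchy f_, u \in Lfun mu 2%:E & Lp_cvg mu 2%:E f_ u].

(* domain and values of the closure of the form restricted to C_0^oo(V); the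
   unrestricted closed form is the case V = E *)
Definition form_dom V u := exists f_ : nat -> F, form_approx V f_ u.

Definition form V u v : R :=
  get [set e : R | exists f_ g_ : nat -> F, [/\ form_approx V f_ u,
    form_approx V g_ v & form0 (f_ n) (g_ n) @[n --> \oo] --> e]].

Definition form_dom_loc u := exists2 V, rel_compact_open E V & form_dom V u.

Definition wgrad u : Rd -> Rd :=
  get [set G : Rd -> Rd | measurable_fun setT G /\
    exists2 f_ : nat -> F, form_approx E f_ u &
      forall K, compact K -> K `<=` E ->
        (\int[mu]_(x in K) (enorm (grad (f_ n) x - G x) ^+ 2)%R%:E)%E
          @[n --> \oo] --> 0%E].

(* weak gradient of functions that belong to the form domain locally *)
Definition is_wgrad_loc u (G : Rd -> Rd) :=
  measurable_fun setT G /\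
  forall V, rel_compact_open E V -> exists2 w, form_dom E w &
    {ae mu, forall x, V x -> u x = w x /\ G x = wgrad w x}.

(* graph of the generator on L^2(V, mu) of the form with domain [form_dom V] *)
Definition form_generator V u h :=
  [/\ form_dom V u, Lp_on mu 2%:E V h
    & forall v, form_dom V v -> form V u v = - \int[mu]_x (h x * v x)].

Definition drift_operator V u w :=
  [/\ ae_bounded mu u, Lp_on mu 1 V w
    & exists2 h, form_generator V u h &
        w = (fun x => h x + dotp (B x) (wgrad u x)) %[ae mu]].

Definition divergence_free :=
  forall f, test_fun E f -> \int[mu]_(x in E) dotp (B x) (grad f x) = 0.

Definition gen_dom_0b u :=
  [/\ exists h, form_generator E u h, ae_bounded mu u & compact (msupp mu E u)].

Definition gen_dom_0b_dense :=
  (forall u, gen_dom_0b u -> Lp_on mu 1 E u) /\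
  forall f (e : R), Lp_on mu 1 E f -> 0 < e ->
    exists2 u, gen_dom_0b u & ('N[mu]_1[(fun x => (f x - u x)%:E)] < e%:E)%E.

(* GV V is the resolvent of the L^1(V, mu)-closure of the operator
   L^{0,V} + <B, grad> with domain D(L^{0,V})_b *)
Definition local_resolvents (GV : set Rd -> R -> F -> F) :=
  forall V, rel_compact_open E V ->
    [/\ graph_closable mu V (drift_operator V),
        sub_markovian_C0_resolvent mu 1 V (GV V)
      & resolvent_of mu V (graph_closure mu V (drift_operator V)) (GV V)].

Definition limit_resolvent (GV : set Rd -> R -> F -> F) (G : R -> F -> F) :=
  forall (V_ : nat -> set Rd) a f, exhaustion E V_ -> 0 < a -> Lp_on mu 1 E f ->
    {ae mu, forall x, E x ->
      GV (V_ n) a (fun y => f y * \1_(V_ n) y) x @[n --> \oo] --> G a f x}.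

Definition extends_drift_operator (L : F -> F -> Prop) :=
  forall u w, gen_dom_0b u -> drift_operator E u w -> L u w.

Definition bounded_dom_identities (L : F -> F -> Prop) :=
  forall u w, L u w -> ae_bounded mu u ->
    [/\ form_dom E u,
        forall v, form_dom_loc v -> ae_bounded mu v ->
          form E u v - \int[mu]_(x in E) (dotp (B x) (wgrad u x) * v x)
            = - \int[mu]_(x in E) (w x * v x)
      & form E u u <= - \int[mu]_(x in E) (w x * u x)].

End forms.

Section volume.
Context {R : realType} {d : nat}.
Local Notation Rd := 'rV[R]_d.
Variables (mu : {sigma_finite_measure set Rd -> \bar R}) (E : set Rd).
Variables (A : Rd -> 'M[R]_d) (B : Rd -> Rd) (rho : Rd -> R) (grho : Rd -> Rd).

Definition sublevel (r : R) : set Rd := E `&` [set x | rho x < r].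

Definition vol1 (r : R) : R :=
  \int[mu]_(x in sublevel r) dotp (mx_apply (A x) (grho x)) (grho x).

Definition vol2 (r : R) : R :=
  \int[mu]_(x in sublevel r) (rho x * `|dotp (B x) (grho x)|).

Definition vol (r : R) : R := vol1 r + vol2 r.

Definition vol_seq (n : nat) : R :=
  \int[lebesgue_measure]_(r in `[1, n%:R]) (r / vol r).

End volume.

(* Main.v *)
(* Suppose that the semigroup is transient, with potential finite on some g > 0.
   Cutting g off at 1 and restricting it to a part of {rho < 1} on which its
   potential is bounded gives f >= 0, f <> 0, such that the resolvents
   u_a = G_a f are bounded by a constant M uniformly in a > 0: the potential of g
   bounds them on {f > 0}, hence everywhere by the maximum principle.  Testing
   a u_a - L u_a = f against g in C_0^oo(E) with 0 <= g <= 1, the sector condition,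
   E^0(u_a, u_a) <= M \int f and the integration by parts of the divergence free
   drift give
     \int f g <= S (M \int f)^(1/2) E^0(g, g)^(1/2) + M \int |<B, grad g>|
                 + a M \int g.
   Letting a -> 0, this is absurd if there are such g, close to 1 in
   L^2({rho < 1}), with E^0(g, g) and \int |<B, grad g>| arbitrarily small.

   Take g = psi(rho), where psi = 1 on r <= 1, psi = 0 on r >= 2^N and
   |psi'| <= C 2^k / (S_N v(2^(k+1))) on [2^k, 2^(k+1)[, with
   S_N = \sum_(k < N) 4^k / v(2^(k+1)).  Then E^0(g, g) <= C^2 / S_N and
   \int |<B, grad g>| <= (C / S_N) \sum_(k < N) (v_2(2^(k+1)) - v_2(2^k)) / v(2^(k+1)),
   and the last sum telescopes to at most log(v_2(2^N) \/ 1) up to a constant, while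
   S_N dominates a_(2^N).  Since rho is only a limit of test functions f_n locally,
   g is replaced by eta psi(f_n) with a smooth cutoff eta.

   For the second claim, the complements of {Gf = 0} and of {Gf < oo} are weakly
   invariant; if the dichotomy failed under irreducibility, G_1 f would be positive
   with a finite potential, i.e. the semigroup would be transient. *)
Require Import Defs.
From HB Require Import structures.
From mathcomp Require Import all_boot all_order all_algebra.
From mathcomp Require Import all_classical all_reals all_analysis.
From mathcomp Require Import measurable_realfun ring lra.
Set Implicit Arguments.
Unset Strict Implicit.
Unset Printing Implicit Defensive.
Import Order.TTheory GRing.Theory Num.Theory.
Import numFieldNormedType.Exports.
Local Open Scope classical_set_scope.
Local Open Scope ring_scope.

(** * Integrals of real-valued functions *)

(** What is known of the generator is two identities for bounded elements of its domain, so a bound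
    on [G a f] uniform in [a] is what makes them usable as [a] tends to 0. The weights of the
    profile are [w k = 4^k / (V k * S_N)] with [V k = v (2^(k+1))]: the energy of the k-th shell is
    then at most [C^2 * w k / S_N], and the normalisation of the weights bounds the total. In the
    drift sum the denominator v is replaced by [v_1 1 + v_2], which stays positive where v_2
    vanishes and makes each term an increment of a logarithm at most. A recurring obstacle is that
    operators act on representatives and that L^1-valued time integrals are known only through
    integrals over sets. Inequalities between them are proved after integration over an arbitrary
    measurable set and then made pointwise a.e.; only the parameters [1 / (n + 1)] are used in the
    end, so that one null set suffices. The closed form and the weak gradient are values chosen by
    [get], whence the lemmas that identify them as limits along test functions. *)

Section real_integrals.
Context d0 (T : measurableType d0) (R : realType).
Variable mu : {measure set T -> \bar R}.
Implicit Types (D S : set T) (f g h : T -> R).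

Lemma aeI (P Q : T -> Prop) : {ae mu, forall x, P x} -> {ae mu, forall x, Q x} ->
  {ae mu, forall x, P x /\ Q x}.
Proof. by apply: filterS2 => x. Qed.

Lemma integrable_real_measurable D f :
  mu.-integrable D (EFin \o f) -> measurable_fun D f.
Proof. by move=> /integrableP[/measurable_EFinP]. Qed.

Lemma integrable_realB D f g : measurable D ->
  mu.-integrable D (EFin \o f) -> mu.-integrable D (EFin \o g) ->
  mu.-integrable D (EFin \o (fun x => f x - g x)).
Proof. by move=> mD fi gi; exact: (integrableB mD fi gi). Qed.

Lemma integrable_realD D f g : measurable D ->
  mu.-integrable D (EFin \o f) -> mu.-integrable D (EFin \o g) ->
  mu.-integrable D (EFin \o (fun x => f x + g x)).
Proof. by move=> mD fi gi; exact: (integrableD mD fi gi). Qed.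

Lemma integrable_realZ D (c : R) f : measurable D ->
  mu.-integrable D (EFin \o f) ->
  mu.-integrable D (EFin \o (fun x => c * f x)).
Proof. by move=> mD fi; exact: (integrableZl mD c fi). Qed.

Lemma le_integrable_real D f g : measurable D -> measurable_fun D f ->
  (forall x, D x -> `|f x| <= g x) ->
  mu.-integrable D (EFin \o g) -> mu.-integrable D (EFin \o f).
Proof.
move=> mD mf fg; apply: (le_integrable mD); first exact/measurable_EFinP.
by move=> x Dx; rewrite /= lee_fin (le_trans (fg x Dx))// ler_norm.
Qed.

Lemma integrable_real_abs D f : measurable D -> mu.-integrable D (EFin \o f) ->
  mu.-integrable D (EFin \o (fun x => `|f x|)).
Proof.
move=> mD fi; apply: (le_integrable mD _ _ fi) => [|x Dx /=].
  by apply/measurable_EFinP/measurableT_comp => //; exact: integrable_real_measurable.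
by rewrite lee_fin normr_id.
Qed.

Lemma integral_EFin D f : measurable D -> mu.-integrable D (EFin \o f) ->
  (\int[mu]_(x in D) (f x)%:E)%E = (\int[mu]_(x in D) f x)%:E.
Proof. by move=> mD fi; rewrite /Rintegral fineK//; exact: integrable_fin_num. Qed.

Lemma ge0_Rintegral_integrable D f (M : R) : measurable D -> measurable_fun D f ->
  (forall x, D x -> 0 <= f x) -> (\int[mu]_(x in D) (f x)%:E <= M%:E)%E ->
  mu.-integrable D (EFin \o f).
Proof.
move=> mD mf f0 fM; apply/integrableP; split; first exact/measurable_EFinP.
rewrite (le_lt_trans _ (ltry M))// (le_trans _ fM)// le_eqVlt; apply/orP; left.
by apply/eqP; apply: eq_integral => x /set_mem Dx; rewrite /= ger0_norm// f0.
Qed.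

Lemma eq_ae_Rintegral D f g : measurable D -> measurable_fun D f ->
  measurable_fun D g -> {ae mu, forall x, D x -> f x = g x} ->
  \int[mu]_(x in D) f x = \int[mu]_(x in D) g x.
Proof.
move=> mD mf mg fg; rewrite /Rintegral; congr fine.
apply: ae_eq_integral => //; [exact/measurable_EFinP|exact/measurable_EFinP|].
by apply: filterS fg => x h Dx; rewrite h.
Qed.

Lemma le_ae_Rintegral D f g : measurable D ->
  mu.-integrable D (EFin \o f) -> mu.-integrable D (EFin \o g) ->
  {ae mu, forall x, D x -> f x <= g x} ->
  \int[mu]_(x in D) f x <= \int[mu]_(x in D) g x.
Proof.
move=> mD fi gi fg.
have mf := integrable_real_measurable fi; have mg := integrable_real_measurable gi.
(* The maximum dominates [f] everywhere and equals [g] a.e., so the pointwise comparison of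
   integrals applies. *)
have mxi : measurable_fun D (fun x => Num.max (f x) (g x)) by exact: measurable_maxr.
have E : \int[mu]_(x in D) g x = \int[mu]_(x in D) Num.max (f x) (g x).
  apply: eq_ae_Rintegral => //; apply: filterS fg => x h Dx.
  by apply/esym/max_idPr; exact: h.
rewrite E; apply: le_Rintegral => //; last by move=> x _; rewrite le_max lexx.
apply: (le_integrable_real (g := fun x => `|f x| + `|g x|)) => //.
  by move=> x Dx; case: (leP (f x) (g x)) => _; rewrite ?lerDl ?lerDr.
by apply: integrable_realD => //; exact: integrable_real_abs.
Qed.

Lemma Rintegral_eq0_ae D f : measurable D -> mu.-integrable D (EFin \o f) ->
  (forall x, D x -> 0 <= f x) -> \int[mu]_(x in D) f x <= 0 ->
  {ae mu, forall x, D x -> f x = 0}.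
Proof.
move=> mD fi f0 i0; have mf := integrable_real_measurable fi.
have E : (\int[mu]_(x in D) `|(f x)%:E|)%E = 0%E.
  rewrite -[RHS](_ : (\int[mu]_(x in D) f x)%:E = _); last first.
    by congr EFin; apply/eqP; rewrite eq_le i0 Rintegral_ge0.
  rewrite -integral_EFin//; apply: eq_integral => x /set_mem Dx.
  by rewrite gee0_abs// lee_fin f0.
have mEf : measurable_fun D (EFin \o f) by exact/measurable_EFinP.
have := (ae_eq_integral_abs mu mD mEf).1 E.
by apply: filterS => x h Dx; have := h Dx => -[].
Qed.

(** The integral over the set [g < f] forces [f - g] to vanish there a.e. Time integrals and
    resolvents of the semigroup are specified by their integrals over sets; this turns such
    specifications into a.e. inequalities. *)
Lemma ae_le_of_Rintegral f g : mu.-integrable setT (EFin \o f) ->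
  mu.-integrable setT (EFin \o g) ->
  (forall S, measurable S -> \int[mu]_(x in S) f x <= \int[mu]_(x in S) g x) ->
  {ae mu, forall x, f x <= g x}.
Proof.
move=> fi gi fg.
have mf := integrable_real_measurable fi; have mg := integrable_real_measurable gi.
pose S := [set x | g x < f x].
have mS : measurable S.
  rewrite [X in measurable X](_ : S = (fun x => f x - g x) @^-1` `]0, +oo[); last first.
    by apply/seteqP; split => x; rewrite /S /= in_itv/= andbT subr_gt0.
  by rewrite -[X in measurable X]setTI; apply: measurable_funB.
have fiS : mu.-integrable S (EFin \o f) by exact: integrableS fi.
have giS : mu.-integrable S (EFin \o g) by exact: integrableS gi.
have : {ae mu, forall x, S x -> f x - g x = 0}.
  apply: Rintegral_eq0_ae => //; first exact: integrable_realB.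
    by move=> x; rewrite /S /= subr_ge0 => /ltW.
  by rewrite RintegralB// subr_le0 fg.
apply: filterS => x h; rewrite leNgt; apply/negP => gf.
by have := h gf; move/eqP; rewrite subr_eq0 => /eqP E; rewrite E ltxx in gf.
Qed.

(** The sum of the whole series has integral at most [M] by monotone convergence, hence is finite
    a.e. *)
Lemma ae_bounded_sum (f : nat -> T -> R) (M : R) :
  (forall n, mu.-integrable setT (EFin \o f n)) ->
  (forall n x, 0 <= f n x) ->
  (forall n, \sum_(k < n) \int[mu]_x f k x <= M) ->
  {ae mu, forall x, exists C, forall n, \sum_(k < n) f k x <= C}.
Proof.
move=> fi f0 fM.
have mf n := integrable_real_measurable (fi n).
pose F x := (\sum_(0 <= k <oo) (f k x)%:E)%E.
have mF : measurable_fun setT F.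
  by apply: ge0_emeasurable_sum => // [k x _ _|k _]; [rewrite lee_fin|exact/measurable_EFinP].
have F0 x : (0 <= F x)%E by apply: nneseries_ge0 => k _ _; rewrite lee_fin.
have FM : (\int[mu]_x F x <= M%:E)%E.
  rewrite /F integral_nneseries//=; last 2 first.
    by move=> n; exact/measurable_EFinP.
    by move=> n x _; rewrite lee_fin.
  apply: lime_le.
    by apply: is_cvg_nneseries => n _ _; apply: integral_ge0 => x _; rewrite lee_fin.
  apply: nearW => n.
  rewrite (eq_bigr (fun k => (\int[mu]_x f k x)%:E)); last first.
    by move=> k _; rewrite integral_EFin.
  by rewrite sumEFin lee_fin big_mkord.
have Fi : mu.-integrable setT F.
  apply/integrableP; split => //.
  rewrite (le_lt_trans _ (ltry M))// (le_trans _ FM)// le_eqVlt; apply/orP; left.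
  by apply/eqP; apply: eq_integral => x _; rewrite gee0_abs.
have := integrable_ae measurableT Fi; apply: filterS => x /(_ Logic.I) Fx.
exists (fine (F x)) => n; rewrite -lee_fin fineK// -sumEFin.
rewrite -(big_mkord xpredT (fun k => (f k x)%:E)) /F.
by apply: nneseries_lim_ge => k _ _; rewrite lee_fin.
Qed.

(* Approximating along [e = 2^-n] makes the [L^1] errors summable, hence gives
   convergence a.e. *)
Lemma ae_le_approx (D : set T) f (Y : T -> R) :
  mu.-integrable setT (EFin \o f) ->
  (forall e, 0 < e -> exists g, [/\ mu.-integrable setT (EFin \o g),
     {ae mu, forall x, D x -> g x <= Y x} & \int[mu]_x `|f x - g x| <= e]) ->
  {ae mu, forall x, D x -> f x <= Y x}.
Proof.
move=> fi H.
have e0 n : (0 : R) < (2^-1) ^+ n by rewrite exprn_gt0.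
have [g gP] := choice (fun n => H _ (e0 n)).
have gi n : mu.-integrable setT (EFin \o (fun x => `|f x - g n x|)).
  by apply: integrable_real_abs => //; apply: integrable_realB => //; case: (gP n).
have S : {ae mu, forall x, exists C, forall n, \sum_(k < n) `|f x - g k x| <= C}.
  apply: (@ae_bounded_sum (fun k x => `|f x - g k x|) 2) => // n.
  apply: (@le_trans _ _ (\sum_(k < n) (2^-1 : R) ^+ k)).
    by apply: ler_sum => k _; case: (gP k).
  elim: n => [|n IH]; first by rewrite big_ord0.
  have : \sum_(k < n.+1) (2^-1 : R) ^+ k = 2 - 2 * 2^-1 ^+ n.+1.
    elim: n.+1 => [|m IHm]; first by rewrite big_ord0 expr0 mulr1 subrr.
    by rewrite big_ord_recr/= IHm exprS; field.
  by move=> ->; rewrite lerBlDr lerDl mulr_ge0// ltW.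
have Y' : {ae mu, forall x, forall n, D x -> g n x <= Y x}.
  by apply: ae_foralln => n; case: (gP n).
apply: filterS2 S Y' => x [C hC] hY Dx.
rewrite leNgt; apply/negP => Yf.
(* Each [g n x] stays at least [e] below [f x], so the partial sums, bounded by [C], would be at
   least [n * e]. *)
pose e := f x - Y x; have ep : 0 < e by rewrite subr_gt0.
have lb n : n%:R * e <= C.
  apply: le_trans (hC n); rewrite mulr_natl -[X in _ *+ X]card_ord -sumr_const.
  apply: ler_sum => k _; rewrite (le_trans _ (ler_norm _))// lerB//.
  exact: hY.
have C0 : 0 <= C by have := hC 0; rewrite big_ord0.
have := lb (Num.truncn (C / e)).+1.
rewrite -ler_pdivlMr// leNgt; apply/negP/negPn.
by rewrite truncnS_gt.
Qed.

Lemma dominated_L1 (f_ : nat -> T -> R) f g :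
  (forall n, measurable_fun setT (f_ n)) -> measurable_fun setT f ->
  {ae mu, forall x, f_ n x @[n --> \oo] --> f x} ->
  mu.-integrable setT (EFin \o g) ->
  (forall n, {ae mu, forall x, `|f_ n x| <= g x}) ->
  \int[mu]_x `|f_ n x - f x| @[n --> \oo] --> 0.
Proof.
move=> mf_ mf cf gi fg.
have mEf : measurable_fun setT (EFin \o f) by exact/measurable_EFinP.
have mEf_ n : measurable_fun setT (EFin \o f_ n) by exact/measurable_EFinP.
have cf' : {ae mu, forall x, setT x -> (EFin \o f_ n) x @[n --> \oo] --> (EFin \o f) x}.
  by apply: filterS cf => x h _; apply/fine_cvgP; split; [exact: nearW|exact: h].
have fg' : {ae mu, forall x, forall n, setT x -> (`|(EFin \o f_ n) x| <= (EFin \o g) x)%E}.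
  by apply: ae_foralln => n; apply: filterS (fg n) => x h _; rewrite /= lee_fin.
have [_ cvg0 _] := dominated_convergence measurableT mEf_ mEf cf' gi fg'.
exact: fine_cvg cvg0.
Qed.

Lemma Rintegral_le_norm S f : measurable S -> mu.-integrable setT (EFin \o f) ->
  \int[mu]_(x in S) f x <= \int[mu]_x `|f x|.
Proof.
move=> mS fi; have fiS : mu.-integrable S (EFin \o f) by exact: integrableS fi.
apply: le_trans (ler_norm _) _; apply: le_trans (le_normr_Rintegral mS fiS) _.
rewrite -lee_fin -!integral_EFin//; [|exact: integrable_real_abs..].
apply: ge0_subset_integral => //.
  by apply/measurable_EFinP/measurableT_comp => //; exact: integrable_real_measurable fi.
Qed.

Lemma Rintegral_set_support S f : measurable S -> (forall x, ~ S x -> f x = 0) ->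
  \int[mu]_(x in S) f x = \int[mu]_x f x.
Proof.
move=> mS f0; rewrite Rintegral_mkcond; congr Rintegral; apply/funext => x.
by rewrite patchE; case: ifPn => // /negP Sx; rewrite f0// => /mem_set.
Qed.

Lemma Lnorm2E f : ('N[mu]_2%:E[EFin \o f] `^ 2 = \int[mu]_x (f x ^+ 2)%:E)%E.
Proof.
rewrite powR_Lnorm//; apply: eq_integral => x _ /=.
by rewrite powR_mulrn// real_normK// num_real.
Qed.

Lemma Lfun2P f : f \in Lfun mu 2%:E <->
  measurable_fun setT f /\ mu.-integrable setT (EFin \o (fun x => f x ^+ 2)).
Proof.
split=> [f2|[mf fi]].
  by split; [move: f2; rewrite inE => /andP[]; rewrite inE|exact: Lfun2_integrable_sqr].
rewrite inE; apply/andP; split; rewrite inE//=/finite_norm.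
apply: (@lty_poweRy _ _ 2) => //; rewrite Lnorm2E integral_EFin// ltry.
by [].
Qed.

Lemma le_Lnorm2 f g : ('N[mu]_2%:E[EFin \o f] <= 'N[mu]_2%:E[EFin \o g])%E ->
  (\int[mu]_x (f x ^+ 2)%:E <= \int[mu]_x (g x ^+ 2)%:E)%E.
Proof.
move=> fg; rewrite -!Lnorm2E gt0_ler_poweR// in_itv/= leey Lnorm_ge0//.
Qed.

Lemma Lnorm2_cvg0 (f_ : nat -> T -> R) :
  ('N[mu]_2%:E[EFin \o f_ n])%E @[n --> \oo] --> 0%E ->
  forall e, 0 < e -> \forall n \near \oo, (\int[mu]_x (f_ n x ^+ 2)%:E <= e%:E)%E.
Proof.
move=> /fine_cvgP[fin /cvgrPdist_le cv] e e0.
have se : 0 < Num.sqrt e by rewrite sqrtr_gt0.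
have eE : (e%:E = (Num.sqrt e)%:E `^ 2)%E.
  by rewrite poweR_EFin powR_mulrn ?sqrtr_ge0// sqr_sqrtr// ltW.
near=> n; rewrite -Lnorm2E eE gt0_ler_poweR// ?in_itv/= ?leey ?Lnorm_ge0 ?lee_fin ?sqrtr_ge0//.
have fn : 'N[mu]_2%:E[EFin \o f_ n]%E \is a fin_num by near: n.
rewrite -(fineK fn) lee_fin.
have : `|0 - fine 'N[mu]_2%:E[EFin \o f_ n]%E| <= Num.sqrt e by near: n; exact: cv.
by rewrite sub0r normrN; apply: le_trans; exact: ler_norm.
Unshelve. all: by end_near. Qed.

End real_integrals.

(** * Quantitative L^2 estimates and local L^2 completeness *)

Section L2_tools.
Context d0 (T : measurableType d0) (R : realType).
Variable mu : {measure set T -> \bar R}.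
Implicit Types (D S : set T) (f g h : T -> R).

(** Cauchy-Schwarz in epsilon-delta form, without square roots and with integrability of the product
    included. In Young's inequality [|h k| <= eta h^2 + k^2 / (4 eta)] the weight [eta] makes the
    first term integrate to at most [e / 2], and the threshold [2 * eta * e] does the same for the
    second. *)
Lemma L2_mul_small D h e : measurable D -> measurable_fun D h ->
  mu.-integrable D (EFin \o (fun x => h x ^+ 2)) -> 0 < e ->
  exists2 del, 0 < del & forall k : T -> R, measurable_fun D k ->
    (\int[mu]_(x in D) (k x ^+ 2)%:E <= del%:E)%E ->
    mu.-integrable D (EFin \o (fun x => h x * k x)) /\
    \int[mu]_(x in D) `|h x * k x| <= e.
Proof.
move=> mD mh hi e0; pose H := \int[mu]_(x in D) h x ^+ 2.
have H0 : 0 <= H by apply: Rintegral_ge0 => x _; exact: sqr_ge0.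
have H1 : 0 < H + 1 by rewrite ltr_wpDl.
pose eta := e / 2 / (H + 1).
have eta0 : 0 < eta by rewrite !divr_gt0.
have c0 : 0 < (4 * eta)^-1 by rewrite invr_gt0 mulr_gt0.
exists (2 * eta * e) => [|k mk kd]; first by apply: mulr_gt0 => //; exact: mulr_gt0.
have ki : mu.-integrable D (EFin \o (fun x => k x ^+ 2)).
  apply: ge0_Rintegral_integrable kd => //; first exact: measurable_funX.
  by move=> x _; exact: sqr_ge0.
have K : \int[mu]_(x in D) k x ^+ 2 <= 2 * eta * e by rewrite -lee_fin -integral_EFin//.
have amgm x : `|h x * k x| <= eta * h x ^+ 2 + (4 * eta)^-1 * k x ^+ 2.
  rewrite normrM -(real_normK (num_real (h x))) -(real_normK (num_real (k x))).
  move: `|h x| `|k x| => a b.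
  have -> : eta * a ^+ 2 + (4 * eta)^-1 * b ^+ 2 = a * b + (4 * eta)^-1 * (2 * eta * a - b) ^+ 2.
    by field; rewrite gt_eqF.
  by rewrite lerDl mulr_ge0 ?sqr_ge0// ltW.
have si : mu.-integrable D (EFin \o (fun x => eta * h x ^+ 2 + (4 * eta)^-1 * k x ^+ 2)).
  by apply: integrable_realD => //; exact: integrable_realZ.
have hki : mu.-integrable D (EFin \o (fun x => h x * k x)).
  apply: le_integrable_real si => //; first exact: measurable_funM.
split=> //; apply: (@le_trans _ _ (\int[mu]_(x in D) (eta * h x ^+ 2 + (4 * eta)^-1 * k x ^+ 2))).
  by apply: le_Rintegral => //; exact: integrable_real_abs.
rewrite RintegralD//; [|exact: integrable_realZ..].
rewrite !RintegralZl// -/H.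
have : eta * H <= e / 2.
  by rewrite /eta mulrAC ler_pdivrMr// ler_wpM2l ?lerDl// divr_ge0// ltW.
have : (4 * eta)^-1 * \int[mu]_(x in D) (k x ^+ 2) <= e / 2.
  apply: le_trans (_ : (4 * eta)^-1 * (2 * eta * e) <= _).
    by rewrite ler_wpM2l// ltW.
  by rewrite le_eqVlt; apply/orP; left; apply/eqP; field; rewrite gt_eqF.
lra.
Qed.

Lemma abs_summable_telescope_cvg (u : nat -> R) (j : nat) (C : R) :
  (forall n, \sum_(k < n) `|u (j + k).+1 - u (j + k)%N| <= C) -> cvgn u.
Proof.
move=> uC; pose v n := u (n + j)%N.
suff /cvg_ex[l vl] : cvgn v by apply/cvg_ex; exists l; rewrite -(cvg_shiftn j).
have : cvgn (series (telescope v)).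
  apply: normed_cvg; apply: nondecreasing_is_cvgn.
    by apply: nondecreasing_series => i _ _; exact: normr_ge0.
  exists C => _ [n _ <-]; rewrite /= /series/= big_mkord.
  apply: le_trans (uC n); apply: ler_sum => i _.
  by rewrite (addnC j i); exact: lexx.
rewrite telescopeK => /cvg_ex[/= l vl]; apply/cvg_ex; exists (l + v 0%N).
apply: (cvg_trans _ (cvgD vl (cvg_cst (v 0%N)))).
by apply: near_eq_cvg; apply: nearW => n; exact: subrK.
Qed.

(** Completeness of L^2 on all members of an increasing sequence of sets at once. A fast subsequence
    [H] converges a.e. on each [D j], and Fatou's lemma in the second index carries the Cauchy
    estimate over to the limit, for the full sequence. *)
Lemma Riesz_Fischer2 (D : nat -> set T) (G : nat -> T -> R) :
  (forall j, measurable (D j)) -> (forall j k, (j <= k)%N -> D j `<=` D k) ->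
  (forall n, measurable_fun setT (G n)) ->
  (forall j e, 0 < e -> exists N, forall m n, (N <= m)%N -> (N <= n)%N ->
     (\int[mu]_(x in D j) ((G m x - G n x) ^+ 2)%:E <= e%:E)%E) ->
  exists2 g : T -> R, measurable_fun setT g & forall j e, 0 < e -> exists N, forall n, (N <= n)%N ->
     (\int[mu]_(x in D j) ((G n x - g x) ^+ 2)%:E <= e%:E)%E.
Proof.
move=> mD ndD mG cG.
have e0 k : (0 : R) < 4^-1 ^+ k by rewrite exprn_gt0.
have [N NP] := choice (fun k => cG k _ (e0 k)).
(* Partial sums of [N i + 1] give indices that are monotone and dominate both [N k] and [k]. *)
pose n_ k := (\sum_(i < k.+1) (N i).+1)%N.
have Nn k : (N k <= n_ k)%N by rewrite /n_ big_ord_recr/= (leq_trans (leqnSn _))// leq_addl.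
have kn k : (k <= n_ k)%N.
  elim: k => // k IH; rewrite /n_ big_ord_recr/= -/(n_ k) -addn1 leq_add//.
have n_S k : (n_ k <= n_ k.+1)%N by rewrite {2}/n_ big_ord_recr/= leq_addr.
have n_nd : {homo n_ : m n / (m <= n)%N >-> (m <= n)%N} by apply: homo_leq => //; exact: leq_trans.
pose H k := G (n_ k).
(* The upper limit is measurable everywhere and does not depend on [j], so one function serves all
   the sets; it is the limit wherever a finite limit exists. *)
pose g x := fine (limn_esup (fun k => (H k x)%:E)).
have mg : measurable_fun setT g.
  apply: (measurableT_comp (fine_measurable measurableT)).
  by apply: measurable_fun_limn_esup => k; apply/measurable_EFinP; exact: mG.
have cvH j : {ae mu, forall x, D j x -> H k x @[k --> \oo] --> g x}.
  (* Starting at [j + k] places [D j] inside the set on which the increment is controlled by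
     [4^-(j+k)]. The weight [2^(j+k)] still leaves a summable series, and by Young's inequality the
     weighted squares together with [2^-k] bound the increments themselves. *)
  pose f k x := 2 ^+ (j + k) * ((H (j + k).+1 x - H (j + k)%N x) ^+ 2 * \1_(D j) x).
  have mf k : measurable_fun setT (f k).
    apply: measurable_funM => //; apply: measurable_funM; last exact: measurable_indic.
    by apply: measurable_funX; apply: measurable_funB; exact: mG.
  have f0 k x : 0 <= f k x by rewrite /f mulr_ge0 ?exprn_ge0// mulr_ge0 ?sqr_ge0//.
  have fI k : (\int[mu]_x (f k x)%:E <= (2^-1 ^+ k)%:E)%E.
    have -> : (\int[mu]_x (f k x)%:E = (2 ^+ (j + k))%:E *
        \int[mu]_(x in D j) ((H (j + k).+1 x - H (j + k)%N x) ^+ 2)%:E)%E.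
      have mHH : measurable_fun (D j) (fun x => ((H (j + k).+1 x - H (j + k)%N x) ^+ 2)%:E).
        apply/measurable_EFinP; apply: (measurable_funS measurableT) => //.
        by apply: measurable_funX; apply: measurable_funB; exact: mG.
      have HH0 x : D j x -> (0 <= ((H (j + k).+1 x - H (j + k)%N x) ^+ 2)%:E)%E.
        by move=> _; rewrite lee_fin sqr_ge0.
      have p20 : 0 <= 2 ^+ (j + k) :> R by rewrite exprn_ge0.
      rewrite -(ge0_integralZl_EFin mu (mD j) HH0 mHH p20).
      rewrite [RHS]integral_mkcond; apply: eq_integral => x _.
      rewrite patchE /f indicE; case: ifPn => _; first by rewrite mulr1 EFinM.
      by rewrite !mulr0.
    have : (\int[mu]_(x in D j) ((H (j + k).+1 x - H (j + k)%N x) ^+ 2)%:E <= (4^-1 ^+ (j +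
      k))%:E)%E.
      apply: le_trans (NP (j + k)%N (n_ (j + k).+1) (n_ (j + k)%N) _ _) => //; last first.
        exact: leq_trans (Nn _) (n_S _).
      apply: ge0_subset_integral => //.
      - apply/measurable_EFinP; apply: (measurable_funS measurableT) => //.
        by apply: measurable_funX; apply: measurable_funB; exact: mG.
      - by move=> x _; rewrite lee_fin sqr_ge0.
      - by apply: ndD; exact: leq_addr.
    move=> /(lee_wpmul2l _) => /(_ (2 ^+ (j + k))%:E ltac:(by rewrite lee_fin)) h.
    apply: le_trans h _; rewrite -EFinM lee_fin -exprMn.
    rewrite (_ : 2 * 4^-1 = 2^-1 :> R); last by field.
    by rewrite exprD ler_piMl ?exprn_ge0// exprn_ile1// invf_le1// ler1n.
  have fi k : mu.-integrable setT (EFin \o f k).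
    by apply: ge0_Rintegral_integrable (fI k) => // x _; exact: f0.
  have geo n : \sum_(k < n) (2^-1 : R) ^+ k <= 2.
    have -> : \sum_(k < n) (2^-1 : R) ^+ k = 2 - 2 * 2^-1 ^+ n.
      elim: n => [|m IHm]; first by rewrite big_ord0 expr0 mulr1 subrr.
      by rewrite big_ord_recr/= IHm exprS; field.
    by rewrite lerBlDr lerDl mulr_ge0// exprn_ge0.
  have : {ae mu, forall x, exists C, forall n, \sum_(k < n) f k x <= C}.
    apply: (@ae_bounded_sum _ _ _ _ f 2) => // n.
    apply: le_trans (geo n); apply: ler_sum => k _.
    by rewrite -lee_fin -integral_EFin.
  apply: filterS => x [C hC] Dx.
  have /cvg_ex[l Hl] : cvgn (fun k => H k x).
    apply: (@abs_summable_telescope_cvg _ j ((2 + C) / 2)) => n.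
    apply: (@le_trans _ _ (\sum_(k < n) 2^-1 * (2^-1 ^+ k + f k x))).
      apply: ler_sum => k _; rewrite /f indicE mem_set// mulr1.
      move: (H _.+1 x - H _ x) => z.
      have p2 : (0 : R) < 2 ^+ (j + k) by rewrite exprn_gt0.
      have pk : 2^-1 ^+ (j + k) <= 2^-1 ^+ k :> R.
        by rewrite exprD ler_piMl ?exprn_ge0// exprn_ile1// invf_le1// ler1n.
      apply: (@le_trans _ _ (2^-1 * (2^-1 ^+ (j + k) + 2 ^+ (j + k) * z ^+ 2))); last first.
        by rewrite ler_wpM2l// lerD2r.
      rewrite exprVn -(real_normK (num_real z)); move: (2 ^+ (j + k)) p2 `|z| => p p0 a.
      have -> : 2^-1 * (p^-1 + p * a ^+ 2) = a + (2 * p)^-1 * (1 - p * a) ^+ 2.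
        by field; rewrite gt_eqF.
      by rewrite lerDl mulr_ge0 ?sqr_ge0// invr_ge0 mulr_ge0// ltW.
    rewrite -mulr_sumr mulrC ler_wpM2r// big_split/= lerD ?geo ?hC//.
  have HE : (H k x)%:E @[k --> \oo] --> l%:E by apply/fine_cvgP; split; [exact: nearW|].
  by rewrite /g (cvg_limn_einf_sup HE).2.
exists g => // j e ep; have [M MP] := cG j e ep; exists M => n Mn.
have mGH k : measurable_fun (D j) (fun x => ((G n x - H k x) ^+ 2)%:E).
  apply/measurable_EFinP; apply: (measurable_funS measurableT) => //.
  by apply: measurable_funX; apply: measurable_funB; exact: mG.
have -> : (\int[mu]_(x in D j) ((G n x - g x) ^+ 2)%:E =
    \int[mu]_(x in D j) limn_einf (fun k => ((G n x - H k x) ^+ 2)%:E))%E.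
  apply: ae_eq_integral => //.
  - apply/measurable_EFinP; apply: (measurable_funS measurableT) => //.
    by apply: measurable_funX; apply: measurable_funB => //; exact: mG.
  - under eq_fun do rewrite -[limn_einf _]oppeK -limn_esupN.
    apply: measurableT_comp => //; apply: measurable_fun_limn_esup => k.
    exact: measurableT_comp (mGH k).
  - apply: filterS (cvH j) => x + Dx => /(_ Dx) Hx.
    suff HE : ((G n x - H k x) ^+ 2)%:E @[k --> \oo] --> ((G n x - g x) ^+ 2)%:E.
      by rewrite (cvg_limn_einf_sup HE).1.
    apply/fine_cvgP; split; first exact: nearW.
    have c1 : (G n x - H k x) @[k --> \oo] --> G n x - g x by apply: cvgB => //; exact: cvg_cst.
    exact: (cvgM c1 c1).
apply: le_trans (fatou mu (mD j) mGH _) _.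
  by move=> k x _; rewrite lee_fin sqr_ge0.
rewrite limn_einf_lim; apply: lime_le; first exact: is_cvg_einfs.
apply: nearW => k.
(* The infimum over a tail is bounded by any one of its terms, here one with index past [M]. *)
pose m := maxn k M.
apply: le_trans (_ : (\int[mu]_(x in D j) ((G n x - H m x) ^+ 2)%:E <= _)%E).
  by apply: ereal_inf_lbound; exists m => //; rewrite /= leq_maxl.
by apply: MP => //; apply: leq_trans (kn m); exact: leq_maxr.
Qed.

End L2_tools.

(** * Sub-Markovian resolvents and semigroups on L^1 *)

Section L1_operators.
Context {R : realType} {d : nat}.
Local Notation Rd := 'rV[R]_d.
Local Notation F := (Rd -> R).
Variables (mu : {sigma_finite_measure set Rd -> \bar R}) (E : set Rd).
Hypothesis aeE : {ae mu, forall x, E x}.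
Implicit Types (f g h u : F) (S : F -> F).

Local Notation L1 f := (mu.-integrable setT (EFin \o f)).

Lemma Lp_on_Lfun p f : Lp_on mu p E f <-> f \in Lfun mu p.
Proof.
split=> [[]//|pf]; split=> //.
by apply: filterS aeE => x Ex /(_ Ex).
Qed.

Lemma Lp_on_L1 f : Lp_on mu 1 E f <-> L1 f.
Proof. by rewrite Lp_on_Lfun; exact: Lfun1_integrable. Qed.

Lemma Lnorm1E f : L1 f -> ('N[mu]_1[EFin \o f])%E = (\int[mu]_x `|f x|)%:E.
Proof.
move=> fi; rewrite Lnorm1 -integral_EFin//; exact: integrable_real_abs.
Qed.

Section contraction.
Variable S : F -> F.
Hypothesis hS : linear_contraction mu 1 E S.

Lemma contraction_L1 f : L1 f -> L1 (S f).
Proof. by move=> /Lp_on_L1 fi; apply/Lp_on_L1; case: hS => + _ _; exact. Qed.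

Lemma contraction_lin (c : R) f g : L1 f -> L1 g ->
  {ae mu, forall x, S (fun x => c * f x + g x) x = c * S f x + S g x}.
Proof.
move=> fi gi; case: hS => _ + _ => /(_ c f g).
move=> /(_ ltac:(exact/Lp_on_L1) ltac:(exact/Lp_on_L1)).
by apply: filterS => x; apply.
Qed.

Lemma contraction_norm f : L1 f -> \int[mu]_x `|S f x| <= \int[mu]_x `|f x|.
Proof.
move=> fi; case: hS => _ _ /(_ f ltac:(exact/Lp_on_L1)).
have Sfi := contraction_L1 fi.
by rewrite (Lnorm1E Sfi) (Lnorm1E fi) lee_fin.
Qed.

(** Linearity is stated for [c * f + g] only; with [c = -1] and [f = g = 0] it gives this, from
    which homogeneity follows. *)
Lemma contraction0 : {ae mu, forall x, S (fun=> 0) x = 0}.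
Proof.
have Z : L1 (fun=> 0 : R) by exact: integrable0.
have := contraction_lin (-1) Z Z.
rewrite (_ : (fun x : Rd => -1 * (fun=> 0 : R) x + (fun=> 0 : R) x) = (fun=> 0 : R)); last first.
  by apply/funext => x; rewrite mulr0 addr0.
by apply: filterS => x; lra.
Qed.

Lemma contractionZ (c : R) f : L1 f ->
  {ae mu, forall x, S (fun x => c * f x) x = c * S f x}.
Proof.
move=> fi; have Z : L1 (fun=> 0 : R) by exact: integrable0.
have := contraction_lin c fi Z.
rewrite (_ : (fun x : Rd => c * f x + (fun=> 0 : R) x) = (fun x => c * f x)); last first.
  by apply/funext => x; rewrite addr0.
by apply: filterS2 contraction0 => x -> ->; rewrite addr0.
Qed.

Lemma contractionB f g : L1 f -> L1 g ->
  {ae mu, forall x, S (fun x => f x - g x) x = S f x - S g x}.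
Proof.
move=> fi gi; have := contraction_lin (-1) gi fi.
rewrite (_ : (fun x => -1 * g x + f x) = (fun x => f x - g x)); last first.
  by apply/funext => x; rewrite mulN1r addrC.
by apply: filterS => x ->; rewrite mulN1r addrC.
Qed.

Lemma contraction_normB f g : L1 f -> L1 g ->
  \int[mu]_x `|S f x - S g x| <= \int[mu]_x `|f x - g x|.
Proof.
move=> fi gi; have fgi : L1 (fun x => f x - g x) by exact: integrable_realB.
have Sf := contraction_L1 fi; have Sg := contraction_L1 gi.
apply: le_trans (contraction_norm fgi); rewrite le_eqVlt; apply/orP; left; apply/eqP.
apply: eq_ae_Rintegral => //.
- apply: (integrable_real_measurable (mu := mu)).
  by apply: integrable_real_abs => //; exact: integrable_realB.
- apply: (integrable_real_measurable (mu := mu)).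
  by apply: integrable_real_abs => //; exact: contraction_L1.
- by apply: filterS (contractionB fi gi) => x -> _.
Qed.

(** Operators act on representatives; that they respect a.e. equality is a consequence of the
    contraction bound. *)
Lemma contraction_eq f g : L1 f -> L1 g -> {ae mu, forall x, f x = g x} ->
  {ae mu, forall x, S f x = S g x}.
Proof.
move=> fi gi fg; have Sf := contraction_L1 fi; have Sg := contraction_L1 gi.
have i1 : L1 (fun x => `|S f x - S g x|).
  by apply: integrable_real_abs => //; exact: integrable_realB.
have : {ae mu, forall x, setT x -> `|S f x - S g x| = 0}.
  apply: Rintegral_eq0_ae => //; apply: le_trans (contraction_normB fi gi) _.
  have -> : \int[mu]_x `|f x - g x| = \int[mu]_(x in setT) (cst 0 x : R);
    last by rewrite Rintegral_cst// mul0r.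
  apply: eq_ae_Rintegral => //.
    apply: (integrable_real_measurable (mu := mu)).
    by apply: integrable_real_abs => //; exact: integrable_realB.
  by apply: filterS fg => x -> _; rewrite subrr normr0.
by apply: filterS => x /(_ Logic.I)/eqP; rewrite normr_eq0 subr_eq0 => /eqP.
Qed.

Hypothesis mS : sub_markovian mu 1 E S.

Lemma min_cst_L1 f (c : R) : 0 <= c -> L1 f -> (forall x, 0 <= f x) -> L1 (fun x =>
  Num.min (f x) c).
Proof.
move=> c0 fi f0; apply: (le_integrable_real (g := f)) => //.
  by apply: measurable_minr => //; exact: integrable_real_measurable fi.
move=> x _; rewrite ger0_norm ?ge_min ?lexx//.
by rewrite le_min f0.
Qed.

Lemma min_natr_cvg (a : R) : Num.min a n%:R @[n --> \oo] --> a.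
Proof.
apply: cvg_near_cst; near=> n; apply/min_idPl.
by near: n; exact: nbhs_infty_ger.
Unshelve. all: by end_near. Qed.

(** The sub-Markov property concerns functions with values in [0, 1]: it is applied to the
    truncations of [f] divided by their level, and positivity passes to the L^1 limit of the
    truncations. *)
Lemma contraction_ge0' f : L1 f -> (forall x, 0 <= f x) ->
  {ae mu, forall x, 0 <= S f x}.
Proof.
move=> fi f0; have mf := integrable_real_measurable fi.
have mini n := min_cst_L1 (ler0n R n) fi f0.
have cv : \int[mu]_x `|Num.min (f x) n%:R - f x| @[n --> \oo] --> 0.
  apply: (@dominated_L1 _ _ _ _ _ _ f) => //.
  - by move=> n; exact: integrable_real_measurable (mini n).
  - by apply: aeW => x; exact: min_natr_cvg.
  - move=> n; apply: aeW => x; rewrite ger0_norm ?ge_min ?lexx//.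
    by rewrite le_min f0/=.
have Sf := contraction_L1 fi.
suff : {ae mu, forall x, setT x -> - S f x <= 0}.
  by apply: filterS => x /(_ Logic.I); rewrite oppr_le0.
have NSf : L1 (fun x => - S f x).
  by have := integrable_realZ (-1) measurableT Sf; congr integrable; apply/funext => x /=;
    rewrite mulN1r.
apply: ae_le_approx => // e e0.
have /cvgrPdist_lt/(_ e e0)[N _ /(_ N.+1 (leqnSn N))] := cv.
rewrite sub0r normrN ger0_norm ?Rintegral_ge0// => le.
have L1N := mini N.+1.
have L1N' : L1 (fun x => N.+1%:R^-1 * Num.min (f x) N.+1%:R) by exact: integrable_realZ.
have pos : {ae mu, forall x, 0 <= S (fun x => Num.min (f x) N.+1%:R) x}.
  have := @mS (fun x => N.+1%:R^-1 * Num.min (f x) N.+1%:R) ltac:(exact/Lp_on_L1).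
  have h01 : {ae mu, forall x, 0 <= N.+1%:R^-1 * Num.min (f x) N.+1%:R <= 1}.
    apply: aeW => x; rewrite mulr_ge0 ?le_min ?f0//=.
    by rewrite ler_pdivrMl// mulr1 ge_min lexx orbT.
  move=> /(_ h01) P1.
  have := contractionZ N.+1%:R^-1 L1N.
  by apply: filterS2 P1 => x /andP[Sx0 _] Sxe; move: Sx0; rewrite Sxe pmulr_rge0.
have SN := contraction_L1 L1N.
exists (fun x => - S (fun x => Num.min (f x) N.+1%:R) x); split.
- by have := integrable_realZ (-1) measurableT SN; congr integrable; apply/funext => x /=;
  rewrite mulN1r.
- by apply: filterS pos => x ? _; rewrite oppr_le0.
- apply: le_trans (ltW le); apply: le_trans (contraction_normB L1N fi).
  rewrite le_eqVlt; apply/orP; left; apply/eqP; congr Rintegral; apply/funext => x.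
  by rewrite opprK addrC.
Qed.

Lemma contraction_ge0 f : L1 f -> {ae mu, forall x, 0 <= f x} ->
  {ae mu, forall x, 0 <= S f x}.
Proof.
move=> fi f0; have afi : L1 (fun x => `|f x|) by exact: integrable_real_abs.
have := contraction_ge0' afi (fun x => normr_ge0 _).
apply: filterS2 (contraction_eq fi afi _) => [x -> //|].
by apply: filterS f0 => x x0; rewrite ger0_norm.
Qed.

Lemma contraction_le f g : L1 f -> L1 g -> {ae mu, forall x, f x <= g x} ->
  {ae mu, forall x, S f x <= S g x}.
Proof.
move=> fi gi fg; have gfi : L1 (fun x => g x - f x) by exact: integrable_realB.
have : {ae mu, forall x, 0 <= S (fun x => g x - f x) x}.
  by apply: contraction_ge0 => //; apply: filterS fg => x; rewrite subr_ge0.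
by apply: filterS2 (contractionB gi fi) => x ->; rewrite subr_ge0.
Qed.

(** Since [f] may be negative, the sub-Markov property is applied to its positive part divided by
    [M]. *)
Lemma contraction_bounded f (M : R) : 0 < M -> L1 f -> {ae mu, forall x, f x <= M} ->
  {ae mu, forall x, S f x <= M}.
Proof.
move=> M0 fi fM; pose p x := Num.max (f x) 0.
have mf := integrable_real_measurable fi.
have pi : L1 p.
  apply: (le_integrable_real (g := fun x => `|f x|)) => //.
  - exact: measurable_maxr.
  - by move=> x _; rewrite /p; case: (leP (f x) 0) => _; rewrite ?normr0.
  - exact: integrable_real_abs.
have fp : {ae mu, forall x, f x <= p x} by apply: aeW => x; rewrite le_max lexx.
have pMi : L1 (fun x => M^-1 * p x) by exact: integrable_realZ.
have p01 : {ae mu, forall x, 0 <= M^-1 * p x <= 1}.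
  apply: filterS fM => x xM; apply/andP; split.
    by apply: mulr_ge0; [rewrite invr_ge0 ltW|rewrite le_max lexx orbT].
  by rewrite ler_pdivrMl// mulr1 ge_max xM ltW.
have := @mS (fun x => M^-1 * p x) ltac:(exact/Lp_on_L1) p01.
move=> H; apply: filterS3 (contraction_le fi pi fp) (contractionZ M^-1 pi) H.
move=> x fx -> /andP[_]; rewrite ler_pdivrMl// mulr1; exact: le_trans.
Qed.

End contraction.

Section resolvent.
Variable G : R -> F -> F.
Hypothesis hG : sub_markovian_C0_resolvent mu 1 E G.

Lemma resolvent_contraction a : 0 < a -> linear_contraction mu 1 E (fun f x => a * G a f x).
Proof. by move=> a0; case: hG => /(_ a a0). Qed.

Lemma resolvent_markov a : 0 < a -> sub_markovian mu 1 E (fun f x => a * G a f x).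
Proof. by move=> a0; case: hG => _ /(_ a a0). Qed.

Lemma resolvent_L1 a f : 0 < a -> L1 f -> L1 (G a f).
Proof.
move=> a0 fi; have := contraction_L1 (resolvent_contraction a0) fi.
move=> /(integrable_realZ a^-1 measurableT); congr integrable.
by apply/funext => x /=; rewrite mulKf// gt_eqF.
Qed.

Lemma resolvent_lin a (c : R) f g : 0 < a -> L1 f -> L1 g ->
  {ae mu, forall x, G a (fun x => c * f x + g x) x = c * G a f x + G a g x}.
Proof.
move=> a0 fi gi; have := contraction_lin (resolvent_contraction a0) c fi gi.
apply: filterS => x; rewrite mulrCA -mulrDr => /mulfI; apply.
by rewrite gt_eqF.
Qed.

Lemma resolventZ a (c : R) f : 0 < a -> L1 f ->
  {ae mu, forall x, G a (fun x => c * f x) x = c * G a f x}.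
Proof.
move=> a0 fi; have := contractionZ (resolvent_contraction a0) c fi.
apply: filterS => x; rewrite mulrCA => /mulfI; apply.
by rewrite gt_eqF.
Qed.

Lemma resolvent_le a f g : 0 < a -> L1 f -> L1 g -> {ae mu, forall x, f x <= g x} ->
  {ae mu, forall x, G a f x <= G a g x}.
Proof.
move=> a0 fi gi fg.
have := contraction_le (resolvent_contraction a0) (resolvent_markov a0) fi gi fg.
by apply: filterS => x; rewrite ler_pM2l.
Qed.

Lemma resolvent_ge0 a f : 0 < a -> L1 f -> {ae mu, forall x, 0 <= f x} ->
  {ae mu, forall x, 0 <= G a f x}.
Proof.
move=> a0 fi f0.
have := contraction_ge0 (resolvent_contraction a0) (resolvent_markov a0) fi f0.
by apply: filterS => x; rewrite pmulr_rge0.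
Qed.

Lemma resolvent_norm a f : 0 < a -> L1 f ->
  \int[mu]_x `|G a f x| <= a^-1 * \int[mu]_x `|f x|.
Proof.
move=> a0 fi; rewrite ler_pdivlMl// -RintegralZl//; last first.
  by apply: integrable_real_abs => //; exact: resolvent_L1.
apply: le_trans (contraction_norm (resolvent_contraction a0) fi).
rewrite le_eqVlt; apply/orP; left; apply/eqP; congr Rintegral; apply/funext => x.
by rewrite normrM gtr0_norm.
Qed.

Lemma resolvent_equation a b f : 0 < a -> 0 < b -> L1 f ->
  {ae mu, forall x, G a f x - G b f x = (b - a) * G a (G b f) x}.
Proof.
move=> a0 b0 /Lp_on_L1 fi; case: hG => _ _ /(_ a b f a0 b0 fi) + _.
by apply: filterS => x; apply.
Qed.

Lemma resolvent_continuity f e : L1 f -> 0 < e -> exists a0, 0 < a0 /\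
  forall a, a0 < a -> \int[mu]_x `|a * G a f x - f x| < e.
Proof.
move=> fi e0; case: hG => _ _ _ /(_ f ltac:(exact/Lp_on_L1)) /fine_cvgP[_].
move=> /cvgrPdist_lt/(_ e e0)[M [_ HM]].
exists (Num.max M 1); split; first by rewrite lt_max ltr01 orbT.
move=> a; rewrite gt_max => /andP[Ma a1]; have := HM a Ma.
have a0 : 0 < a by rewrite (lt_trans _ a1).
have ri : L1 (fun x => a * G a f x - f x).
  by apply: integrable_realB => //; apply: integrable_realZ => //; exact: resolvent_L1.
rewrite /= (Lnorm1E ri)/= sub0r normrN ger0_norm//.
exact: Rintegral_ge0.
Qed.

(* The generator [L u = a u - f] of [u = G a f] is dispersive: its integral over
   [u > M] is nonpositive, while [L u = a u] there. *)
Lemma maximum_principle a f (M : R) : 0 < a -> 0 < M -> L1 f ->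
  {ae mu, forall x, 0 <= f x} -> {ae mu, forall x, 0 < f x -> G a f x <= M} ->
  {ae mu, forall x, G a f x <= M}.
Proof.
move=> a0 M0 fi f0 fM; set u := G a f.
have ui : L1 u by exact: resolvent_L1.
have mu_ := integrable_real_measurable ui.
have u0 : {ae mu, forall x, 0 <= u x} by exact: resolvent_ge0.
pose w x := a * u x - f x.
have wi : L1 w by apply: integrable_realB => //; exact: integrable_realZ.
pose S := [set x | M < u x].
have mS : measurable S.
  rewrite [X in measurable X](_ : S = u @^-1` `]M, +oo[); last first.
    by apply/seteqP; split => x; rewrite /S /= in_itv/= andbT.
  by rewrite -[X in measurable X]setTI; exact: mu_.
(* [p] is the excess of [u] over [M], supported in [S]; the rest [m] is the minimum of [u] and [M],
   which [b * G b] keeps below [M]. *)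
pose p x := Num.max (u x - M) 0; pose m x := u x - p x.
have muM : measurable_fun setT (fun x => u x - M) by exact: measurable_funB.
have p0 x : 0 <= p x by rewrite le_max lexx orbT.
have pi : L1 p.
  apply: (le_integrable_real (g := fun x => `|u x| )) => //.
  - exact: measurable_maxr.
  - move=> x _; rewrite ger0_norm// ge_max normr_ge0 andbT lerBlDr.
    by rewrite (le_trans (ler_norm _))// lerDl ltW.
  - exact: integrable_real_abs.
have mi : L1 m by exact: integrable_realB.
have SL1 f' : L1 f' -> mu.-integrable S (EFin \o f') by move=> ?; apply: (integrableS measurableT).
(* On [S] one has [m = M], so only the contribution of [p] remains; it is nonpositive because
   [b * G b] contracts L^1 and [p] vanishes off [S]. *)
have IS b : 0 < b -> \int[mu]_(x in S) (b * G b u x - u x) <= 0.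
  move=> b0; have cb := resolvent_contraction b0.
  have bu := contraction_L1 cb ui; have bp := contraction_L1 cb pi.
  apply: (@le_trans _ _ (\int[mu]_(x in S) (b * G b p x - p x))).
    apply: le_ae_Rintegral => //.
    - by apply: SL1; exact: integrable_realB.
    - by apply: SL1; exact: integrable_realB.
    - have mM : {ae mu, forall x, m x <= M}.
        by apply: aeW => x; rewrite /m /p; case: (leP (u x - M) 0) => ?; lra.
      have := contraction_bounded cb (resolvent_markov b0) M0 mi mM.
      have := contractionB cb ui pi; apply: filterS2 => x /= + + Sx.
      rewrite -/m => -> ?; rewrite /p max_l; last by rewrite subr_ge0 ltW.
      lra.
  rewrite RintegralB//; [|exact: SL1..].
  rewrite subr_le0; apply: le_trans (Rintegral_le_norm mS bp) _.
  apply: le_trans (contraction_norm cb pi) _.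
  rewrite (_ : \int[mu]_(x in S) p x = \int[mu]_x p x).
    by rewrite le_eqVlt; apply/orP; left; apply/eqP; congr Rintegral; apply/funext => x;
      rewrite ger0_norm.
  apply: Rintegral_set_support => // x /negP; rewrite -leNgt => uM.
  by apply/max_idPr; rewrite subr_le0.
(* [w] is approximated in L^1 by [b * G b w], which the resolvent equation identifies with
   [b * (b * G b u - u)]; the bound [IS] applies to the latter. *)
have ISw : \int[mu]_(x in S) w x <= 0.
  apply/ler_addgt0Pl => e e0; rewrite addr0.
  have [b0 [b0p Hb]] := resolvent_continuity wi e0.
  pose b := b0 + a; have bp : 0 < b by rewrite addr_gt0.
  have {Hb} lee : \int[mu]_x `|b * G b w x - w x| < e by apply: Hb; rewrite ltrDl.
  have cb := resolvent_contraction bp; have bwi := contraction_L1 cb wi.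
  have dwi : L1 (fun x => w x - b * G b w x) by exact: integrable_realB.
  have -> : \int[mu]_(x in S) w x =
     \int[mu]_(x in S) (w x - b * G b w x) + \int[mu]_(x in S) (b * G b w x).
    rewrite -(RintegralD mS (SL1 _ dwi) (SL1 _ bwi)).
    by congr Rintegral; apply/funext => x; rewrite subrK.
  rewrite -[e]addr0 lerD//.
    apply: le_trans (Rintegral_le_norm mS dwi) _; apply: le_trans (ltW lee).
    by rewrite le_eqVlt; apply/orP; left; apply/eqP; congr Rintegral; apply/funext => x;
      rewrite distrC.
  have bui := contraction_L1 cb ui.
  have -> : \int[mu]_(x in S) (b * G b w x) = \int[mu]_(x in S) (b * (b * G b u x - u x)).
    have i1 : L1 (fun x => b * (b * G b u x - u x)).
      by apply: integrable_realZ => //; exact: integrable_realB.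
    apply: eq_ae_Rintegral => //.
    - exact: integrable_real_measurable (SL1 _ bwi).
    - exact: integrable_real_measurable (SL1 _ i1).
    - have aui : L1 (fun x => a * u x) by exact: integrable_realZ.
      have := resolvent_equation bp a0 fi.
      have := resolventZ a bp ui; have := contractionB cb aui fi.
      apply: filterS3 => x /= + + + _; rewrite -/w -/u => -> -> Eq.
      have -> : G b f x = u x + (a - b) * G b u x by rewrite -Eq; ring.
      by ring.
  rewrite RintegralZl//; last by apply: SL1; exact: integrable_realB.
  by rewrite mulr_ge0_le0 ?(ltW bp)// IS.
have f0S : {ae mu, forall x, S x -> w x = a * u x}.
  apply: filterS2 f0 fM => x x0 xM; rewrite /S /w /= => Mu.
  suff -> : f x = 0 by rewrite subr0.
  apply/eqP; rewrite eq_le x0 andbT leNgt; apply/negP => /xM.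
  by rewrite leNgt -/u Mu.
have aui : L1 (fun x => a * u x) by exact: integrable_realZ.
have : {ae mu, forall x, S x -> a * u x = 0}.
  apply: Rintegral_eq0_ae => //; first exact: SL1.
    by move=> x Mu; rewrite mulr_ge0 ?ltW// (lt_trans M0).
  rewrite -(eq_ae_Rintegral mS _ _ f0S)//.
  - exact: integrable_real_measurable (SL1 _ wi).
  - exact: integrable_real_measurable (SL1 _ aui).
apply: filterS => x h; rewrite leNgt; apply/negP => Mu; have /eqP := h Mu.
by rewrite mulf_eq0 !gt_eqF// (lt_trans M0).
Qed.

End resolvent.
End L1_operators.

Section radon_nikodym_fin_num_fun.
Context d0 (T : measurableType d0) (R : realType).
Variables (mu : {sigma_finite_measure set T -> \bar R}).
Variables (nu : {measure set T -> \bar R}) (nufin : fin_num_fun nu).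

(** A copy of [nu] on which the finite-measure structure provided by [nufin] can be declared, as
    needed for the Radon-Nikodym theorem. *)
Definition fin_num_measure : set T -> \bar R := nu.

HB.instance Definition _ := isMeasure.Build _ _ _ fin_num_measure
  (measure0 nu) (measure_ge0 nu) (@measure_semi_sigma_additive _ _ _ nu).
HB.instance Definition _ := Measure_isFinite.Build _ _ _ fin_num_measure nufin.

Lemma radon_nikodym_fin_num_fun : nu `<< mu -> exists f : T -> \bar R,
  [/\ forall x, (0 <= f x)%E, forall x, f x \is a fin_num, mu.-integrable setT f
    & forall A, measurable A -> nu A = (\int[mu]_(x in A) f x)%E].
Proof. exact: (@radon_nikodym_sigma_finite _ _ _ mu fin_num_measure). Qed.

End radon_nikodym_fin_num_fun.

(** * Orbit integrals, time integrals and the potential of the L^1 semigroup *)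

Section semigroup.
Context {R : realType} {d : nat}.
Local Notation Rd := 'rV[R]_d.
Local Notation F := (Rd -> R).
Variables (mu : {sigma_finite_measure set Rd -> \bar R}) (E : set Rd).
Hypothesis aeE : {ae mu, forall x, E x}.
Variable T : R -> F -> F.
Hypothesis hT : sub_markovian_C0_semigroup mu 1 E T.
Implicit Types (f g h u : F) (S : set Rd).
Local Notation L1 f := (mu.-integrable setT (EFin \o f)).
Local Notation leb := (@lebesgue_measure R).

Lemma semigroup_contraction t : 0 < t -> linear_contraction mu 1 E (T t).
Proof. by move=> t0; case: hT => /(_ t t0). Qed.

Lemma semigroup_markov t : 0 < t -> sub_markovian mu 1 E (T t).
Proof. by move=> t0; case: hT => _ /(_ t t0). Qed.

Lemma semigroup_L1 t f : 0 < t -> L1 f -> L1 (T t f).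
Proof. by move=> t0; exact: (contraction_L1 aeE (semigroup_contraction t0)). Qed.

Lemma semigroup_ge0 t f : 0 < t -> L1 f -> {ae mu, forall x, 0 <= f x} ->
  {ae mu, forall x, 0 <= T t f x}.
Proof.
by move=> t0; exact: (contraction_ge0 aeE (semigroup_contraction t0) (semigroup_markov t0)).
Qed.

Lemma semigroup_continuity0 f e : L1 f -> 0 < e -> exists2 a, 0 < a &
  forall t, 0 < t -> t < a -> \int[mu]_x `|T t f x - f x| < e.
Proof.
move=> fi e0; case: hT => _ _ _ /(_ f ltac:(exact/(Lp_on_L1 aeE))) /fine_cvgP[_].
move=> /cvgrPdist_lt/(_ e e0)[a /= a0 Ha]; exists a => // t t0 ta.
have := Ha t; rewrite /ball_/= sub0r normrN gtr0_norm// => /(_ ta t0).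
have ri : L1 (fun x => T t f x - f x).
  by apply: integrable_realB => //; exact: semigroup_L1.
by rewrite (Lnorm1E ri)/= sub0r normrN ger0_norm//; exact: Rintegral_ge0.
Qed.

(** By the semigroup law and contraction, continuity at time 0 becomes a modulus of continuity that
    does not depend on the base point [s]. *)
Lemma semigroup_increment s t f : 0 < s -> 0 < t -> L1 f ->
  \int[mu]_x `|T (s + t) f x - T s f x| <= \int[mu]_x `|T t f x - f x|.
Proof.
move=> s0 t0 fi; have Ttf := semigroup_L1 t0 fi.
apply: le_trans (contraction_normB aeE (semigroup_contraction s0) Ttf fi).
have st0 : 0 < s + t by rewrite addr_gt0.
have := semigroup_L1 s0 Ttf; have := semigroup_L1 s0 fi; have := semigroup_L1 st0 fi => i1 i2 i3.
rewrite le_eqVlt; apply/orP; left; apply/eqP; apply: eq_ae_Rintegral => //.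
- apply: (integrable_real_measurable (mu := mu)).
  by apply: integrable_real_abs => //; exact: integrable_realB.
- apply: (integrable_real_measurable (mu := mu)).
  by apply: integrable_real_abs => //; exact: integrable_realB.
case: hT => _ _ /(_ s t f s0 t0 ltac:(exact/(Lp_on_L1 aeE))) + _.
by apply: filterS => x /(_ Logic.I) -> _.
Qed.

(** The scalar function of time through which L^1-valued time integrals are identified. *)
Definition orbit_integral S f (t : R) : R := \int[mu]_(x in S) T t f x.

Lemma orbit_integral_continuous S f : measurable S -> L1 f ->
  {in `]0, +oo[, continuous (orbit_integral S f)}.
Proof.
move=> mS fi t; rewrite in_itv/= andbT => t0.
apply/cvgrPdist_lt => e e0.
have [a a0 Ha] := semigroup_continuity0 fi e0.
have key s r : 0 < s -> 0 < r -> r < a ->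
    `|orbit_integral S f (s + r) - orbit_integral S f s| < e.
  move=> s0 r0 ra; apply: le_lt_trans (Ha r r0 ra).
  apply: le_trans (semigroup_increment s0 r0 fi).
  have i1 : L1 (T (s + r) f) by apply: semigroup_L1 => //; rewrite addr_gt0.
  have i2 := semigroup_L1 s0 fi.
  have iS g : L1 g -> mu.-integrable S (EFin \o g) by apply: (integrableS measurableT).
  rewrite /orbit_integral -(RintegralB mS (iS _ i1) (iS _ i2)).
  have id : L1 (fun x => T (s + r) f x - T s f x) by exact: integrable_realB.
  apply: le_trans (le_normr_Rintegral mS (iS _ id)) _.
  apply: le_trans (Rintegral_le_norm mS (integrable_real_abs measurableT id)) _.
  by rewrite le_eqVlt; apply/orP; left; apply/eqP; congr Rintegral; apply/funext => x;
    rewrite normr_id.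
near=> s.
have s0 : 0 < s by near: s; exact: lt_nbhsr.
have ts : `|t - s| < a by near: s; apply: cvgr_dist_lt.
(* For [s] before [t] the increment starts at [s], which is why [key] has to be uniform in its base
   point. *)
have [st|ts'|->] := ltgtP s t.
- have := key s (t - s) s0; rewrite subr_gt0 subrKC; apply => //.
  by rewrite (le_lt_trans (ler_norm _)).
- have := key t (s - t) t0; rewrite subr_gt0 subrKC distrC; apply => //.
  by rewrite (le_lt_trans (ler_norm _))// distrC.
- by rewrite subrr normr0.
Unshelve. all: by end_near. Qed.

Lemma orbit_integral_measurable S f : measurable S -> L1 f ->
  measurable_fun (`]0, +oo[%classic : set (measurableTypeR R)) (orbit_integral S f).
Proof.
move=> mS fi; apply: open_continuous_measurable_fun; first exact: interval_open.
by move=> t /set_mem ti; exact: orbit_integral_continuous.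
Qed.

Lemma orbit_integral_le S f t : measurable S -> L1 f -> 0 < t ->
  `|orbit_integral S f t| <= \int[mu]_x `|f x|.
Proof.
move=> mS fi t0; have Ti := semigroup_L1 t0 fi.
apply: le_trans (contraction_norm aeE (semigroup_contraction t0) fi).
have TiS : mu.-integrable S (EFin \o T t f) by exact: integrableS Ti.
apply: le_trans (le_normr_Rintegral mS TiS) _.
apply: le_trans (Rintegral_le_norm mS (integrable_real_abs measurableT Ti)) _.
by rewrite le_eqVlt; apply/orP; left; apply/eqP; congr Rintegral; apply/funext => x;
  rewrite normr_id.
Qed.

Lemma orbit_integral_ge0 S f t : measurable S -> L1 f -> {ae mu, forall x, 0 <= f x} ->
  0 < t -> 0 <= orbit_integral S f t.
Proof.
move=> mS fi f0 t0; have Ti := semigroup_L1 t0 fi.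
have TiS : mu.-integrable S (EFin \o T t f) by exact: integrableS Ti.
rewrite /orbit_integral (_ : 0 = \int[mu]_(x in S) (cst 0 x : R));
  last by rewrite Rintegral_cst// mul0r.
apply: le_ae_Rintegral => //; first exact: integrable0.
by apply: filterS (semigroup_ge0 t0 fi f0).
Qed.

Lemma orbit_integral_integrable S f (N : R) : measurable S -> L1 f ->
  leb.-integrable (`]0, N]%classic : set (measurableTypeR R)) (EFin \o orbit_integral S f).
Proof.
move=> mS fi; apply: (le_integrable_real (g := fun=> \int[mu]_x `|f x|)) => //.
- apply: measurable_funS (orbit_integral_measurable mS fi) => //.
  by apply: subset_itvl; rewrite bnd_simp.
- by move=> t; rewrite /= in_itv/= => /andP[t0 _]; exact: orbit_integral_le.
- apply: (@integrableS _ _ _ leb `[0, N]) => //; first exact: subset_itv_oc_cc.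
  apply: continuous_compact_integrable; first exact: segment_compact.
  by move=> x; exact: cst_continuous.
Qed.

Lemma integrable_expR_half (a : R) : 0 < a ->
  leb.-integrable (`]0, +oo[%classic : set (measurableTypeR R)) (EFin \o (fun t =>
    expR (- (a * t)))).
Proof.
move=> a0; have H := @integrable_exponential_pdf R a a0.
have H1 : leb.-integrable (`]0, +oo[%classic : set (measurableTypeR R)) (EFin \o exponential_pdf a).
  exact: integrableS H.
have : leb.-integrable (`]0, +oo[%classic : set (measurableTypeR R)) (EFin \o (fun t =>
  a^-1 * exponential_pdf a t)).
  exact: integrable_realZ.
apply: eq_integrable => // t; rewrite inE/= in_itv/= andbT => t0.
by rewrite exponential_pdfE ?ltW//= mulKf ?gt_eqF// mulNr.
Qed.

Lemma exp_orbit_integrable S f (a : R) : 0 < a -> measurable S -> L1 f ->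
  leb.-integrable (`]0, +oo[%classic : set (measurableTypeR R)) (EFin \o (fun t =>
    expR (- (a * t)) * orbit_integral S f t)).
Proof.
move=> a0 mS fi.
apply: (@le_integrable_real _ _ _ leb _ _ (fun t => (\int[mu]_x `|f x|) * expR (- (a * t)))) => //.
- apply: measurable_funM; last exact: orbit_integral_measurable.
  by apply: integrable_real_measurable (integrable_expR_half a0).
- move=> t; rewrite /= in_itv/= andbT => t0.
  rewrite normrM ger0_norm ?expR_ge0// mulrC ler_wpM2r ?expR_ge0//.
  exact: orbit_integral_le.
- by apply: integrable_realZ => //; exact: integrable_expR_half.
Qed.


(** The map [t, x |-> T t f x] need not be jointly measurable, each [T t f] being an arbitrary
    representative. The double integral is therefore read as a measure in [S]: it is finite and
    absolutely continuous with respect to [mu], and its Radon-Nikodym density is the time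
    integral. *)
Lemma time_integral_exists f (N : R) : L1 f -> {ae mu, forall x, 0 <= f x} ->
  exists h, L1 h /\ forall S, measurable S ->
    \int[mu]_(x in S) h x = \int[leb]_(t in `]0, N]) orbit_integral S f t.
Proof.
move=> fi f0.
pose D : set (measurableTypeR R) := `]0, N]%classic.
have mD : measurable D by exact: measurable_itv.
(* The absolute value makes [nu] nonnegative on all sets, although [T t f] is nonnegative only a.e.;
   on measurable sets the value is unchanged. *)
pose I S t : \bar R := (\int[mu]_(x in S) `|T t f x|%:E)%E.
pose nu S : \bar R := (\int[leb]_(t in D) I S t)%E.
have D0 t : D t -> 0 < t by rewrite /D /= in_itv/= => /andP[].
have I0 S t : (0 <= I S t)%E by apply: integral_ge0 => x _; rewrite lee_fin.
have IE S t : measurable S -> D t -> I S t = (orbit_integral S f t)%:E.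
  move=> mS /D0 t0; have Ti := semigroup_L1 t0 fi.
  have TiS : mu.-integrable S (EFin \o T t f) by exact: integrableS Ti.
  rewrite /orbit_integral -(integral_EFin mS TiS).
  have mT := integrable_real_measurable TiS.
  apply: ae_eq_integral => //; [exact/measurable_EFinP/measurableT_comp|exact/measurable_EFinP|].
  by apply: filterS (semigroup_ge0 t0 fi f0) => x x0 _; rewrite ger0_norm.
have mI S : measurable S -> measurable_fun D (I S).
  move=> mS; apply: (eq_measurable_fun (EFin \o orbit_integral S f)).
    by move=> t /set_mem Dt; rewrite IE.
  by apply/measurable_EFinP; exact: (integrable_real_measurable (orbit_integral_integrable N mS
    fi)).
have nuE S : measurable S -> nu S = (\int[leb]_(t in D) orbit_integral S f t)%:E.
  move=> mS; rewrite /nu -(integral_EFin mD (orbit_integral_integrable N mS fi)).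
  by apply: eq_integral => t /set_mem Dt; rewrite IE.
have nu0 : nu set0 = 0%E.
  by rewrite /nu /I; under eq_integral do rewrite integral_set0; rewrite integral0.
have nu_ge0 S : (0 <= nu S)%E by apply: integral_ge0 => t _; exact: I0.
have nus : semi_sigma_additive nu.
  move=> B mB tB mUB.
  have -> : nu (\bigcup_n B n) = (\sum_(0 <= i <oo) nu (B i))%E.
    rewrite /nu -integral_nneseries//; last by move=> n; exact: mI.
    apply: eq_integral => t /set_mem Dt; rewrite /I ge0_integral_bigcup//.
    apply/measurable_EFinP/measurableT_comp => //.
    have := semigroup_L1 (D0 _ Dt) fi => /(integrableS measurableT mUB (@subsetT _ _)).
    exact: integrable_real_measurable.
  by apply: is_cvg_nneseries => n _ _.
pose H1 := isMeasure.Build _ _ _ nu nu0 nu_ge0 nus.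
pose nu1 : {measure set Rd -> \bar R} := HB.pack nu H1.
have nufin : fin_num_fun nu by move=> S mS; rewrite nuE.
have dom : nu1 `<< mu.
  apply/null_content_dominatesP => S mS S0; change (nu S = 0%E); rewrite nuE//.
  rewrite (@eq_Rintegral _ _ _ leb D (fun=> 0)).
    by rewrite Rintegral_cst// mul0r.
  move=> t /set_mem Dt; rewrite /orbit_integral /Rintegral null_set_integral//.
  have Ti := semigroup_L1 (D0 _ Dt) fi.
  apply/measurable_EFinP; apply: (measurable_funS measurableT) => //.
  exact: integrable_real_measurable Ti.
have [g [g0 gfin gi gE]] := @radon_nikodym_fin_num_fun _ Rd R mu nu1 nufin dom.
exists (fine \o g); split.
  apply: eq_integrable gi => // x _; by rewrite /= fineK.
move=> S mS; apply: EFin_inj; rewrite -nuE//.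
transitivity (\int[mu]_(x in S) g x)%E; last by rewrite -gE.
have giS : mu.-integrable S g by exact: integrableS gi.
rewrite -integral_EFin//; last first.
  by apply: eq_integrable giS => // x _; rewrite /= fineK.
by apply: eq_integral => x _; rewrite /= fineK.
Qed.

Section potential.
Variable G : R -> F -> F.
Hypothesis hG : sub_markovian_C0_resolvent mu 1 E G.
Hypothesis hTG : resolvent_of_semigroup mu E T G.
Variable f : F.
Hypotheses (fi : L1 f) (f0 : {ae mu, forall x, 0 <= f x}).
Let h (N : R) := time_integral mu E T N f.

Lemma time_integralP N : L1 (h N) /\ forall S, measurable S ->
    \int[mu]_(x in S) h N x = \int[leb]_(t in `]0, N]) orbit_integral S f t.
Proof.
have [g [gi gP]] := time_integral_exists N fi f0.
have [/(Lp_on_L1 aeE) hi hP] : [set h | Lp_on mu 1 E h /\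
    forall S : set Rd, measurable S -> \int[mu]_(x in S) h x =
    \int[leb]_(t in `]0, N]) \int[mu]_(x in S) T t f x] (h N).
  by apply: (@getPex _ [set _ | _]); exists g; split => //; exact/(Lp_on_L1 aeE).
by [].
Qed.

Lemma resolvent_Rintegral a S : 0 < a -> measurable S ->
  \int[mu]_(x in S) G a f x =
  \int[leb]_(t in `]0, +oo[) (expR (- (a * t)) * orbit_integral S f t).
Proof. by move=> a0 mS; rewrite hTG//; exact/(Lp_on_L1 aeE). Qed.

Let oN (N : R) : (`]0, N]%classic : set (measurableTypeR R)) `<=` `]0, +oo[.
Proof. by apply: subset_itvl; rewrite bnd_simp. Qed.

Lemma Rintegral_pos_le (N : R) (M : itv_bound R) (u v : R -> R) :
  (BRight N <= M)%O ->
  leb.-integrable (`]0, N]%classic : set (measurableTypeR R)) (EFin \o u) ->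
  leb.-integrable ([set` Interval (BRight 0) M] : set (measurableTypeR R)) (EFin \o v) ->
  (forall t, 0 < t -> u t <= v t) -> (forall t, 0 < t -> 0 <= v t) ->
  \int[leb]_(t in `]0, N]) u t <= \int[leb]_(t in [set` Interval (BRight 0) M]) v t.
Proof.
move=> NM ui vi uv v0.
have sub : (`]0, N]%classic : set (measurableTypeR R)) `<=` [set` Interval (BRight 0) M].
  exact: subset_itvl.
have vi' : leb.-integrable (`]0, N]%classic : set (measurableTypeR R)) (EFin \o v).
  exact: integrableS vi.
have pos t : [set` Interval (BRight 0) M] t -> 0 < t.
  by rewrite /= in_itv/= => /andP[].
apply: (@le_trans _ _ (\int[leb]_(t in `]0, N]) v t)).
  apply: le_Rintegral => //.
  by move=> t /sub/pos; exact: uv.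
rewrite -lee_fin -!integral_EFin//; apply: ge0_subset_integral => //.
  exact: measurable_int vi.
by move=> t /pos; rewrite lee_fin; exact: v0.
Qed.

Lemma time_integral_ge0 N : {ae mu, forall x, 0 <= h N x}.
Proof.
have [hi hP] := time_integralP N.
apply: (ae_le_of_Rintegral (f := fun=> 0)) => [||S mS]; [exact: integrable0|exact: hi|].
rewrite Rintegral_cst// mul0r (hP S mS); apply: Rintegral_ge0 => t.
by rewrite /= in_itv/= => /andP[t0 _]; exact: orbit_integral_ge0.
Qed.

Lemma time_integral_nd N M : N <= M -> {ae mu, forall x, h N x <= h M x}.
Proof.
move=> NM; have [Ni NP] := time_integralP N; have [Mi MP] := time_integralP M.
apply: (ae_le_of_Rintegral Ni Mi) => S mS; rewrite (NP S mS) (MP S mS).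
apply: Rintegral_pos_le; rewrite ?bnd_simp//; [exact: orbit_integral_integrable..|].
by move=> t t0; exact: orbit_integral_ge0.
Qed.

(** For [t <= N] the factor [expR (a * (N - t))] is at least 1, and the part of the Laplace integral
    beyond [N] is nonnegative. *)
Lemma time_integral_le_resolvent a N : 0 < a ->
  {ae mu, forall x, h N x <= expR (a * N) * G a f x}.
Proof.
move=> a0; have [Ni NP] := time_integralP N.
have Gi := resolvent_L1 aeE hG a0 fi.
apply: ae_le_of_Rintegral => //; first exact: integrable_realZ.
move=> S mS; rewrite (NP S mS) RintegralZl//; last exact: integrableS Gi.
rewrite resolvent_Rintegral//.
have ei := exp_orbit_integrable a0 mS fi.
rewrite -RintegralZl//.
have -> : \int[leb]_(t in `]0, N]) orbit_integral S f t =
  \int[leb]_(t in `]0, N]) (orbit_integral S f t * \1_(`]0, N]%classic) t).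
  by apply: eq_Rintegral => t; rewrite indicE => ->; rewrite mulr1.
apply: Rintegral_pos_le => //.
- apply: eq_integrable (orbit_integral_integrable N mS fi) => // t.
  by rewrite /= indicE => ->; rewrite mulr1.
- exact: integrable_realZ.
- move=> t t0; have o0 := orbit_integral_ge0 mS fi f0 t0.
  rewrite indicE; case: (boolP (t \in _)) => [|_]; last first.
    by rewrite mulr0 !mulr_ge0// expR_ge0.
  rewrite inE/= in_itv/= => /andP[_ tN]; rewrite mulr1 mulrA -expRD ler_peMl//.
  by rewrite -expR0 ler_expR subr_ge0 ler_pM2l.
- by move=> t t0; rewrite !mulr_ge0 ?expR_ge0//; exact: orbit_integral_ge0.
Qed.

(* On [t > N], [exp (- a t) <= exp (- a N / 2) exp (- (a / 2) t)]. *)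
Lemma resolvent_le_time_integral a N : 0 < a -> 0 <= N ->
  {ae mu, forall x, G a f x <= h N x + expR (- (a / 2 * N)) * G (a / 2) f x}.
Proof.
move=> a0 N0; have [Ni NP] := time_integralP N.
have a20 : 0 < a / 2 by rewrite divr_gt0.
have Gi := resolvent_L1 aeE hG a0 fi; have G2i := resolvent_L1 aeE hG a20 fi.
have eGi : L1 (fun x => expR (- (a / 2 * N)) * G (a / 2) f x) by exact: integrable_realZ.
apply: ae_le_of_Rintegral => //; first exact: integrable_realD.
move=> S mS; have iS g : L1 g -> mu.-integrable S (EFin \o g) by apply: (integrableS measurableT).
rewrite (RintegralD mS (iS _ Ni) (iS _ eGi)) (RintegralZl _ mS (iS _ G2i)) (NP S mS).
rewrite !resolvent_Rintegral//.
have ei := exp_orbit_integrable a0 mS fi.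
have ei2 := exp_orbit_integrable a20 mS fi.
have oi := orbit_integral_integrable N mS fi.
have pos t : (`]0, +oo[%classic : set (measurableTypeR R)) t -> 0 < t.
  by rewrite /= in_itv/= andbT.
have oI : leb.-integrable (`]0, +oo[%classic : set (measurableTypeR R))
    (EFin \o (fun t => orbit_integral S f t * \1_(`]0, N]%classic) t)).
  apply: (@le_integrable_real _ _ _ leb _ _
    (fun t => expR (a * N) * (expR (- (a * t)) * orbit_integral S f t))) => //.
  - apply: measurable_funM; first exact: orbit_integral_measurable.
    by apply: measurable_funS measurableT _ _ => //; exact: measurable_indic.
  - move=> t /pos t0; have o0 := orbit_integral_ge0 mS fi f0 t0.
    rewrite indicE; case: (boolP (t \in _)) => [|_]; last first.
      by rewrite mulr0 normr0 !mulr_ge0// expR_ge0.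
    rewrite inE/= in_itv/= => /andP[_ tN]; rewrite mulr1 ger0_norm// mulrA -expRD ler_peMl//.
    by rewrite -expR0 ler_expR subr_ge0 ler_pM2l.
  - exact: integrable_realZ.
have -> : \int[leb]_(t in `]0, N]) orbit_integral S f t =
  \int[leb]_(t in `]0, +oo[) (orbit_integral S f t * \1_(`]0, N]%classic) t).
  rewrite Rintegral_mkcond [RHS]Rintegral_mkcond; congr Rintegral.
  apply/funext => t; rewrite !patchE indicE.
  case: ifPn => tN; last by rewrite mulr0; case: ifP.
  rewrite mulr1 ifT//; move: tN; rewrite !inE; exact: oN.
rewrite -RintegralZl// -RintegralD//; last exact: integrable_realZ.
apply: le_Rintegral => //; first by apply: integrable_realD => //; exact: integrable_realZ.
move=> t /pos t0; have o0 := orbit_integral_ge0 mS fi f0 t0.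
rewrite indicE; case: (boolP (t \in _)) => [_|/negP].
  rewrite mulr1 -[leLHS]addr0 lerD// ?mulr_ge0 ?expR_ge0//.
  by rewrite ler_piMl// -expR0 ler_expR oppr_le0 mulr_ge0 ?ltW.
rewrite inE/= in_itv/= t0/= => /negP; rewrite -ltNge => Nt; rewrite mulr0 add0r mulrA ler_wpM2r//.
rewrite -expRD ler_expR -opprD lerN2 -mulrDr.
by have : a / 2 * N <= a / 2 * t by [rewrite ler_pM2l// ltW]; lra.
Qed.

(** The potential is the supremum of increasing truncations. Letting [N] tend to infinity in
    [resolvent_le_time_integral] removes the exponential term, [G (a / 2) f x] being a fixed real
    number. The quantifiers over [nat] stand inside, so that one null set serves all of them. *)
Lemma potentialP : {ae mu, forall x,
  [/\ forall N : nat, (0 <= (h N%:R x)%:E <= potential mu E T f x)%E,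
      forall M : R, (forall N : nat, h N%:R x <= M) -> (potential mu E T f x <= M%:E)%E
    & forall n : nat, ((G n.+1%:R^-1 f x)%:E <= potential mu E T f x)%E]}.
Proof.
have nd : {ae mu, forall x, forall N : nat, h N%:R x <= h N.+1%:R x}.
  by apply: ae_foralln => N; apply: time_integral_nd; rewrite ler_nat.
have h0 : {ae mu, forall x, forall N : nat, 0 <= h N%:R x}.
  by apply: ae_foralln => N; exact: time_integral_ge0.
have Gh : {ae mu, forall x, forall n N : nat, G n.+1%:R^-1 f x <=
   h N%:R x + expR (- (n.+1%:R^-1 / 2 * N%:R)) * G (n.+1%:R^-1 / 2) f x}.
  by apply: ae_foralln => n; apply: ae_foralln => N; exact: resolvent_le_time_integral.
apply: filterS3 nd h0 Gh => x nd h0 Gh.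
have ndh : {homo (fun N : nat => (h N%:R x)%:E) : n m / (n <= m)%N >-> (n <= m)%E}.
  by apply/nondecreasing_seqP => N; rewrite lee_fin.
have pE : potential mu E T f x = ereal_sup (range (fun N : nat => (h N%:R x)%:E)).
  by rewrite /potential; apply: cvg_lim => //; exact: ereal_nondecreasing_cvgn.
have hp N : ((h N%:R x)%:E <= potential mu E T f x)%E.
  by rewrite pE; apply: ereal_sup_ubound; exists N.
split.
- by move=> N; rewrite hp andbT lee_fin.
- by move=> M hM; rewrite pE; apply: ge_ereal_sup => _ [N _ <-]; rewrite lee_fin.
- move=> n; set g2 := G (n.+1%:R^-1 / 2) f x.
  (* An infinite potential leaves nothing to prove; the value -oo is excluded by the truncations. *)
  case: (boolP (potential mu E T f x \is a fin_num)) => [pfin|]; last first.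
    rewrite fin_numE negb_and !negbK => /orP[/eqP pN|/eqP ->]; last by rewrite leey.
    by have := hp 0%N; rewrite pN.
  rewrite -(fineK pfin) lee_fin.
  have cv : (fine (potential mu E T f x) + expR (- (n.+1%:R^-1 / 2 * N%:R)) * g2) @[N --> \oo]
     --> fine (potential mu E T f x) + 0 * g2.
    apply: cvgD; first exact: cvg_cst.
    apply: cvgM; last exact: cvg_cst.
    have : (expR (- (n.+1%:R^-1 / 2))) ^+ N @[N --> \oo] --> (0 : R).
      by apply: cvg_expr; rewrite ger0_norm ?expR_ge0// -expR0 ltr_expR oppr_lt0.
    apply: cvg_trans; apply: near_eq_cvg; near=> N.
    by rewrite -expRM_natr mulNr.
  rewrite -[leRHS]addr0 -[X in _ + X](mul0r g2).
  rewrite -(cvg_lim _ cv)//; apply: limr_ge.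
    by apply/cvg_ex; eexists; exact: cv.
  apply: nearW => N; apply: le_trans (Gh n N) _; rewrite lerD2r -lee_fin fineK//.
Unshelve. all: by end_near. Qed.

End potential.

End semigroup.

(** * The 0-oo dichotomy under irreducibility *)

Section dichotomy.
Context {R : realType} {d : nat}.
Local Notation Rd := 'rV[R]_d.
Local Notation F := (Rd -> R).
Variables (mu : {sigma_finite_measure set Rd -> \bar R}) (E : set Rd).
Hypothesis aeE : {ae mu, forall x, E x}.
Hypothesis mE : measurable E.
Variables G Tbar T : R -> F -> F.
Hypothesis hG : sub_markovian_C0_resolvent mu 1 E G.
Hypothesis hTbar : sub_markovian_C0_semigroup mu 1 E Tbar.
Hypothesis hTG : resolvent_of_semigroup mu E Tbar G.
Hypothesis hT : sub_markovian_C0_semigroup mu 2%:E E T.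
Hypothesis hTT : forall t f, 0 < t -> Lp_on mu 1 E f -> Lp_on mu 2%:E E f ->
     T t f = Tbar t f %[ae mu].
Implicit Types (f g h u : F) (S D : set Rd).
Local Notation L1 f := (mu.-integrable setT (EFin \o f)).
Local Notation leb := (@lebesgue_measure R).

(** Only the minimum of [h] and [u k] has to converge to [h]: it is dominated by [h], hence
    converges in L^1, and it lies below [u k], so that positivity transfers the bound on
    [G b (u k)]. The sequence [u] itself may be unbounded. *)
Lemma resolvent_le_of_approx b (u : nat -> F) h D (Y : Rd -> R) : 0 < b ->
  (forall k, L1 (u k)) -> (forall k, {ae mu, forall x, 0 <= u k x}) ->
  L1 h -> {ae mu, forall x, 0 <= h x} ->
  {ae mu, forall x, Num.min (h x) (u k x) @[k --> \oo] --> h x} ->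
  (forall k, {ae mu, forall x, D x -> G b (u k) x <= Y x}) ->
  {ae mu, forall x, D x -> G b h x <= Y x}.
Proof.
move=> b0 ui u0 hi h0 cu uY.
pose v k x := Num.min (h x) (u k x).
have mh := integrable_real_measurable hi.
have mv k : measurable_fun setT (v k).
  by apply: measurable_minr => //; exact: integrable_real_measurable (ui k).
have vb k : {ae mu, forall x, `|v k x| <= h x}.
  apply: filterS2 (u0 k) h0 => x ux hx.
  by rewrite ger0_norm /v ?le_min ?ux ?hx// ge_min lexx.
have vi k : L1 (v k).
  apply: (le_integrable_real (g := fun x => `|h x| + `|u k x|)) => //.
    by move=> x _; rewrite /v; case: (leP (h x) (u k x)) => _; rewrite ?lerDl ?lerDr.
  by apply: integrable_realD => //; exact: integrable_real_abs.
have cv := dominated_L1 mv mh cu hi vb.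
apply: ae_le_approx; first exact: (resolvent_L1 aeE hG).
move=> e e0; have be0 : 0 < b * e by rewrite mulr_gt0.
move/cvgrPdist_lt : cv => /(_ _ be0)[k _ /(_ k (leqnn k))].
rewrite sub0r normrN ger0_norm ?Rintegral_ge0// => lek.
exists (G b (v k)); split; first exact: (resolvent_L1 aeE hG).
- have vu : {ae mu, forall x, v k x <= u k x} by apply: aeW => x; rewrite ge_min lexx orbT.
  have := resolvent_le aeE hG b0 (vi k) (ui k) vu.
  by apply: filterS2 (uY k) => x uY' vu' Dx; rewrite (le_trans vu') ?uY'.
- have hvi : L1 (fun x => h x - v k x) by exact: integrable_realB.
  apply: (@le_trans _ _ (\int[mu]_x `|G b (fun x => h x - v k x) x|)).
    rewrite le_eqVlt; apply/orP; left; apply/eqP; apply: eq_ae_Rintegral => //.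
    + apply: (integrable_real_measurable (mu := mu)); apply: integrable_real_abs => //.
      by apply: integrable_realB => //; exact: (resolvent_L1 aeE hG).
    + apply: (integrable_real_measurable (mu := mu)); apply: integrable_real_abs => //.
      exact: (resolvent_L1 aeE hG).
    + have := resolvent_lin aeE hG (-1) b0 (vi k) hi.
      rewrite (_ : (fun x => -1 * v k x + h x) = (fun x => h x - v k x)); last first.
        by apply/funext => x; rewrite mulN1r addrC.
      by apply: filterS => x -> _; rewrite mulN1r addrC.
  apply: le_trans (resolvent_norm aeE hG b0 hvi) _.
  rewrite ler_pdivrMl//; apply: le_trans (ltW lek).
  by rewrite le_eqVlt; apply/orP; left; apply/eqP; congr Rintegral; apply/funext => x;
    rewrite distrC.
Qed.

(* [t |-> \int_D T_t h] is continuous and nonnegative, and its Laplace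
   transform at [b] is [\int_D G_b h]. *)
Lemma semigroup_eq0_of_resolvent b h D : 0 < b -> measurable D ->
  L1 h -> {ae mu, forall x, 0 <= h x} ->
  {ae mu, forall x, D x -> G b h x <= 0} ->
  forall t, 0 < t -> {ae mu, forall x, D x -> Tbar t h x = 0}.
Proof.
move=> b0 mD hi h0 Gh t t0.
have Ti := semigroup_L1 aeE hTbar t0 hi.
have T0 := semigroup_ge0 aeE hTbar t0 hi h0.
have TiD : mu.-integrable D (EFin \o Tbar t h) by exact: integrableS Ti.
pose phi := orbit_integral mu Tbar D h.
have phi0 s : 0 < s -> 0 <= phi s by move=> s0; exact: (orbit_integral_ge0 aeE hTbar).
have ei := exp_orbit_integrable aeE hTbar b0 mD hi.
have aephi : {ae leb, forall s, (`]0, +oo[%classic : set (measurableTypeR R)) s ->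
    expR (- (b * s)) * phi s = 0}.
  apply: Rintegral_eq0_ae => //.
    by move=> s; rewrite /= in_itv/= andbT => s0; rewrite mulr_ge0 ?expR_ge0 ?phi0.
  rewrite -(resolvent_Rintegral aeE hTG hi b0 mD).
  have Gi := resolvent_L1 aeE hG b0 hi.
  rewrite (_ : 0 = \int[mu]_(x in D) (cst 0 x : R)); last by rewrite Rintegral_cst// mul0r.
  apply: le_ae_Rintegral => //; [exact: integrableS Gi|exact: integrable0].
have phit : phi t = 0.
  (* A positive value at [t] would persist on an interval [[t, t + a[] by continuity, where the
     integrand is then nonzero; but that interval has positive measure. *)
  apply/eqP; rewrite eq_le phi0// andbT leNgt; apply/negP => pt.
  have tI : t \in `]0, +oo[ by rewrite in_itv/= andbT.
  have /cvgrPdist_lt/(_ (phi t) pt)[a /= a0 Ha] :=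
    orbit_integral_continuous aeE hTbar mD hi tI.
  have [A [mA A0 sub]] := aephi.
  have : leb `]t, (t + a)[ = 0%E.
    apply/eqP; rewrite eq_le measure_ge0 andbT -A0 le_measure ?inE//.
    move=> s; rewrite /= in_itv/= => /andP[ts sa]; apply: sub => /=.
    have s0 : 0 < s by rewrite (lt_trans t0).
    rewrite in_itv/= s0 => /(_ isT)/eqP; rewrite mulf_eq0 gt_eqF ?expR_gt0//= => /eqP ps.
    have : `|phi t - phi s| < phi t.
      apply: Ha; rewrite /ball_/= distrC gtr0_norm ?subr_gt0//.
      by rewrite ltrBlDl.
    by rewrite ps subr0 gtr0_norm// ltxx.
  rewrite lebesgue_measure_itv/= lte_fin ltrDl a0 -EFinB addrAC subrr add0r => -[] /eqP.
  by rewrite gt_eqF.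
pose g x := `|Tbar t h x|.
have gi : mu.-integrable D (EFin \o g) by exact: integrable_real_abs.
have : {ae mu, forall x, D x -> g x = 0}.
  apply: Rintegral_eq0_ae => //; first by move=> x _; exact: normr_ge0.
  rewrite -[leRHS]phit le_eqVlt; apply/orP; left; apply/eqP.
  apply: eq_ae_Rintegral => //; [exact: integrable_real_measurable gi|exact:
    integrable_real_measurable TiD|].
  by apply: filterS T0 => x x0 _; rewrite /g ger0_norm.
by apply: filterS => x gx /gx /eqP; rewrite normr_eq0 => /eqP.
Qed.

(** The hypothesis concerns nonnegative L^1 functions, weak invariance all of L^2. An L^2 function
    [q] vanishing on [D] is cut to [qk], which lies in both L^1 and L^2, where [T] and [Tbar] agree,
    and splits into positive and negative parts; the L^2 contraction then lets [k] tend to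
    infinity. *)
Lemma weakly_invariant_of_resolvent b D : 0 < b -> measurable D -> D `<=` E ->
  (forall h, L1 h -> (forall x, 0 <= h x) -> (forall x, D x -> h x = 0) ->
    {ae mu, forall x, D x -> G b h x <= 0}) ->
  weakly_invariant mu E T (E `\` D).
Proof.
move=> b0 mD DE HD; split; [exact: measurableD|by move=> x []|].
move=> t f t0 /(Lp_on_Lfun aeE)/Lfun2P[mf fi].
pose q x := f x * \1_(E `\` D) x.
have mq : measurable_fun setT q.
  by apply: measurable_funM => //; apply: measurable_indic; exact: measurableD.
have qD x : D x -> q x = 0.
  by move=> Dx; rewrite /q indicE memNset ?mulr0//; case.
have q2i : L1 (fun x => q x ^+ 2).
  apply: (le_integrable_real (g := fun x => f x ^+ 2)) => //.
    exact: measurable_funX.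
  move=> x _; rewrite ger0_norm ?sqr_ge0// /q exprMn indicE.
  by case: (x \in _); rewrite ?expr1n ?mulr1// expr0n/= mulr0 sqr_ge0.
(* On this set [|q| <= k.+1 * q^2], so that the restriction of [q] is integrable. *)
pose S k : set Rd := [set x | k.+1%:R^-1 < `|q x|].
have mS k : measurable (S k).
  rewrite [X in measurable X](_ : S k = (fun x => `|q x|) @^-1` `]k.+1%:R^-1, +oo[); last first.
    by apply/seteqP; split => x; rewrite /S /= in_itv/= andbT.
  by rewrite -[X in measurable X]setTI; apply: measurableT_comp.
pose qk k x := q x * \1_(S k) x.
have mqk k : measurable_fun setT (qk k) by apply: measurable_funM => //; exact: measurable_indic.
have qkD k x : D x -> qk k x = 0 by move=> Dx; rewrite /qk qD// mul0r.
have qki k : L1 (qk k).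
  apply: (le_integrable_real (g := fun x => k.+1%:R * q x ^+ 2)) => //;
    last exact: integrable_realZ.
  move=> x _; rewrite /qk indicE; case: (boolP (x \in S k)) => [|_]; last first.
    by rewrite mulr0 normr0 mulr_ge0// sqr_ge0.
  rewrite inE /S /= => kq; rewrite mulr1 -real_normK ?num_real// expr2 mulrA ler_peMl//.
  by rewrite -ler_pdivrMl// mulr1 ltW.
have qkq k x : qk k x ^+ 2 <= q x ^+ 2.
  by rewrite /qk exprMn indicE; case: (x \in S k); rewrite ?expr1n ?mulr1// expr0n mulr0 sqr_ge0.
have qk2i k : L1 (fun x => qk k x ^+ 2).
  apply: (le_integrable_real (g := fun x => q x ^+ 2)) => //; first exact: measurable_funX.
  by move=> x _; rewrite ger0_norm ?sqr_ge0.
have dki k : L1 (fun x => (q x - qk k x) ^+ 2).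
  apply: (le_integrable_real (g := fun x => 4 * q x ^+ 2)) => //; last exact: integrable_realZ.
    by apply: measurable_funX; exact: measurable_funB.
  move=> x _; rewrite ger0_norm ?sqr_ge0//; have := qkq k x.
  by have := sqr_ge0 (q x + qk k x); nra.
have cv : \int[mu]_x `|(q x - qk k x) ^+ 2 - 0| @[k --> \oo] --> 0.
  apply: (@dominated_L1 _ _ _ _ _ _ (fun x => 4 * q x ^+ 2)) => //; last 2 first.
  - exact: integrable_realZ.
  - move=> k; apply: aeW => x; rewrite ger0_norm ?sqr_ge0//; have := qkq k x.
    by have := sqr_ge0 (q x + qk k x); nra.
  - by move=> k; exact: integrable_real_measurable (dki k).
  apply: aeW => x; apply: cvg_near_cst.
  have [qx|qx] := eqVneq (q x) 0; first by apply: nearW => k; rewrite /qk qx mul0r subr0 expr0n.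
  have aq : 0 < `|q x| by rewrite normr_gt0.
  near=> k; rewrite /qk indicE mem_set ?mulr1 ?subrr ?expr0n// /S /=.
  near: k; exact: (near_infty_natSinv_lt (PosNum aq)).
have Tqk k : {ae mu, forall x, D x -> T t (qk k) x = 0}.
  have pi : L1 (fun x => Num.max (qk k x) 0).
    apply: (le_integrable_real (g := fun x => `|qk k x|)) => //; last exact: integrable_real_abs.
      exact: measurable_maxr.
    by move=> x _; case: (leP (qk k x) 0) => _; rewrite ?normr0.
  have ni : L1 (fun x => Num.max (- qk k x) 0).
    apply: (le_integrable_real (g := fun x => `|qk k x|)) => //; last exact: integrable_real_abs.
      by apply: measurable_maxr => //; exact: measurableT_comp.
    by move=> x _; case: (leP (- qk k x) 0) => _; rewrite ?normr0 ?normrN.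
  have P : {ae mu, forall x, D x -> Tbar t (fun x => Num.max (qk k x) 0) x = 0}.
    have p0 x : 0 <= Num.max (qk k x) 0 by rewrite le_max lexx orbT.
    apply: (semigroup_eq0_of_resolvent b0) => //; first exact: aeW.
    by apply: HD => // x Dx; rewrite qkD// maxxx.
  have N : {ae mu, forall x, D x -> Tbar t (fun x => Num.max (- qk k x) 0) x = 0}.
    have p0 x : 0 <= Num.max (- qk k x) 0 by rewrite le_max lexx orbT.
    apply: (semigroup_eq0_of_resolvent b0) => //; first exact: aeW.
    by apply: HD => // x Dx; rewrite qkD// oppr0 maxxx.
  have L := contractionB aeE (semigroup_contraction hTbar t0) pi ni.
  rewrite (_ : (fun x => _ - _) = qk k) in L; last first.
    apply/funext => x; case: (leP (qk k x) 0) => qx.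
      by rewrite max_l ?sub0r ?opprK// oppr_ge0.
    by rewrite max_r ?subr0// oppr_le0 ltW.
  have TT := hTT t0 ((Lp_on_L1 aeE _).2 (qki k)) ((Lp_on_Lfun aeE _ _).2 ((Lfun2P _ _).2 (conj
    (mqk k) (qk2i k)))).
  have LT : {ae mu, forall x, T t (qk k) x =
      Tbar t (fun x => Num.max (qk k x) 0) x - Tbar t (fun x => Num.max (- qk k x) 0) x}.
    by apply: filterS2 L TT => x <- ->.
  by apply: filterS3 P N LT => x Px Nx -> Dx; rewrite Px// Nx// subrr.
have ct : linear_contraction mu 2%:E E (T t) by case: hT => /(_ t t0).
have q2 : Lp_on mu 2%:E E q by apply/(Lp_on_Lfun aeE)/Lfun2P.
have qk2 k : Lp_on mu 2%:E E (qk k) by apply/(Lp_on_Lfun aeE)/Lfun2P.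
have Tq2 : L1 (fun x => T t q x ^+ 2).
  by case: ct => /(_ q q2)/(Lp_on_Lfun aeE)/Lfun2P[].
have mTq : measurable_fun setT (T t q).
  by case: ct => /(_ q q2)/(Lp_on_Lfun aeE)/Lfun2P[].
(* [T t (qk k)] vanishes on [D], so [T t q] agrees there with [T t (q - qk k)]. *)
have bound k : \int[mu]_(x in D) (T t q x ^+ 2) <= \int[mu]_x (q x - qk k x) ^+ 2.
  have dk2 : Lp_on mu 2%:E E (fun x => q x - qk k x).
    apply/(Lp_on_Lfun aeE)/Lfun2P; split => //; exact: measurable_funB.
  case: (ct) => c1 c2 c3.
  have /Lp_on_Lfun-/(_ aeE)/Lfun2P[mTd Td2] := c1 _ dk2.
  apply: (@le_trans _ _ (\int[mu]_(x in D) (T t (fun x => q x - qk k x) x ^+ 2))).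
    rewrite le_eqVlt; apply/orP; left; apply/eqP; apply: eq_ae_Rintegral => //.
    - by apply: (measurable_funS measurableT) => //; exact: measurable_funX.
    - by apply: (measurable_funS measurableT) => //; exact: measurable_funX.
    - have := c2 (-1) _ _ (qk2 k) q2.
      rewrite (_ : (fun x => -1 * qk k x + q x) = (fun x => q x - qk k x)); last first.
        by apply/funext => x; rewrite mulN1r addrC.
      by apply: filterS2 (Tqk k) => x T0 /(_ Logic.I) -> Dx; rewrite T0// mulr0 add0r.
  apply: le_trans (Rintegral_le_norm mD Td2) _.
  under eq_Rintegral do rewrite ger0_norm ?sqr_ge0//.
  rewrite -lee_fin -!integral_EFin//.
  exact: le_Lnorm2 (c3 _ dk2).
have : {ae mu, forall x, D x -> T t q x ^+ 2 = 0}.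
  apply: Rintegral_eq0_ae => //; first exact: integrableS Tq2.
    by move=> x _; exact: sqr_ge0.
  have -> : (0 : R) = limn (fun k => \int[mu]_x `|(q x - qk k x) ^+ 2 - 0|) by rewrite (cvg_lim _
    cv).
  apply: limr_ge; first by apply/cvg_ex; eexists; exact: cv.
  apply: nearW => k; apply: le_trans (bound k) _; rewrite le_eqVlt; apply/orP; left; apply/eqP.
  by congr Rintegral; apply/funext => x; rewrite subr0 ger0_norm ?sqr_ge0.
apply: filterS => x Tx [Ex nD].
have Dx : D x by apply: contrapT => nDx; apply: nD; split.
by have /eqP := Tx Dx; rewrite sqrf_eq0 => /eqP.
Unshelve. all: by end_near. Qed.

End dichotomy.

Section recurrence_dichotomy.
Context {R : realType} {d : nat}.
Local Notation Rd := 'rV[R]_d.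
Local Notation F := (Rd -> R).
Variables (mu : {sigma_finite_measure set Rd -> \bar R}) (E : set Rd).
Hypothesis aeE : {ae mu, forall x, E x}.
Hypothesis mE : measurable E.
Variables G Tbar T : R -> F -> F.
Hypothesis hG : sub_markovian_C0_resolvent mu 1 E G.
Hypothesis hTbar : sub_markovian_C0_semigroup mu 1 E Tbar.
Hypothesis hTG : resolvent_of_semigroup mu E Tbar G.
Hypothesis hT : sub_markovian_C0_semigroup mu 2%:E E T.
Hypothesis hTT : forall t f, 0 < t -> Lp_on mu 1 E f -> Lp_on mu 2%:E E f ->
     T t f = Tbar t f %[ae mu].
Local Notation L1 f := (mu.-integrable setT (EFin \o f)).

Let wi := weakly_invariant_of_resolvent aeE mE hG hTbar hTG hT hTT.

Variable f : F.
Hypotheses (fi : L1 f) (f0 : {ae mu, forall x, 0 <= f x}).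
(** These resolvents increase with [k] and stay below the potential; [g 0] is [G 1 f]. *)
Let g k := G k.+1%:R^-1 f.

Let a0 k : (0 : R) < k.+1%:R^-1. Proof. by []. Qed.
Let gi k : L1 (g k). Proof. exact: (resolvent_L1 aeE hG). Qed.
Let mg k : measurable_fun setT (g k). Proof. exact: integrable_real_measurable (gi k). Qed.
Let g0 k : {ae mu, forall x, 0 <= g k x}. Proof. exact: (resolvent_ge0 aeE hG). Qed.

(** [Z] plays the role of the set where the potential vanishes, [D] of the set where it is finite.
    Expressed by countably many resolvents, they are measurable and open to the resolvent
    equation. *)
Let Z : set Rd := E `&` [set x | g 0 x <= 0].
Let D : set Rd := E `&` [set x | exists M : nat, forall k, g k x <= M%:R].

Let mle k (c : R) : measurable [set x | g k x <= c].
Proof.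
rewrite [X in measurable X](_ : _ = g k @^-1` `]-oo, c]).
  by rewrite -[X in measurable X]setTI; exact: mg.
by apply/seteqP; split => x; rewrite /= in_itv.
Qed.

Let mZ : measurable Z. Proof. exact: measurableI. Qed.

Let mD : measurable D.
Proof.
apply: measurableI => //.
rewrite [X in measurable X](_ : _ = \bigcup_(M : nat) \bigcap_k [set x | g k x <= M%:R]).
  by apply: bigcup_measurable => M _; apply: bigcap_measurable => // k _; exact: mle.
apply/seteqP; split => x /= [M].
  by move=> h; exists M => // k _; exact: h.
by move=> _ h; exists M => k; exact: h.
Qed.

Let min_cvg (u : nat -> R) (a : R) : (\forall k \near \oo, a <= u k) ->
  Num.min a (u k) @[k --> \oo] --> a.
Proof. by move=> h; apply: cvg_near_cst; apply: filterS h => k /min_idPl. Qed.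

(** If [h] vanishes on [Z], then [n * g 0] eventually exceeds [h] at almost every point, while
    [G 2 (g 0) = g 0 - G 2 f <= 0] on [Z] by the resolvent equation. The value 2 is a parameter
    above that of [g 0], which is 1. *)
Let wiZ : weakly_invariant mu E T (E `\` Z).
Proof.
apply: (wi (b := 2)) => //; first by move=> x [].
move=> h hi h0 hZ.
apply: (@resolvent_le_of_approx R d mu E aeE G hG 2 (fun n x => n%:R * g 0 x)) => //.
- by move=> n; exact: integrable_realZ.
- by move=> n; apply: filterS (g0 0) => x; exact: mulr_ge0.
- exact: aeW.
- apply: filterS2 aeE (g0 0) => x Ex gx; apply: min_cvg.
  have [gp|gn] := ltP 0 (g 0 x); last first.
    by apply: nearW => n; rewrite hZ ?mulr_ge0//; split.
  near=> n; rewrite -ler_pdivrMr//; near: n; exact: nbhs_infty_ger.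
- move=> n; have := resolvent_equation aeE hG (ltr0Sn R 1) (a0 0) fi.
  have := resolventZ aeE hG n%:R (ltr0Sn R 1) (gi 0).
  have := resolvent_ge0 aeE hG (ltr0Sn R 1) fi f0.
  apply: filterS3 => x G2 Gn eq [Ex gx].
  rewrite Gn; apply: mulr_ge0_le0 => //.
  have gx' : g 0 x <= 0 := gx; move: eq G2; rewrite -/(g 0) invr1; lra.
Unshelve. all: by end_near. Qed.

Let g_nd : {ae mu, forall x, forall k, g k x <= g k.+1 x}.
Proof.
apply: ae_foralln => k.
have := resolvent_equation aeE hG (a0 k.+1) (a0 k) fi.
have := resolvent_ge0 aeE hG (a0 k.+1) (gi k) (g0 k).
apply: filterS2 => x Gk eq; rewrite -subr_ge0 {}eq mulr_ge0// subr_ge0.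
by rewrite lef_pV2 ?posrE// ler_nat.
Qed.

Let Y x : R := get [set M | forall k, g k x <= M].

Let YP x : D x -> forall k, g k x <= Y x.
Proof.
by move=> [Ex [M hM]]; apply: (@getPex _ [set M | forall k, g k x <= M]); exists M%:R.
Qed.

(** Off [D] the [g k] increase to infinity and so exceed [n * h] for every [n], while
    [G 2 (g k) <= g k <= Y] on [D]. Hence [n * G 2 h <= Y] on [D] for all [n], which forces
    [G 2 h <= 0]. *)
Let wiD : weakly_invariant mu E T (E `\` D).
Proof.
apply: (wi (b := 2)) => //; first by move=> x [].
move=> h hi h0 hD.
have key n : {ae mu, forall x, D x -> G 2 (fun x => n%:R * h x) x <= Y x}.
  apply: (@resolvent_le_of_approx R d mu E aeE G hG 2 g) => //.
  - exact: integrable_realZ.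
  - by apply: aeW => x; rewrite mulr_ge0.
  - apply: filterS3 aeE g_nd (g0 0) => x Ex nd gx.
    have nd' : {homo (fun k => g k x) : m n / (m <= n)%N >-> m <= n}.
      by apply/nondecreasing_seqP.
    have [Dx|nDx] := pselect (D x).
      rewrite hD// mulr0; apply: min_cvg; apply: nearW => k.
      by apply: le_trans gx _; exact: nd'.
    have [k gk] : exists k, n%:R * h x <= g k x.
      apply: contrapT => hk; apply: nDx; split => //.
      exists (Num.truncn (n%:R * h x)).+1 => k; rewrite leNgt; apply/negP => lt.
      apply: hk; exists k; apply: ltW; apply: lt_trans lt; exact: truncnS_gt.
    by apply: min_cvg; exists k => // m /= km; apply: le_trans gk _; exact: nd'.
  - move=> k; have := resolvent_equation aeE hG (ltr0Sn R 1) (a0 k) fi.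
    have := resolvent_ge0 aeE hG (ltr0Sn R 1) fi f0.
    have := resolvent_ge0 aeE hG (ltr0Sn R 1) (gi k) (g0 k).
    apply: filterS3 => x Ggk G2 eq Dx; apply: le_trans (YP Dx k).
    have c1 : 0 <= 1 - k.+1%:R^-1 :> R by rewrite subr_ge0 invf_le1// ler1n.
    have := mulr_ge0 c1 Ggk; move: eq; rewrite -/(g k) => eq P.
    have -> : g k x = G 2 f x - (k.+1%:R^-1 - 2) * G 2 (g k) x by rewrite -eq; ring.
    by move: (G 2 f x) (G 2 (g k) x) (k.+1%:R^-1) P G2 => u w c P G2; lra.
have := ae_foralln key.
have : {ae mu, forall x, forall n : nat, G 2 (fun x => n%:R * h x) x = n%:R * G 2 h x}.
  by apply: ae_foralln => n; exact: (resolventZ aeE hG).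
apply: filterS2 => x Gn hn Dx; rewrite leNgt; apply/negP => G2.
have := hn (Num.truncn (Y x / G 2 h x)).+1 Dx; rewrite Gn -ler_pdivlMr//.
by rewrite leNgt truncnS_gt.
Unshelve. all: by end_near. Qed.

Lemma recurrence_dichotomy : ~ transient mu E Tbar -> strictly_irreducible mu E T ->
  {ae mu, forall x, potential mu E Tbar f x = 0%E \/ potential mu E Tbar f x = +oo%E}.
Proof.
move=> ntrans irr.
have pP := potentialP aeE hTbar hG hTG fi f0.
have aeN S : measurable S -> mu S = 0%E -> {ae mu, forall x, ~ S x}.
  by move=> mS S0; exists S; split => // x /= /contrapT.
have mED : measurable (E `\` D) by exact: measurableD.
have mEZ : measurable (E `\` Z) by exact: measurableD.
have [/(aeN _ mEZ) H|H] := irr _ wiZ.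
  have hN : {ae mu, forall x, forall N : nat, time_integral mu E Tbar N%:R f x <= expR (1 * N%:R)
    * G 1 f x}.
    by apply: ae_foralln => N; exact: (time_integral_le_resolvent aeE hTbar hG hTG).
  apply: filterS3 (aeI aeE pP) H hN => x [Ex [P1 P2 _]] nZ hN'; left.
  have gx : g 0 x <= 0.
    by apply: contrapT => gx; apply: nZ; split => // -[].
  apply/eqP; rewrite eq_le; apply/andP; split; last by have /andP[] := P1 0%N; exact: le_trans.
  apply: P2 => N; apply: le_trans (hN' N) _.
  by apply: mulr_ge0_le0; [exact: expR_ge0|move: gx; rewrite /g invr1].
have {H} gpos : {ae mu, forall x, 0 < g 0 x}.
  have {H} : mu Z = 0%E.
    rewrite -H; congr (mu _); apply/seteqP; split => x; last by move=> [Ex nEZ];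
      apply: contrapT => nZ; apply: nEZ.
    by move=> Zx; split; [case: Zx|move=> [_]].
  move/(aeN _ mZ); apply: filterS2 aeE => x Ex nZ; rewrite ltNge; apply/negP => gx.
  by apply: nZ.
have [/(aeN _ mED) H|H] := irr _ wiD; last first.
  have {H} : mu D = 0%E.
    rewrite -H; congr (mu _); apply/seteqP; split => x; last by move=> [Ex nED];
      apply: contrapT => nD; apply: nED.
    by move=> Dx; split; [case: Dx|move=> [_]].
  move/(aeN _ mD); apply: filterS3 aeE pP => x Ex [P1 _ P3] nD; right.
  apply/eqP; rewrite -leye_eq leNgt; apply/negP => pfin.
  have p0 : (0 <= potential mu E Tbar f x)%E by have /andP[] := P1 0%N; exact: le_trans.
  have pf : potential mu E Tbar f x \is a fin_num by rewrite ge0_fin_numE.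
  apply: nD; split => //; exists (Num.truncn (fine (potential mu E Tbar f x))).+1 => k.
  apply: le_trans (ltW (truncnS_gt _)).
  rewrite -lee_fin fineK//; exact: P3.
exfalso; apply: ntrans; exists (g 0); split.
- exact/(Lp_on_L1 aeE).
- by apply: filterS gpos.
- have pgP := potentialP aeE hTbar hG hTG (gi 0) (g0 0).
  have hN : {ae mu, forall x, forall N : nat, time_integral mu E Tbar N%:R (g 0) x <=
      expR (N.+2%:R^-1 * N%:R) * G N.+2%:R^-1 (g 0) x}.
    apply: ae_foralln => N; apply: (time_integral_le_resolvent aeE hTbar hG hTG) => //.
  (* With the parameter [1 / (N + 2)] the factor in the resolvent equation is at least 1/2, so the
     resolvent of [g 0] is at most [2 * Y] on [D]; [expR 1] covers the exponent
     [N / (N + 2) <= 1]. *)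
  have eqN : {ae mu, forall x, forall N : nat, g N.+1 x - g 0 x = (1 - N.+2%:R^-1) * G N.+2%:R^-1
    (g 0) x}.
    apply: ae_foralln => N; have := resolvent_equation aeE hG (a0 N.+1) (a0 0) fi.
    by apply: filterS => x h; apply: etrans h _; congr ((_ - _) * _); exact: invr1.
  have GN0 : {ae mu, forall x, forall N : nat, 0 <= G N.+2%:R^-1 (g 0) x}.
    by apply: ae_foralln => N; exact: (resolvent_ge0 aeE hG).
  apply: filterS3 (aeI H hN) (aeI eqN gpos) (aeI GN0 pgP) =>
    x [nED hN'] [eqN' gx] [GN0' [P1 P2 _]] Ex.
  have Dx : D x by apply: contrapT => nD; apply: nED.
  apply: (@le_lt_trans _ _ (expR 1 * (2 * Y x))%:E); last exact: ltry.
  apply: P2 => N; apply: le_trans (hN' N) _.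
  have i2 : N.+2%:R^-1 <= (2^-1 : R) by rewrite lef_pV2 ?posrE// ler_nat.
  apply: ler_pM; [exact: expR_ge0|exact: GN0'| |].
    by rewrite ler_expR mulrC ler_pdivrMr// mul1r ler_nat -addn2 leq_addr.
  move: (eqN' N) (YP Dx N.+1) (GN0' N) i2.
  by move: (N.+2%:R^-1) (g 0 x) gx (Y x) (g N.+1 x) (G _ (g 0) x) => c w w0 y v u; nra.
Qed.

End recurrence_dichotomy.

Lemma recurrent_of_irreducible {R : realType} {d : nat}
    (mu : {sigma_finite_measure set 'rV[R]_d -> \bar R}) (E : set 'rV[R]_d)
    (G Tbar T : R -> ('rV[R]_d -> R) -> ('rV[R]_d -> R)) :
  {ae mu, forall x, E x} -> measurable E ->
  sub_markovian_C0_resolvent mu 1 E G -> sub_markovian_C0_semigroup mu 1 E Tbar ->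
  resolvent_of_semigroup mu E Tbar G -> sub_markovian_C0_semigroup mu 2%:E E T ->
  (forall t f, 0 < t -> Lp_on mu 1 E f -> Lp_on mu 2%:E E f -> T t f = Tbar t f %[ae mu]) ->
  ~ transient mu E Tbar -> strictly_irreducible mu E T -> recurrent mu E Tbar.
Proof.
move=> aeE mE hG hTbar hTG hT hTT nt irr f /(Lp_on_L1 aeE) fi f0.
have f0' : {ae mu, forall x, 0 <= f x} by apply: filterS2 aeE f0 => x Ex /(_ Ex).
by apply: filterS (recurrence_dichotomy aeE mE hG hTbar hTG hT hTT fi f0' nt irr).
Qed.

(** * Smooth cutoff functions *)

Section flat_exponential.
Context {R : realType}.

(** To be read with [y = 1 / x]: the uniform bound makes the functions [flat n] bounded, and the
    decay [C / y] gives their differentiability at 0. *)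
Lemma expR_dominates_horner (q : {poly R}) :
  exists2 C : R, 0 <= C & forall y, 0 < y -> `|q.[y]| * expR (- y) <= C /\ (1 <= y ->
    `|q.[y]| * expR (- y) <= C / y).
Proof.
pose S : R := \sum_(i < size q) `|q`_i|.
(* One more than the power of [y] that bounds [q]: the inequality [(y / m)^m <= expR y] then wins by
   a full power of [y]. *)
pose m := (size q).+1.
have S0 : 0 <= S by apply: sumr_ge0.
have m0 : (0 : R) < m%:R by rewrite ltr0n.
have q1 y : 0 < y -> y <= 1 -> `|q.[y]| <= S.
  move=> y0 y1; rewrite horner_coef (le_trans (ler_norm_sum _ _ _))// ler_sum// => i _.
  have y0' := ltW y0.
  by rewrite normrM ler_piMr// ger0_norm ?exprn_ge0// exprn_ile1.
have qm y : 1 <= y -> `|q.[y]| <= S * y ^+ (size q).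
  move=> y1; rewrite horner_coef (le_trans (ler_norm_sum _ _ _))// mulr_suml ler_sum// => i _.
  rewrite normrM ler_wpM2l// ger0_norm ?exprn_ge0 ?(le_trans ler01)//.
  by rewrite ler_weXn2l// ltnW.
have ey y : 0 < y -> (y / m%:R) ^+ m <= expR y.
  move=> y0; have -> : expR y = expR (y / m%:R) ^+ m.
    by rewrite -expRM_natr mulfVK// gt_eqF.
  have y0' := ltW y0; rewrite lerXn2r ?nnegrE ?expR_ge0 ?divr_ge0//.
  by apply: le_trans (expR_ge1Dx _); rewrite lerDr.
pose C := S * m%:R ^+ m.
have m1 : 1 <= m%:R ^+ m :> R by rewrite exprn_ege1// ler1n.
have SC : S <= C by rewrite ler_peMr.
have big y : 1 <= y -> `|q.[y]| * expR (- y) <= C / y.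
  move=> y1; have y0 : 0 < y by rewrite (lt_le_trans ltr01).
  rewrite expRN ler_pdivrMr ?expR_gt0//; apply: le_trans (qm y y1) _.
  rewrite /C -!mulrA ler_wpM2l// -ler_pdivrMl ?exprn_gt0//.
  apply: le_trans (_ : y^-1 * (y / m%:R) ^+ m <= _); last first.
    by rewrite ler_wpM2l ?ey// invr_ge0 ltW.
  by rewrite expr_div_n [y ^+ m]exprS mulrA mulKf ?gt_eqF// mulrC.
exists C; first by rewrite (le_trans S0).
move=> y y0; split; last exact: big.
have [y1|y1] := leP 1 y.
  by apply: le_trans (big y y1) _; rewrite ler_piMr ?(le_trans S0)// invf_le1.
apply: le_trans SC; apply: le_trans (q1 y y0 (ltW y1)).
by rewrite ler_piMr// -expR0 ler_expR oppr_le0 ltW.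
Qed.

(* [flat n] is the n-th derivative of [x |-> exp (- 1 / x)] on [x > 0], extended by 0. *)
Fixpoint flat_poly (n : nat) : {poly R} :=
  if n is k.+1 then 'X^2 * (flat_poly k - (flat_poly k)^`()) else 1.

Definition flat n (x : R) : R := if 0 < x then (flat_poly n).[x^-1] * expR (- x^-1) else 0.

Lemma flat_le0 n x : x <= 0 -> flat n x = 0.
Proof. by rewrite /flat ltNge => ->. Qed.

Lemma flat_bounded n : exists2 C : R, 0 <= C & forall x, `|flat n x| <= C.
Proof.
have [C C0 HC] := expR_dominates_horner (flat_poly n); exists C => // x.
rewrite /flat; case: ifPn => x0; last by rewrite normr0.
rewrite normrM (ger0_norm (expR_ge0 _)).
by have [] := HC x^-1 ltac:(by rewrite invr_gt0).
Qed.

Lemma is_derive_flat n (x : R) : is_derive x 1 (flat n) (flat n.+1 x).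
Proof.
have [x0|x0|->] := ltgtP x 0.
- rewrite (flat_le0 _ (ltW x0)).
  apply: (@near_eq_is_derive _ _ _ (cst 0) _ _ _ 0).
  near=> y; rewrite flat_le0//; apply: ltW; near: y; exact: lt_nbhsl.
- have D1 : is_derive x 1 (fun y : R => y^-1) (- x ^- 2).
    have := @is_deriveV R id x 1 1 (lt0r_neq0 x0) (is_derive_id _ _).
    move=> H; apply: (is_derive_eq H); rewrite /GRing.scale/= mulr1//.
  have D2 : is_derive x 1 (fun y : R => (flat_poly n).[y^-1]) ((flat_poly n)^`().[x^-1] * - x ^- 2).
    by have := @is_derive1_comp R (horner (flat_poly n)) (fun y =>
      y^-1) x _ _ (is_derive_poly _ _) D1.
  have D3 : is_derive x 1 (fun y : R => expR (- y^-1)) (expR (- x^-1) * x ^- 2).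
    have D4 : is_derive x 1 (fun y : R => - y^-1) (x ^- 2).
      by apply: (is_derive_eq (is_deriveN D1)); rewrite opprK.
    by have := @is_derive1_comp R expR (fun y => - y^-1) x _ _ (is_derive_expR _) D4.
  apply: (@near_eq_is_derive _ _ _ ((fun y : R => (flat_poly n).[y^-1]) * (fun y : R =>
    expR (- y^-1))) _ _ _ (flat n.+1 x)).
    near=> y; rewrite /flat ifT//; near: y; exact: lt_nbhsr.
  apply: (is_derive_eq (is_deriveM D2 D3)).
  rewrite /flat x0 /= hornerM hornerD hornerN hornerXn /GRing.scale/= exprVn; ring.
rewrite flat_le0//.
(* The extra factor ['X] absorbs the [1 / h] of the difference quotient, and the decay [C / y] at
   [y = 1 / h] makes the quotient at most [C * h]. *)
have [C C0 HC] := expR_dominates_horner ('X * flat_poly n).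
have cv : h^-1 *: (flat n (h *: 1 + 0) - flat n 0) @[h --> (0 : R)^'] --> (0 : R).
  apply/cvgrPdist_le => e e0.
  have C1 : 0 < e / (C + 1) by rewrite divr_gt0// ltr_wpDl.
  near=> h; rewrite sub0r normrN (flat_le0 n (lexx 0)) subr0 addr0.
  rewrite /GRing.scale/= mulr1 /flat.
  case: ifPn => h0; last by rewrite mulr0 normr0 ltW.
  have h1 : `|h| < 1 by near: h; apply: dnbhs0_lt.
  have he : `|h| < e / (C + 1) by near: h; apply: dnbhs0_lt.
  rewrite gtr0_norm// in h1 he.
  have hV : 1 <= h^-1 by rewrite invf_ge1 ?ltW.
  have [_ /(_ hV)] := HC h^-1 ltac:(by rewrite invr_gt0).
  rewrite invrK hornerM hornerX !normrM mulrA (ger0_norm (expR_ge0 _)) => H.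
  apply: le_trans H _; rewrite ltr_pdivlMr ?ltr_wpDl// in he.
  by nra.
split; first by apply/cvg_ex; exists 0.
exact: cvg_lim.
Unshelve. all: by end_near. Qed.

Lemma flat_ge0 x : 0 <= flat 0 x.
Proof. by rewrite /flat/=; case: ifP => // _; rewrite hornerC mul1r expR_ge0. Qed.

Lemma flat_gt0 x : 0 < x -> 0 < flat 0 x.
Proof. by move=> x0; rewrite /flat/= x0 hornerC mul1r expR_gt0. Qed.

Lemma flat_le x y : x <= y -> flat 0 x <= flat 0 y.
Proof.
move=> xy; rewrite /flat/= !hornerC !mul1r; case: ifPn => x0; last by case: ifP => // _;
  rewrite expR_ge0.
have y0 : 0 < y by rewrite (lt_le_trans x0).
by rewrite y0 ler_expR lerN2 lef_pV2.
Qed.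

Lemma flat_continuous n : continuous (flat n).
Proof.
move=> x; apply: differentiable_continuous; apply/derivable1_diffP.
by have [] := is_derive_flat n x.
Qed.

Lemma flat_lipschitz n : exists2 C : R, 0 <= C & forall x y, `|flat n x - flat n y| <= C * `|x - y|.
Proof.
have [C C0 HC] := flat_bounded n.+1; exists C => // x y.
wlog xy : x y / x < y.
  move=> H; have [xy|yx|->] := ltgtP x y; first exact: H.
    by rewrite distrC (distrC x); exact: H.
  by rewrite !subrr normr0 mulr0.
have [c _ E] := @MVT R (flat n) (flat n.+1) x y xy (fun c _ => is_derive_flat n c)
   (continuous_subspaceT (@flat_continuous n)).
by rewrite distrC E normrM (distrC x) ler_wpM2r.
Qed.

Definition step_top : R := expR (-1).

(* A smooth step without integration or division of functions: [flat 0] is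
   exactly 0 on [x <= 0], and [flat 0 x >= step_top] for [x >= 1]. *)
Definition step (x : R) : R := (flat 0 step_top)^-1 * flat 0 (step_top - flat 0 x).
Definition step' (x : R) : R :=
  (flat 0 step_top)^-1 * (flat 1 (step_top - flat 0 x) * - flat 1 x).

Lemma flat_step_top : 0 < flat 0 step_top.
Proof. by apply: flat_gt0; exact: expR_gt0. Qed.

Lemma flat01 x : 1 <= x -> step_top <= flat 0 x.
Proof.
move=> x1; apply: le_trans (flat_le x1).
by rewrite /flat/= ltr01 hornerC mul1r invr1.
Qed.

Lemma step_le0 x : x <= 0 -> step x = 1.
Proof. by move=> x0; rewrite /step (flat_le0 0 x0) subr0 mulVf// gt_eqF// flat_step_top. Qed.

Lemma step_ge1 x : 1 <= x -> step x = 0.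
Proof.
move=> /flat01 x1; have x0 : step_top - flat 0 x <= 0 by rewrite subr_le0.
by rewrite /step (flat_le0 0 x0) mulr0.
Qed.

Lemma step'_le0 x : x <= 0 -> step' x = 0.
Proof. by move=> x0; rewrite /step' (flat_le0 1 x0) oppr0 !mulr0. Qed.

Lemma step'_ge1 x : 1 <= x -> step' x = 0.
Proof.
move=> /flat01 x1; have x0 : step_top - flat 0 x <= 0 by rewrite subr_le0.
by rewrite /step' (flat_le0 1 x0) mul0r mulr0.
Qed.

Lemma step_itv x : 0 <= step x <= 1.
Proof.
rewrite /step mulr_ge0 ?flat_ge0 ?invr_ge0 ?flat_ge0//= ler_pdivrMl ?flat_step_top// mulr1.
by apply: flat_le; rewrite gerBl flat_ge0.
Qed.

Lemma is_derive_step (x : R) : is_derive x 1 step (step' x).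
Proof.
have D1 : is_derive x 1 (fun y => step_top - flat 0 y) (- flat 1 x).
  by apply: (is_derive_eq (is_deriveB (is_derive_cst step_top x 1) (is_derive_flat 0 x)));
    rewrite sub0r.
have D2 := @is_derive1_comp R (flat 0) _ x _ _ (is_derive_flat 0 _) D1.
exact: (is_derive_eq (is_deriveZ (flat 0 step_top)^-1 D2)).
Qed.

Lemma step'_bounded : exists2 C : R, 0 <= C & forall x, `|step' x| <= C.
Proof.
have [C C0 HC] := flat_bounded 1.
have i0 : 0 <= (flat 0 step_top)^-1 by rewrite invr_ge0 flat_ge0.
exists ((flat 0 step_top)^-1 * (C * C)); first by rewrite !mulr_ge0.
move=> x; rewrite /step' normrM (ger0_norm i0) ler_wpM2l// normrM normrN ler_pM//.
Qed.

(** Needed to compare the derivative of the profile at [rho] with its value at a smooth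
    approximation of [rho]; the two terms of the constant are those of the product rule for
    differences. *)
Lemma step'_lipschitz : exists2 C : R, 0 <= C & forall x y, `|step' x - step' y| <= C * `|x - y|.
Proof.
have [B B0 HB] := flat_bounded 1.
have [C C0 HC] := flat_lipschitz 0; have [D D0 HD] := flat_lipschitz 1.
have i0 : 0 <= (flat 0 step_top)^-1 by rewrite invr_ge0 flat_ge0.
exists ((flat 0 step_top)^-1 * (D * C * B + B * D)).
  by rewrite mulr_ge0// addr_ge0// !mulr_ge0.
move=> x y; rewrite /step' -mulrBr normrM (ger0_norm i0) -[leRHS]mulrA; apply: ler_wpM2l => //.
set u := step_top - _; set v := step_top - _.
have -> : flat 1 u * - flat 1 x - flat 1 v * - flat 1 y =
  (flat 1 v - flat 1 u) * flat 1 x + flat 1 v * (flat 1 y - flat 1 x).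
  by move: (flat 1 u) (flat 1 v) (flat 1 x) (flat 1 y) => *; ring.
have uv : `|v - u| <= C * `|x - y|.
  by rewrite /u /v (_ : _ - _ = flat 0 x - flat 0 y) ?HC//; ring.
rewrite [leRHS]mulrDl (le_trans (ler_normD _ _))// lerD// normrM.
  rewrite (_ : D * C * B * _ = D * (C * `|x - y|) * B); last by ring.
  by apply: ler_pM => //; apply: le_trans (HD v u) _; rewrite ler_wpM2l.
by rewrite -mulrA; apply: ler_pM => //; rewrite (distrC x); exact: HD.
Qed.
End flat_exponential.

(** * Smooth functions of several variables and cutoffs *)

Section smooth_functions.
Context {R : realType} {d : nat}.
Local Notation Rd := 'rV[R]_d.
Implicit Types (f g : Rd -> R).
Local Notation e_ i := (delta_mx ord0 i : Rd).

(** [Ck n] says nothing explicit about lower orders, and existence of partial derivatives alone does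
    not give continuity. Collecting all orders up to [n] makes the inductions for products and
    compositions go through. *)
Definition smooth_upto n f := forall k, (k <= n)%N -> Ck k f.

Lemma smooth_uptoS n f : smooth_upto n.+1 f <->
  [/\ continuous f, forall i x, derivable f x (e_ i) &
      forall i, smooth_upto n (partial_derivative i f)].
Proof.
split=> [fn|[cf df pf]].
  split; first exact: (fn 0%N).
    by have [] := fn 1%N isT.
  by move=> i k kn; have [_] := fn k.+1 kn; exact.
case=> [//|k] kn; split=> // i; exact: pf.
Qed.

Lemma smooth_upto_leq m n f : (m <= n)%N -> smooth_upto n f -> smooth_upto m f.
Proof. by move=> mn fn k km; apply: fn; exact: leq_trans mn. Qed.

Lemma smooth_derivable f i x : smooth f -> derivable f x (e_ i).
Proof. by move=> /(_ 1%N)[]. Qed.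

Lemma smooth_is_derive f i x : smooth f -> is_derive x (e_ i) f (partial_derivative i f x).
Proof. by move=> sf; apply: derivableP; exact: smooth_derivable. Qed.

Lemma smooth_partial f i : smooth f -> smooth (partial_derivative i f).
Proof. by move=> sf k; have [_ H] := sf k.+1; exact: H. Qed.

Lemma smooth_continuous f : smooth f -> continuous f.
Proof. by move=> /(_ 0%N). Qed.

Lemma smooth_upto_cst n (c : R) : smooth_upto n (fun _ : Rd => c).
Proof.
elim: n c => [|n IH] c; first by move=> [|//] _; exact: cst_continuous.
apply/smooth_uptoS; split=> [|i x|i]; first exact: cst_continuous.
  exact: derivable_cst.
rewrite (_ : partial_derivative i _ = fun=> 0); first exact: IH.
by apply/funext => x; rewrite /partial_derivative derive_cst.
Qed.

Lemma smooth_uptoD n f g : smooth_upto n f -> smooth_upto n g ->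
  smooth_upto n (fun x => f x + g x).
Proof.
elim: n f g => [|n IH] f g.
  move=> f0 g0 [|//] _ x; exact: cvgD (f0 0%N isT x) (g0 0%N isT x).
move=> /smooth_uptoS[cf df pf] /smooth_uptoS[cg dg pg].
apply/smooth_uptoS; split=> [x|i x|i].
- exact: cvgD (cf x) (cg x).
- exact: derivableD (df i x) (dg i x).
- rewrite (_ : partial_derivative i _ = fun x => partial_derivative i f x + partial_derivative i
  g x).
    exact: IH.
  by apply/funext => x; rewrite /partial_derivative (deriveD (df i x) (dg i x)).
Qed.

Lemma smooth_uptoM n f g : smooth_upto n f -> smooth_upto n g ->
  smooth_upto n (fun x => f x * g x).
Proof.
elim: n f g => [|n IH] f g.
  move=> f0 g0 [|//] _ x; exact: cvgM (f0 0%N isT x) (g0 0%N isT x).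
move=> fn gn; have /smooth_uptoS[cf df pf] := fn; have /smooth_uptoS[cg dg pg] := gn.
apply/smooth_uptoS; split=> [x|i x|i].
- exact: cvgM (cf x) (cg x).
- exact: derivableM (df i x) (dg i x).
- rewrite (_ : partial_derivative i _ = fun x => f x * partial_derivative i g x + g x *
  partial_derivative i f x).
    apply: smooth_uptoD; apply: IH => //; exact: smooth_upto_leq (leqnSn n) _.
  by apply/funext => x; rewrite /partial_derivative (deriveM (df i x) (dg i x)).
Qed.

(** Restriction to a line reduces directional derivatives to one variable, where the chain rule
    applies. *)
Lemma is_derive_line (f : Rd -> R) x v l : is_derive x v f l <->
  is_derive (0 : R) (1 : R) (fun t => f (t *: v + x)) l.
Proof.
have E : (fun h : R => h^-1 *: (f (h *: v + x) - f x)) =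
   (fun h : R => h^-1 *: (f ((h *: 1 + 0) *: v + x) - f (0 *: v + x))).
  by apply/funext => h; rewrite addr0 scale0r add0r /GRing.scale/= mulr1.
by split=> -[dx vx]; split; [move: dx|move: vx|move: dx|move: vx];
  rewrite /derivable /derive /= -?E ?E.
Qed.

Lemma is_derive_comp (h : R -> R) (f : Rd -> R) x v a b :
  is_derive (f x) 1 h a -> is_derive x v f b -> is_derive x v (fun y => h (f y)) (a * b).
Proof.
move=> ha /is_derive_line fb; apply/is_derive_line.
apply: (@is_derive1_comp R h (fun t => f (t *: v + x)) 0) fb.
by rewrite scale0r add0r.
Qed.

(** The induction is over all [m] at once, since differentiation raises the index of [flat]. *)
Lemma smooth_upto_flat n m f : smooth_upto n f -> smooth_upto n (fun x => flat m (f x)).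
Proof.
elim: n m f => [|n IH] m f.
  move=> f0 [|//] _ x; apply: (@continuous_comp _ _ _ f (flat m)); first exact: f0 0%N isT x.
  exact: flat_continuous.
move=> fn; have /smooth_uptoS[cf df pf] := fn.
have D i x := is_derive_comp (is_derive_flat m (f x)) (derivableP (df i x)).
apply/smooth_uptoS; split=> [x|i x|i].
- by apply: (@continuous_comp _ _ _ f (flat m)); [exact: cf|exact: flat_continuous].
- by have [] := D i x.
- rewrite (_ : partial_derivative i _ = fun x => flat m.+1 (f x) * partial_derivative i f x).
    by apply: smooth_uptoM => //; apply: IH; exact: smooth_upto_leq (leqnSn n) _.
  by apply/funext => x; have [_] := D i x.
Qed.

Lemma smoothP f : smooth f <-> forall n, smooth_upto n f.
Proof. by split=> [sf n k _|sf k]; [exact: (sf k)|exact: (sf k k (leqnn k))]. Qed.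

Lemma smooth_cst (c : R) : smooth (fun _ : Rd => c).
Proof. by apply/smoothP => n; exact: smooth_upto_cst. Qed.

Lemma smoothD f g : smooth f -> smooth g -> smooth (fun x => f x + g x).
Proof. by move=> /smoothP sf /smoothP sg; apply/smoothP => n; exact: smooth_uptoD. Qed.

Lemma smoothM f g : smooth f -> smooth g -> smooth (fun x => f x * g x).
Proof. by move=> /smoothP sf /smoothP sg; apply/smoothP => n; exact: smooth_uptoM. Qed.

Lemma smoothZ (c : R) f : smooth f -> smooth (fun x => c * f x).
Proof. by move=> sf; apply: smoothM => //; exact: smooth_cst. Qed.

Lemma smoothB f g : smooth f -> smooth g -> smooth (fun x => f x - g x).
Proof.
move=> sf sg; rewrite (_ : (fun x => _) = fun x => f x + -1 * g x).
  by apply: smoothD => //; exact: smoothZ.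
by apply/funext => x; rewrite mulN1r.
Qed.

Lemma smooth_sum (I : Type) (s : seq I) (F : I -> Rd -> R) :
  (forall i, smooth (F i)) -> smooth (fun x => \sum_(i <- s) F i x).
Proof.
move=> sF; elim: s => [|i s IH].
  by under [X in smooth X]funext do rewrite big_nil; exact: smooth_cst.
by under [X in smooth X]funext do rewrite big_cons; exact: smoothD.
Qed.

Lemma smooth_flat m f : smooth f -> smooth (fun x => flat m (f x)).
Proof. by move=> /smoothP sf; apply/smoothP => n; exact: smooth_upto_flat. Qed.

Lemma smooth_step f : smooth f -> smooth (fun x => step (f x)).
Proof.
move=> sf; apply: smoothZ; apply: smooth_flat; apply: smoothB; first exact: smooth_cst.
exact: smooth_flat.
Qed.

Lemma smooth_coord (i : 'I_d) : smooth (fun x : Rd => x ord0 i).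
Proof.
have D j x : is_derive x (e_ j) (fun x : Rd => x ord0 i) ((j == i)%:R : R).
  apply/is_derive_line.
  rewrite (_ : (fun t : R => _) = (fun t : R => t * (j == i)%:R + x ord0 i)); last first.
    by apply/funext => t; rewrite !mxE eqxx/= eq_sym.
  have H1 : is_derive (0 : R) 1 (fun t : R => t) 1 by exact: is_derive_id.
  have H2 (c : R) : is_derive (0 : R) 1 (fun t : R => c) 0 by exact: is_derive_cst.
  have H := is_deriveD (is_deriveM H1 (H2 (j == i)%:R)) (H2 (x ord0 i)).
  by apply: (is_derive_eq H); rewrite scaler0 add0r addr0 /GRing.scale/= mulr1.
apply/smoothP; case=> [|n].
  by move=> [|//] _; exact: coord_continuous.
apply/smooth_uptoS; split; first exact: coord_continuous.
  by move=> j x; have [] := D j x.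
move=> j; rewrite (_ : partial_derivative j _ = fun=> (j == i)%:R); first exact: smooth_upto_cst.
by apply/funext => x; have [_] := D j x.
Qed.

(** Squared Euclidean distance, smooth as opposed to the sup norm; the sum runs over a list to fit
    [smooth_sum]. *)
Definition sqdist (p x : Rd) : R := \sum_(i <- enum 'I_d) (x ord0 i - p ord0 i) * (x ord0 i - p
  ord0 i).

Lemma smooth_sqdist p : smooth (sqdist p).
Proof.
apply: smooth_sum => i; have s : smooth (fun x : Rd => x ord0 i - p ord0 i).
  by apply: smoothB; [exact: smooth_coord|exact: smooth_cst].
exact: smoothM.
Qed.

Lemma sqdist_coord (p x : Rd) i : (x ord0 i - p ord0 i) ^+ 2 <= sqdist p x.
Proof.
rewrite /sqdist big_enum/= (bigD1 i)//= expr2 lerDl sumr_ge0// => j _.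
by rewrite -expr2 sqr_ge0.
Qed.

(** Finitely many bumps cover [K]; their sum [s] is at least some [m > 0] there, and
    [step (1 - s / m)] is 1 where [s >= m] and 0 where [s = 0]. The gradient vanishes at every point
    of [K], boundary included, because [step'] is 0 on the closed half-line of nonpositive
    numbers. *)
Lemma smooth_cutoff (K Om : set Rd) : compact K -> open Om -> K `<=` Om ->
  exists eta : Rd -> R, [/\ smooth eta, compact (supp setT eta), supp setT eta `<=` Om,
    forall x, 0 <= eta x <= 1 & forall x, K x -> eta x = 1 /\ forall i,
      partial_derivative i eta x = 0].
Proof.
move=> cK oOm KOm.
(* Twice the radius, so that the closed cubes of radius [r p] stay inside [Om]. *)
have H (p : Rd) : exists r : R, 0 < r /\ (K p -> ball p (2 * r) `<=` Om).
  have [Kp|nKp] := pselect (K p); last by exists 1; split => // /nKp.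
  have /nbhs_ballP[e /= e0 eO] : nbhs p Om by apply: open_nbhs_nbhs; split => //; exact: KOm.
  exists (e / 2); split; first by rewrite divr_gt0.
  by move=> _; rewrite mulrC divfK.
have [r rP] := choice H.
pose be p x := flat 0 (r p ^+ 2 - sqdist p x).
have sbe p : smooth (be p).
  by apply: smooth_flat; apply: smoothB; [exact: smooth_cst|exact: smooth_sqdist].
have r0 p : 0 < r p by case: (rP p).
have beP p x : 0 < be p x -> forall i, `|p ord0 i - x ord0 i| < r p.
  move=> b0 i; rewrite distrC -ltr_sqr ?nnegrE//; last exact: ltW.
  rewrite real_normK ?num_real//; apply: le_lt_trans (sqdist_coord p x i) _; rewrite ltNge;
    apply/negP => le.
  by move: b0; rewrite /be flat_le0 ?ltxx// subr_le0.
pose U p := [set x | 0 < be p x].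
have oU p : open (U p).
  rewrite (_ : U p = be p @^-1` [set y | 0 < y]) //.
  by apply: open_comp; [move=> x _; exact: (smooth_continuous (sbe p))|exact: open_gt].
have Up p : U p p.
  rewrite /U /= /be; apply: flat_gt0; rewrite /sqdist big1 ?subr0 ?exprn_gt0//.
  by move=> i _; rewrite subrr mul0r.
have cK' := cK; rewrite compact_cover in cK'.
have KU : K `<=` cover K U by move=> x Kx; exists x => //; exact: Up.
have [D DK KD] : exists2 D : seq Rd, forall p, p \in D -> K p & K `<=` cover [set` D] U.
  have [D DK KD] := cK' Rd K U (fun p _ => oU p) KU.
  by exists (finmap.enum_fset D) => // p pD; apply/set_mem; exact: DK.
pose s x := \sum_(p <- D) be p x.
have ss : smooth s by exact: smooth_sum.
have be0 p x : 0 <= be p x by exact: flat_ge0.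
have s0 x : 0 <= s x by apply: sumr_ge0.
have sgt x : K x -> 0 < s x.
  move=> /KD[p pD Upx]; rewrite /s (big_rem p)//= ltr_pwDl// ?sumr_ge0//.
have [m m0 Hm] : exists2 m : R, 0 < m & forall x, K x -> m <= s x.
  have [->|K0] := eqVneq K set0; first by exists 1.
  have /set0P K0' := K0.
  have [c /set_mem Kc cm] := EVT_min_rV K0' cK (continuous_subspaceT (smooth_continuous ss)).
  by exists (s c); [exact: sgt|move=> x Kx; apply: cm; exact/mem_set].
pose y x := 1 - m^-1 * s x.
have sy : smooth y by apply: smoothB; [exact: smooth_cst|exact: smoothZ].
pose eta x := step (y x).
have seta : smooth eta by exact: smooth_step.
(* A finite union of closed cubes: a compact set that contains the support of [eta]. *)
pose C := \bigcup_(p in [set` D]) [set x : Rd | forall i, `|p ord0 i - x ord0 i| <= r p].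
have etaC x : eta x != 0 -> C x.
  move=> ex; have : 0 < s x.
    rewrite lt_neqAle s0 andbT eq_sym; apply/eqP => sx0; move: ex.
    by rewrite /eta /y sx0 mulr0 subr0 step_ge1 ?eqxx.
  rewrite /s lt_neqAle s0 andbT eq_sym psumr_neq0//.
  move=> /hasP[p pD /andP[_ bp]]; exists p; first exact: pD.
  by move=> i; apply: ltW; exact: beP.
have clC : closed C.
  apply: closed_bigcup; first exact: finite_seq.
  move=> p _.
  rewrite (_ : [set x | _] = \bigcap_(i in [set: 'I_d]) [set x : Rd | `|p ord0 i - x ord0 i| <= r
    p]); last first.
    by apply/seteqP; split => x h i; [move=> _|]; exact: h.
  apply: closed_bigI => i _.
  apply: (@closed_comp _ _ (fun x : Rd => `|p ord0 i - x ord0 i|) [set z | z <= r p]);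
    last exact: closed_le.
  move=> x _; apply: (@continuous_comp _ _ _ (fun x : Rd => p ord0 i - x ord0 i) (fun z : R =>
    `|z|)).
    apply: smooth_continuous; apply: smoothB; [exact: smooth_cst|exact: smooth_coord].
  exact: norm_continuous.
have Cball (p x : Rd) : (forall i, `|p ord0 i - x ord0 i| <= r p) -> ball p (2 * r p) x.
  move=> h; split=> [|i j]; first by rewrite mulr_gt0.
  by rewrite ord1 /ball/= (le_lt_trans (h j))// ltr_pMl// ltr1n.
have CO : C `<=` Om.
  move=> x [p pD Hp]; have Kp : K p by exact: DK.
  have [_ /(_ Kp)] := rP p; apply; exact: Cball.
have cC : compact C.
  apply: bounded_closed_compact => //.
  pose M : R := \sum_(p <- D) (`|p| + 2 * r p).
  exists M; split; first exact: num_real.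
  move=> M' MM' x [p pD Hp]; apply: ltW; apply: le_lt_trans MM'.
  have := Cball p x Hp; rewrite mx_norm_ball /ball_/= => px.
  rewrite /M (big_rem p)//= -[leLHS]addr0 lerD//; last first.
    by apply: sumr_ge0 => q _; rewrite addr_ge0// mulr_ge0// ltW.
  rewrite -[x](subrK p) (le_trans (ler_normD _ _))// addrC lerD2l distrC ltW//.
have sub : supp setT eta `<=` C.
  rewrite /supp setTI [X in _ `<=` X](closure_id _).1//.
  by apply: closureS => x; exact: etaC.
exists eta; split => //.
- by apply: subclosed_compact cC sub; exact: closed_closure.
- exact: subset_trans sub CO.
- by move=> x; exact: step_itv.
- move=> x Kx; have y0 : y x <= 0.
    by rewrite /y subr_le0 ler_pdivlMl// mulr1 Hm.
  split; first by rewrite /eta step_le0.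
  move=> i; have [_ dE] := is_derive_comp (is_derive_step (y x)) (smooth_is_derive i x sy).
  by apply: etrans dE _; rewrite step'_le0// mul0r.
Qed.

End smooth_functions.

(** * The form and the drift *)

Lemma continuous_measurable_rV {R : realType} {d : nat} (f : 'rV[R]_d -> R) :
  continuous f -> measurable_fun setT f.
Proof.
move=> cf; apply: (measurability _ (RGenOpens.measurableE R)).
move=> _ [_ [a [b ->]] <-]; rewrite setTI.
apply: open_measurable_mx; apply: open_comp; last exact: interval_open.
by move=> x _; exact: cf.
Qed.

Lemma closed_measurable_rV {R : realType} {d : nat} (S : set 'rV[R]_d) :
  closed S -> measurable S.
Proof.
move=> cS; rewrite -[S]setCK; apply: measurableC; apply: open_measurable_mx.
exact: closed_openC.
Qed.

Lemma compact_measurable_rV {R : realType} {d : nat} (S : set 'rV[R]_d) :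
  compact S -> measurable S.
Proof. by move=> cS; apply: closed_measurable_rV; apply: compact_closed => //;
  exact: norm_hausdorff. Qed.

Section dot_product.
Context {R : realType} {d : nat}.
Implicit Types (x y z : 'rV[R]_d) (M : 'M[R]_d).

Lemma dotpE M x y : dotp (mx_apply M x) y = \sum_i \sum_j M i j * (x ord0 j * y ord0 i).
Proof.
rewrite /dotp /mx_apply; apply: eq_bigr => i _; rewrite mxE mulr_suml.
by apply: eq_bigr => j _; rewrite mxE; ring.
Qed.

Lemma dotpC x y : dotp x y = dotp y x.
Proof. by apply: eq_bigr => i _; rewrite mulrC. Qed.

Lemma dotpDl x y z : dotp (x + y) z = dotp x z + dotp y z.
Proof. by rewrite /dotp -big_split; apply: eq_bigr => i _; rewrite mxE mulrDl. Qed.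

Lemma dotpZl c x y : dotp (c *: x) y = c * dotp x y.
Proof. by rewrite /dotp mulr_sumr; apply: eq_bigr => i _; rewrite mxE mulrA. Qed.

Lemma dotpBl x y z : dotp (x - y) z = dotp x z - dotp y z.
Proof. by rewrite -scaleN1r dotpDl dotpZl mulN1r. Qed.

Lemma dotpBr x y z : dotp x (y - z) = dotp x y - dotp x z.
Proof. by rewrite !(dotpC x) dotpBl. Qed.

Lemma dotpDr x y z : dotp x (y + z) = dotp x y + dotp x z.
Proof. by rewrite !(dotpC x) dotpDl. Qed.

Lemma dotpZr c x y : dotp x (c *: y) = c * dotp x y.
Proof. by rewrite !(dotpC x) dotpZl. Qed.

Lemma mx_applyB M x y : mx_apply M (x - y) = mx_apply M x - mx_apply M y.
Proof. by rewrite /mx_apply mulmxBl. Qed.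

Lemma mx_applyD M x y : mx_apply M (x + y) = mx_apply M x + mx_apply M y.
Proof. by rewrite /mx_apply mulmxDl. Qed.

Lemma mx_applyZ M c x : mx_apply M (c *: x) = c *: mx_apply M x.
Proof. by rewrite /mx_apply scalemxAl. Qed.

Lemma dotp_ge0 x : 0 <= dotp x x.
Proof. by apply: sumr_ge0 => i _; rewrite -expr2 sqr_ge0. Qed.

Lemma enorm_sqr x : enorm x ^+ 2 = dotp x x.
Proof. by rewrite /enorm sqr_sqrtr// dotp_ge0. Qed.

Lemma enorm_sqrE x : enorm x ^+ 2 = \sum_i x ord0 i ^+ 2.
Proof. by rewrite enorm_sqr; apply: eq_bigr => i _; rewrite expr2. Qed.

Lemma coord_sqr_le x i : x ord0 i ^+ 2 <= enorm x ^+ 2.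
Proof. by rewrite enorm_sqrE (bigD1 i)//= lerDl sumr_ge0// => j _; rewrite sqr_ge0. Qed.

Lemma sym_part_quad M x :
  \sum_i \sum_j sym_part M i j * x ord0 i * x ord0 j = dotp (mx_apply M x) x.
Proof.
rewrite dotpE.
transitivity (2^-1 * (\sum_i \sum_j M i j * (x ord0 j * x ord0 i)
   + \sum_i \sum_j M j i * (x ord0 j * x ord0 i))).
  rewrite -big_split/= mulr_sumr; apply: eq_bigr => i _.
  rewrite -big_split/= mulr_sumr; apply: eq_bigr => j _.
  by rewrite /sym_part !mxE; ring.
rewrite [X in _ + X]exchange_big/= [X in _ + X](_ : _ = \sum_i \sum_j M i j * (x ord0 j * x ord0
  i)).
  by field.
by apply: eq_bigr => i _; apply: eq_bigr => j _; rewrite [x ord0 i * _]mulrC.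
Qed.

(** The cross terms cancel in [Q(x + y) + Q(x - y) = 2 Q(x) + 2 Q(y)], whether or not [M] is
    symmetric. *)
Lemma quad_parallelogram M x y : 0 <= dotp (mx_apply M (x - y)) (x - y) ->
  dotp (mx_apply M (x + y)) (x + y) <=
    2 * dotp (mx_apply M x) x + 2 * dotp (mx_apply M y) y.
Proof.
rewrite mx_applyB mx_applyD !(dotpBl, dotpBr, dotpDl, dotpDr); lra.
Qed.

End dot_product.

Section gradient.
Context {R : realType} {d : nat}.
Implicit Types (f g : 'rV[R]_d -> R).

Lemma gradE f x i : grad f x ord0 i = partial_derivative i f x.
Proof. by rewrite mxE. Qed.

Lemma gradB f g x : smooth f -> smooth g -> grad (fun y => f y - g y) x = grad f x - grad g x.
Proof.
move=> sf sg; apply/rowP => i; rewrite !mxE.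
by rewrite /partial_derivative -(deriveB (@smooth_derivable _ _ f i x sf) (@smooth_derivable _ _
  g i x sg)).
Qed.

Lemma gradM f g x : smooth f -> smooth g ->
  grad (fun y => f y * g y) x = f x *: grad g x + g x *: grad f x.
Proof.
move=> sf sg; apply/rowP => i; rewrite !mxE.
by rewrite /partial_derivative -(deriveM (@smooth_derivable _ _ f i x sf) (@smooth_derivable _ _
  g i x sg)).
Qed.

Lemma grad_comp (h : R -> R) f x a : is_derive (f x) 1 h a -> smooth f ->
  grad (fun y => h (f y)) x = a *: grad f x.
Proof.
move=> dh sf; apply/rowP => i; rewrite !mxE.
by have [_] := is_derive_comp dh (smooth_is_derive i x sf).
Qed.

Lemma supp_eq0 f x : ~ supp setT f x -> f x = 0.
Proof.
move=> nx; apply/eqP/negPn/negP => fx; apply: nx.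
by apply: subset_closure; split.
Qed.

Lemma supp_partial f i x : ~ supp setT f x -> partial_derivative i f x = 0.
Proof.
move=> nx.
have : \near x, cst 0 x = f x.
  have oS : open (~` supp setT f) by apply: closed_openC; exact: closed_closure.
  have := open_nbhs_nbhs (conj oS nx); apply: filterS => y ny.
  by rewrite (supp_eq0 ny).
move=> H; have := @near_eq_is_derive _ _ _ (cst 0) f x (delta_mx ord0 i) 0 H (is_derive_cst 0 x _).
by case.
Qed.

End gradient.

Section form_theory.
Context {R : realType} {d : nat}.
Local Notation Rd := 'rV[R]_d.
Local Notation F := (Rd -> R).
Variables (mu : {sigma_finite_measure set Rd -> \bar R}) (E : set Rd).
Variables (A : Rd -> 'M[R]_d) (B : Rd -> Rd).
Hypothesis aeE : {ae mu, forall x, E x}.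
Hypothesis mE : measurable E.
Hypothesis oE : open E \/ closed E.
Hypothesis muK : forall K, compact K -> K `<=` E -> (mu K < +oo)%E.
Hypothesis hA_loc : forall i j, L1loc mu E (fun x => A x i j).
Local Notation Q x xi := (dotp (mx_apply (A x) xi) xi).
Hypothesis hell : forall K, compact K -> K `<=` E -> exists2 nu : R, 0 < nu &
  forall x xi, K x -> enorm xi ^+ 2 <= nu * Q x xi /\ Q x xi <= nu * enorm xi ^+ 2.
Hypothesis hclosable : form0_closable mu E A.
Hypothesis hsector : strong_sector mu E A.
Hypothesis hexh : exists Kn : nat -> set Rd,
  [/\ forall n, compact (Kn n) /\ Kn n `<=` E, forall m n, (m <= n)%N -> Kn m `<=` Kn n &
      forall K, compact K -> K `<=` E -> exists n, K `<=` Kn n].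
Hypothesis hB_loc : forall i, L2loc mu E (fun x => B x ord0 i).
Hypothesis hB_div : divergence_free mu E B.
Implicit Types (f g h b u v : F) (K : set Rd).

Lemma quad_ge0 x xi : E x -> 0 <= Q x xi.
Proof.
move=> Ex; have [nu nu0 H] := hell (@compact_set1 _ x) (fun y (yx : [set x] y) => eq_ind_r E Ex yx).
have H1 : 0 <= nu * Q x xi by apply: le_trans (sqr_ge0 (enorm xi)) _; case: (H x xi erefl).
by rewrite pmulr_rge0 in H1.
Qed.

(** The multipliers that turn local integrability into integrability over [E]. The conditions are
    imposed on [E] only, since for closed [E] a test function may be nonzero beyond it. *)
Definition bounded_cpt b := measurable_fun setT b /\ exists K M,
  [/\ compact K, K `<=` E, 0 <= M & forall x, E x -> `|b x| <= M /\ (~ K x -> b x = 0)].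

Lemma bounded_cptM b c : bounded_cpt b -> bounded_cpt c -> bounded_cpt (fun x => b x * c x).
Proof.
move=> [mb [K [M [cK KE M0 H]]]] [mc [K' [M' [cK' KE' M'0 H']]]].
split; first exact: measurable_funM.
exists K, (M * M'); split; rewrite ?mulr_ge0// => x Ex.
have [bM b0] := H x Ex; have [cM c0] := H' x Ex.
by split; [rewrite normrM ler_pM|move=> /b0 ->; rewrite mul0r].
Qed.

Lemma bounded_cpt_locM h b K : compact K -> K `<=` E -> mu.-integrable K (EFin \o h) ->
  bounded_cpt b -> mu.-integrable K (EFin \o (fun x => h x * b x)).
Proof.
move=> cK KE hi [mb [K' [M [_ _ M0 H]]]].
have mK := compact_measurable_rV cK.
have hMi : mu.-integrable K (EFin \o (fun x => M * `|h x|)).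
  by apply: integrable_realZ => //; exact: integrable_real_abs.
apply: le_integrable_real hMi => //.
  apply: measurable_funM; first exact: integrable_real_measurable hi.
  exact: measurable_funS mb.
by move=> x Kx; rewrite normrM mulrC ler_wpM2r//; have [] := H x (KE _ Kx).
Qed.

Lemma bounded_cpt_integrable h b : L1loc mu E h -> bounded_cpt b ->
  mu.-integrable E (EFin \o (fun x => h x * b x)).
Proof.
move=> hl bb; have [mb [K [M [cK KE M0 H]]]] := bb.
have mK := compact_measurable_rV cK.
have hbi := bounded_cpt_locM cK KE (hl K cK KE) bb.
have /integrableP[mhb ihb] := hbi.
have Eq x : E x -> (EFin \o (fun x => h x * b x)) x = ((EFin \o (fun x => h x * b x)) \_ K) x.
  move=> Ex; rewrite patchE; case: ifPn => // /negP nK /=.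
  have [_ ->] := H x Ex; first by rewrite mulr0.
  by move=> Kx; apply: nK; exact/mem_set.
apply: (eq_integrable mE ((EFin \o (fun x => h x * b x)) \_ K)).
  by move=> x /set_mem Ex; rewrite Eq.
apply: (integrableS measurableT mE) => //.
by apply/(integrable_mkcond _ mK).
Qed.

Lemma L1loc_cst (c : R) : L1loc mu E (fun=> c).
Proof.
move=> K cK KE; have mK := compact_measurable_rV cK.
apply/integrableP; split; first exact/measurable_EFinP.
by rewrite integral_cst//= lte_mul_pinfty// muK.
Qed.

Lemma bounded_cpt_int1 b : bounded_cpt b -> mu.-integrable E (EFin \o b).
Proof.
move=> bb; have := bounded_cpt_integrable (L1loc_cst 1) bb.
by congr integrable; apply/funext => x /=; rewrite mul1r.
Qed.

Let muEc : mu (~` E) = 0%E.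
Proof.
by apply: measure_negligible; [exact: measurableC|exact: aeE].
Qed.

Lemma integralTE (f : Rd -> \bar R) : measurable_fun setT f -> (forall x, (0 <= f x)%E) ->
  (\int[mu]_x f x = \int[mu]_(x in E) f x)%E.
Proof.
move=> mf f0; rewrite (@ge0_negligible_integral _ _ _ mu setT (~` E))//.
- by rewrite setTD setCK.
- exact: measurableC.
Qed.

Lemma integrableTE f : measurable_fun setT f -> mu.-integrable E (EFin \o f) ->
  mu.-integrable setT (EFin \o f).
Proof.
move=> mf /integrableP[_ fi]; apply/integrableP; split; first exact/measurable_EFinP.
rewrite integralTE//.
by apply/measurable_EFinP/measurableT_comp.
Qed.

Lemma test_supp_compact f : test_fun E f -> compact (E `&` supp setT f).
Proof.
move=> [_ cf sf]; case: oE => [/sf sE|clE]; last by rewrite setIC; exact: compact_closedI.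
by rewrite (_ : E `&` _ = supp setT f)//; apply/setIidPr.
Qed.

Lemma bounded_cpt_of_supp f b : test_fun E f -> continuous b ->
  (forall x, ~ supp setT f x -> b x = 0) -> bounded_cpt b.
Proof.
move=> tf cb b0; split; first exact: continuous_measurable_rV.
have cK := test_supp_compact tf; set K := _ `&` _ in cK.
have [M M0 HM] : exists2 M, 0 <= M & forall x, K x -> `|b x| <= M.
  have [K0|K0] := pselect (K !=set0); last first.
    by exists 0 => // x Kx; exfalso; apply: K0; exists x.
  have cab : {within K, continuous (fun x => `|b x|)}.
    apply: continuous_subspaceT => x.
    by apply: (@continuous_comp _ _ _ b (fun z : R => `|z|)); [exact: cb|exact: norm_continuous].
  have [c _ cM] := EVT_max_rV K0 cK cab.
  by exists `|b c| => // x Kx; apply: cM; exact/mem_set.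
exists K, M; split=> // [x []//|x Ex]; have [Kx|nK] := pselect (K x).
  by split => //; exact: HM.
have bx : b x = 0 by apply: b0 => sx; apply: nK.
by rewrite bx normr0.
Qed.

Lemma test_bounded_cpt f : test_fun E f -> bounded_cpt f.
Proof.
move=> tf; apply: (bounded_cpt_of_supp tf); last by move=> x; exact: supp_eq0.
by case: tf => sf _ _; exact: smooth_continuous.
Qed.

Lemma test_partial_bounded_cpt f i : test_fun E f -> bounded_cpt (partial_derivative i f).
Proof.
move=> tf; apply: (bounded_cpt_of_supp tf); last by move=> x; exact: supp_partial.
by case: tf => sf _ _; apply: smooth_continuous; exact: smooth_partial.
Qed.

Lemma test_sub f g : test_fun E f -> test_fun E g -> test_fun E (fun x => f x - g x).
Proof.
move=> [sf cf tf] [sg cg tg].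
have sub : supp setT (fun x => f x - g x) `<=` supp setT f `|` supp setT g.
  rewrite /supp -closureU; apply: closureS => x [_ /= fg].
  have [f0|f0] := eqVneq (f x) 0; last by left; split.
  by right; split => //=; apply/eqP => g0; move: fg; rewrite f0 g0 subrr eqxx.
split.
- exact: smoothB.
- by apply: subclosed_compact sub; [exact: closed_closure|exact: compactU].
- by move=> oE'; apply: subset_trans sub _ => x [/(tf oE')|/(tg oE')].
Qed.

Lemma test_mul f g : test_fun E f -> smooth g -> test_fun E (fun x => f x * g x).
Proof.
move=> [sf cf tf] sg.
have sub : supp setT (fun x => f x * g x) `<=` supp setT f.
  apply: closureS => x [_ /= fg]; split => //=.
  by apply/eqP => f0; move: fg; rewrite f0 mul0r eqxx.
split; first exact: smoothM.
  by apply: subclosed_compact sub => //; exact: closed_closure.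
by move=> oE'; apply: subset_trans sub _; exact: tf.
Qed.

Lemma test_cst0 : test_fun E (fun=> 0).
Proof.
have s0 : supp setT (fun=> 0 : R) = set0 :> set Rd.
  by rewrite /supp (_ : _ `&` _ = set0) ?closure0//; apply/seteqP; split => x //= [_]; rewrite eqxx.
split; first exact: smooth_cst.
  by rewrite s0; exact: compact0.
by rewrite s0 => _; exact: sub0set.
Qed.

Lemma form0_integrable f g : test_fun E f -> test_fun E g ->
  mu.-integrable E (EFin \o (fun x => dotp (mx_apply (A x) (grad f x)) (grad g x))).
Proof.
move=> tf tg; rewrite (_ : EFin \o _ = fun x =>
  (\sum_i \sum_j (A x i j * (partial_derivative j f x * partial_derivative i g x))%:E)%E).
  apply: integrable_sum => // i _; apply: integrable_sum => // j _.
  apply: bounded_cpt_integrable => //.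
  by apply: bounded_cptM; exact: test_partial_bounded_cpt.
apply/funext => x /=; rewrite dotpE.
under [RHS]eq_bigr do rewrite sumEFin.
rewrite sumEFin; congr EFin; apply: eq_bigr => i _; apply: eq_bigr => j _.
by rewrite !gradE.
Qed.

Local Notation fm := (form0 mu E A).

Lemma form0Bl f f' g : test_fun E f -> test_fun E f' -> test_fun E g ->
  fm (fun x => f x - f' x) g = fm f g - fm f' g.
Proof.
move=> tf tf' tg; rewrite /form0 -(RintegralB mE (form0_integrable tf tg) (form0_integrable tf'
  tg)).
apply: eq_Rintegral => x _; have [sf _ _] := tf; have [sf' _ _] := tf'.
by rewrite gradB// mx_applyB dotpBl.
Qed.

Lemma form0Br f g g' : test_fun E f -> test_fun E g -> test_fun E g' ->
  fm f (fun x => g x - g' x) = fm f g - fm f g'.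
Proof.
move=> tf tg tg'; rewrite /form0 -(RintegralB mE (form0_integrable tf tg) (form0_integrable tf
  tg')).
apply: eq_Rintegral => x _; have [sg _ _] := tg; have [sg' _ _] := tg'.
by rewrite gradB// dotpBr.
Qed.

Lemma form0_ge0 f : 0 <= fm f f.
Proof. by apply: Rintegral_ge0 => x Ex; exact: quad_ge0. Qed.

Lemma form0_triangle f g : test_fun E f -> test_fun E g ->
  fm f f <= 2 * fm (fun x => f x - g x) (fun x => f x - g x) + 2 * fm g g.
Proof.
move=> tf tg; have tfg := test_sub tf tg.
have i0 := form0_integrable tf tf.
have i1 := integrable_realZ 2 mE (form0_integrable tfg tfg).
have i2 := integrable_realZ 2 mE (form0_integrable tg tg).
have e1 := RintegralZl 2 mE (form0_integrable tfg tfg).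
have e2 := RintegralZl 2 mE (form0_integrable tg tg).
rewrite /form0; apply: le_trans (_ : _ <= \int[mu]_(x in E) (2 * Q x (grad (fun x =>
  f x - g x) x) + 2 * Q x (grad g x))) _.
  apply: (le_Rintegral mE i0 (integrable_realD mE i1 i2)).
  move=> x Ex; have [sf _ _] := tf; have [sg _ _] := tg.
  have -> : grad f x = grad (fun x => f x - g x) x + grad g x by rewrite gradB// subrK.
  by apply: quad_parallelogram; exact: quad_ge0.
by rewrite (RintegralD mE i1 i2) e1 e2.
Qed.

Local Opaque form0.

Lemma form0_cauchy_bounded (f_ : nat -> F) : (forall n, test_fun E (f_ n)) ->
  form0_cauchy mu E A f_ ->
  exists2 C, 0 <= C & forall n, fm (f_ n) (f_ n) <= C.
Proof.
move=> tf /(_ 1 ltr01)[N HN].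
pose C := \sum_(k < N) fm (f_ k) (f_ k) + (2 * 1 + 2 * fm (f_ N) (f_ N)).
have q0 k : 0 <= fm (f_ k) (f_ k) by exact: form0_ge0.
exists C; first by rewrite !addr_ge0 ?sumr_ge0 ?mulr_ge0.
move=> n; have [Nn|nN] := leqP N n.
  apply: le_trans (form0_triangle (tf n) (tf N)) _.
  rewrite /C -[leLHS]add0r lerD ?sumr_ge0//.
  by rewrite lerD2r ler_wpM2l// ltW//; exact: HN.
rewrite /C (bigD1 (Ordinal nN))//= -addrA -[leLHS]addr0 lerD//.
by rewrite !addr_ge0 ?sumr_ge0 ?mulr_ge0.
Qed.

Lemma form0_cauchyB (f_ g_ : nat -> F) : (forall n, test_fun E (f_ n)) -> (forall n,
  test_fun E (g_ n)) ->
  form0_cauchy mu E A f_ -> form0_cauchy mu E A g_ ->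
  form0_cauchy mu E A (fun n x => f_ n x - g_ n x).
Proof.
move=> tf tg cf cg e e0.
have e4 : 0 < e / 4 by rewrite divr_gt0.
have [N HN] := cf _ e4; have [M HM] := cg _ e4.
exists (maxn N M) => m n; rewrite !geq_max => /andP[Nm Mm] /andP[Nn Mn].
pose a := (fun x => f_ m x - f_ n x); pose b := (fun x => g_ m x - g_ n x).
have ta : test_fun E a by exact: test_sub.
have tb : test_fun E b by exact: test_sub.
(* [form0_triangle] is used for the pair [a - b] and [- b], whose difference is [a]. *)
have tnb : test_fun E (fun x => 0 - b x) by apply: test_sub => //; exact: test_cst0.
rewrite (_ : _ \- _ = (fun x => a x - b x)); last by apply/funext => x; rewrite /a /b /=; ring.
have := form0_triangle (test_sub ta tb) tnb.
have Ha := HN m n Nm Nn; have Hb := HM m n Mm Mn.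
have -> : (fun x => a x - b x - (0 - b x)) = a by apply/funext => x; ring.
have -> : fm (fun x => 0 - b x) (fun x => 0 - b x) = fm b b.
  have t0 := test_cst0.
  have z1 g : test_fun E g -> fm (fun=> 0) g = 0.
    by move=> tg'; have := form0Bl t0 t0 tg'; under eq_fun do rewrite subrr; rewrite subrr.
  have z2 g : test_fun E g -> fm g (fun=> 0) = 0.
    by move=> tg'; have := form0Br tg' t0 t0; under eq_fun do rewrite subrr; rewrite subrr.
  rewrite (form0Bl t0 tb tnb) (form0Br t0 t0 tb) (form0Br tb t0 tb) (z1 _ t0) (z1 _ tb) (z2 _ tb).
  by rewrite subrr !sub0r opprK.
move=> H; apply: le_lt_trans H _.
have -> : e = 2 * (e / 4) + 2 * (e / 4) by field.
by apply: ltrD; rewrite ltr_pM2l; [exact: Ha|by []|exact: Hb|by []].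
Qed.

(** The difference of two sequences approximating the same [u] is Cauchy for the form and tends to 0
    in L^2, so closability applies to it. *)
Lemma form0_sub_cvg0 V V' (f_ f'_ : nat -> F) u : form_approx mu E A V f_ u ->
  form_approx mu E A V' f'_ u ->
  forall e, 0 < e -> \forall n \near \oo, fm (fun x => f_ n x - f'_ n x) (fun x =>
    f_ n x - f'_ n x) < e.
Proof.
move=> [tf cf u2 Lf] [tf' cf' _ Lf'] e e0.
have t n : test_fun E (f_ n) by have [] := tf n.
have t' n : test_fun E (f'_ n) by have [] := tf' n.
have cff := form0_cauchyB t t' cf cf'.
have L0 : Lp_cvg mu 2%:E (fun n x => f_ n x - f'_ n x) (cst 0).
  have LL : ('N[mu]_2%:E[(fun x => (f_ n x - u x)%:E)] + 'N[mu]_2%:E[(fun x =>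
    (f'_ n x - u x)%:E)])%E
      @[n --> \oo] --> 0%E.
    by rewrite -[X in _ --> X]adde0; apply: cvgeD.
  apply: squeeze_cvge LL; last exact: cvg_cst.
  apply: nearW => n; rewrite Lnorm_ge0/=.
  have mu_ : measurable_fun setT u by move/Lfun2P : u2 => [].
  have mf : measurable_fun setT (f_ n) by have [] := test_bounded_cpt (t n).
  have mf' : measurable_fun setT (f'_ n) by have [] := test_bounded_cpt (t' n).
  have := @minkowski_EFin _ _ _ mu (fun x => f_ n x - u x) (fun x => u x - f'_ n x) 2
    (measurable_funB mf mu_) (measurable_funB mu_ mf') (ler1n _ 2).
  rewrite (_ : (EFin \o _) = (fun x => (f_ n x - f'_ n x - cst 0 x)%:E)); last first.
    by apply/funext => x /=; congr EFin; rewrite subr0; ring.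
  move=> h; apply: le_trans h _; rewrite leeD2l//.
  rewrite -(oppe_Lnorm mu (fun x => (f'_ n x - u x)%:E)) le_eqVlt; apply/orP; left; apply/eqP.
  by apply: eq_Lnorm => x; rewrite /= opprB.
have := hclosable (fun n => test_sub (t n) (t' n)) cff L0.
move/cvgrPdist_lt => /(_ e e0); apply: filterS => n.
by rewrite sub0r normrN ger0_norm// form0_ge0.
Qed.

Lemma sector_small : exists2 S : R, 0 < S & forall f g, test_fun E f -> test_fun E g ->
  `|fm f g| <= S * (Num.sqrt (fm f f) * Num.sqrt (fm g g)).
Proof. by case: hsector => S S0 H; exists S => // f g tf tg; rewrite mulrA; exact: H. Qed.

(** Joint continuity of the form on sets of bounded energy, from the sector condition: the
    difference splits into the values of the form at [f - f', g] and at [f', g - g'], so that only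
    [g] and [f'] need energy bounds. *)
Lemma form0_close (C e : R) : 0 <= C -> 0 < e -> exists2 del, 0 < del & forall f f' g g',
  test_fun E f -> test_fun E f' -> test_fun E g -> test_fun E g' ->
  fm g g <= C -> fm f' f' <= C ->
  fm (fun x => f x - f' x) (fun x => f x - f' x) < del ->
  fm (fun x => g x - g' x) (fun x => g x - g' x) < del ->
  `|fm f g - fm f' g'| <= e.
Proof.
move=> C0 e0; have [S S0 HS] := sector_small.
pose c := Num.sqrt C + 1.
have c0 : 0 < c by rewrite ltr_wpDl ?sqrtr_ge0.
pose s := e / (2 * S * c); have s0 : 0 < s by rewrite divr_gt0// !mulr_gt0.
exists (s ^+ 2); first by rewrite exprn_gt0.
move=> f f' g g' tf tf' tg tg' gC f'C df dg.
have -> : fm f g - fm f' g' = fm (fun x => f x - f' x) g + fm f' (fun x => g x - g' x).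
  by rewrite (form0Bl tf tf' tg) (form0Br tf' tg tg') addrA subrK.
have sq z : z < s ^+ 2 -> Num.sqrt z <= s.
  by move=> zs; rewrite -(ger0_norm (ltW s0)) -sqrtr_sqr ler_wsqrtr// ltW.
have sC z : z <= C -> Num.sqrt z <= c.
  by move=> zC; apply: le_trans (_ : Num.sqrt C <= _); [exact: ler_wsqrtr|rewrite lerDl].
have b1 := HS _ _ (test_sub tf tf') tg; have b2 := HS _ _ tf' (test_sub tg tg').
have -> : e = S * (s * c) + S * (c * s).
  by rewrite /s; field; rewrite !gt_eqF.
apply: le_trans (ler_normD _ _) _; apply: lerD.
- apply: le_trans b1 _; rewrite ler_wpM2l ?(ltW S0)//.
  by apply: ler_pM; [exact: sqrtr_ge0|exact: sqrtr_ge0|exact: sq|exact: sC].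
- apply: le_trans b2 _; rewrite ler_wpM2l ?(ltW S0)//.
  by apply: ler_pM; [exact: sqrtr_ge0|exact: sqrtr_ge0|exact: sC|exact: sq].
Qed.

Lemma form_approx_near V (f_ g_ f'_ g'_ : nat -> F) u v :
  form_approx mu E A V f_ u -> form_approx mu E A V f'_ u ->
  form_approx mu E A V g_ v -> form_approx mu E A V g'_ v ->
  forall e, 0 < e -> \forall n \near \oo, `|fm (f_ n) (g_ n) - fm (f'_ n) (g'_ n)| <= e.
Proof.
move=> af af' ag ag' e e0.
have tf n : test_fun E (f_ n) by have [/(_ n)[]] := af.
have tf' n : test_fun E (f'_ n) by have [/(_ n)[]] := af'.
have tg n : test_fun E (g_ n) by have [/(_ n)[]] := ag.
have tg' n : test_fun E (g'_ n) by have [/(_ n)[]] := ag'.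
have [_ cg _ _] := ag; have [_ cf' _ _] := af'.
have [C1 C10 H1] := form0_cauchy_bounded tg cg; have [C2 C20 H2] := form0_cauchy_bounded tf' cf'.
have [del d0 H] := form0_close (addr_ge0 C10 C20) e0.
apply: filterS2 (form0_sub_cvg0 af af' d0) (form0_sub_cvg0 ag ag' d0) => n h1 h2.
apply: (H _ _ _ _ (tf n) (tf' n) (tg n) (tg' n) _ _ h1 h2).
- by apply: le_trans (H1 n) _; rewrite lerDl.
- by apply: le_trans (H2 n) _; rewrite lerDr.
Qed.

Lemma form_approx_cvg V (f_ g_ : nat -> F) u v :
  form_approx mu E A V f_ u -> form_approx mu E A V g_ v -> cvgn (fun n => fm (f_ n) (g_ n)).
Proof.
move=> af ag.
have tf n : test_fun E (f_ n) by have [/(_ n)[]] := af.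
have tg n : test_fun E (g_ n) by have [/(_ n)[]] := ag.
have [_ cg _ _] := ag; have [_ cf _ _] := af.
have [C1 C10 H1] := form0_cauchy_bounded tg cg; have [C2 C20 H2] := form0_cauchy_bounded tf cf.
apply: cauchy_cvg; apply: cauchy_exP => e e0.
have e20 : 0 < e / 2 by rewrite divr_gt0.
have [del d0 H] := form0_close (addr_ge0 C10 C20) e20.
have [N HN] := cf _ d0; have [M HM] := cg _ d0.
pose m := maxn N M; exists (fm (f_ m) (g_ m)).
exists m => // n /= mn; rewrite /ball/=.
apply: (@le_lt_trans _ _ (e / 2)); last by rewrite ltr_pdivrMr// ltr_pMr// ltr1n.
have h1 := HN m n (leq_maxl N M) (leq_trans (leq_maxl N M) mn).
have h2 := HM m n (leq_maxr N M) (leq_trans (leq_maxr N M) mn).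
apply: (H _ _ _ _ (tf m) (tf n) (tg m) (tg n) _ _ h1 h2).
- by apply: le_trans (H1 m) _; rewrite lerDl.
- by apply: le_trans (H2 n) _; rewrite lerDr.
Qed.

(** The closed form is a value chosen by [get] as the limit along some approximating sequences;
    closability and the sector condition make the limit the same along all of them. *)
Lemma formP V (f_ g_ : nat -> F) u v :
  form_approx mu E A V f_ u -> form_approx mu E A V g_ v ->
  fm (f_ n) (g_ n) @[n --> \oo] --> Defs.form mu E A V u v.
Proof.
move=> af ag.
have [f'_ [g'_ [af' ag' cv]]] : [set e : R | exists f_ g_ : nat -> F, [/\ form_approx mu E A V f_ u,
    form_approx mu E A V g_ v & fm (f_ n) (g_ n) @[n --> \oo] --> e]] (Defs.form mu E A V u v).
  have /cvg_ex[l Hl] := form_approx_cvg af ag.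
  by apply: (@getPex _ [set _ | _]); exists l; exists f_, g_.
apply/cvgrPdist_le => e e0; have e20 : 0 < e / 2 by rewrite divr_gt0.
move/cvgrPdist_le : cv => /(_ _ e20) cv.
have nr := form_approx_near af af' ag ag' e20.
apply: filterS2 cv nr => n c1 c2.
rewrite (_ : _ - _ = (Defs.form mu E A V u v - fm (f'_ n) (g'_ n)) + - (fm (f_ n) (g_ n) - fm
  (f'_ n) (g'_ n))).
  by rewrite (splitr e) (le_trans (ler_normD _ _))// lerD// normrN.
by rewrite opprB addrA subrK.
Qed.

Lemma test_supp_sub f : test_fun E f -> supp E f `<=` E.
Proof.
move=> [_ _ sf]; case: oE => [oE'|cE].
  apply: subset_trans (sf oE'); apply: closureS => x [Ex fx]; split => //.
by rewrite [X in _ `<=` X](closure_id _).1//; apply: closureS => x [].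
Qed.

Lemma test_Lfun2 f : test_fun E f -> f \in Lfun mu 2%:E.
Proof.
move=> tf; have bf := test_bounded_cpt tf; have [mf _] := bf.
apply/Lfun2P; split => //; apply: integrableTE; first exact: measurable_funX.
exact: bounded_cpt_int1 (bounded_cptM bf bf).
Qed.

Lemma test_form_approx V g : test_fun E g -> supp E g `<=` V ->
  form_approx mu E A V (fun=> g) g.
Proof.
move=> tg sg; split => //; last 2 first.
- exact: test_Lfun2.
- rewrite /Lp_cvg (_ : (fun=> _) = cst 0%E); first exact: cvg_cst.
  apply/funext => n /=; rewrite (_ : (fun x => _) = cst 0%E); first by rewrite Lnorm0.
  by apply/funext => x; rewrite subrr.
- move=> e e0; exists 0%N => m n _ _.
  have -> : fm (g \- g) (g \- g) = 0; last by [].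
  have := form0Bl tg tg (test_sub tg tg); rewrite subrr; exact.
Qed.

Lemma form_sector : exists2 S : R, 0 < S & forall u g, form_dom mu E A E u -> test_fun E g ->
  `|Defs.form mu E A E u g| <= S * (Num.sqrt (Defs.form mu E A E u u) * Num.sqrt (fm g g)).
Proof.
have [S S0 HS] := sector_small; exists S => // u g [f_ af] tg.
have tf n : test_fun E (f_ n) by have [/(_ n)[]] := af.
have ag := test_form_approx tg (test_supp_sub tg).
have c1 := formP af ag; have c2 := formP af af.
have c3 : `|fm (f_ n) g| @[n --> \oo] --> `|Defs.form mu E A E u g| by exact: cvg_norm c1.
have c4 : S * (Num.sqrt (fm (f_ n) (f_ n)) * Num.sqrt (fm g g)) @[n --> \oo]
    --> S * (Num.sqrt (Defs.form mu E A E u u) * Num.sqrt (fm g g)).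
  apply: cvgM; first exact: cvg_cst.
  apply: cvgM; last exact: cvg_cst.
  exact: (continuous_cvg _ (@sqrt_continuous R _) c2).
apply: (ler_cvg_to c3 c4); apply: nearW => n; exact: HS.
Qed.

Lemma ereal_cvg0P (u : nat -> \bar R) : (forall n, (0 <= u n)%E) ->
  (forall e, 0 < e -> exists N, forall n, (N <= n)%N -> (u n <= e%:E)%E) -> u n @[n --> \oo] -->
    0%E.
Proof.
move=> u0 H; apply/fine_cvgP; split.
  have [N HN] := H 1 ltr01; exists N => // n /= Nn.
  by rewrite ge0_fin_numE// (le_lt_trans (HN n Nn))// ltry.
apply/cvgrPdist_le => e e0; have [N HN] := H e e0; exists N => // n /= Nn.
rewrite sub0r normrN ger0_norm ?fine_ge0//.
have uf : u n \is a fin_num by rewrite ge0_fin_numE// (le_lt_trans (HN n Nn))// ltry.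
by rewrite -lee_fin fineK// HN.
Qed.

Lemma ereal_cvg0_near (u : nat -> \bar R) e : u n @[n --> \oo] --> 0%E -> 0 < e ->
  (forall n, (0 <= u n)%E) -> \forall n \near \oo, (u n <= e%:E)%E.
Proof.
move=> /fine_cvgP[uf /cvgrPdist_le/(_ e)] H e0 u0; move: (H e0) => {}H.
apply: filterS2 uf H => n un; rewrite sub0r normrN ger0_norm ?fine_ge0//.
by rewrite -lee_fin fineK.
Qed.

Lemma partial_measurable f i : test_fun E f -> measurable_fun setT (partial_derivative i f).
Proof. by move=> tf; have [] := test_partial_bounded_cpt i tf. Qed.

(** Local ellipticity turns Cauchy sequences for the form into sequences whose gradients are Cauchy
    in L^2 on compact sets. *)
Lemma enorm_grad_integral_le K : compact K -> K `<=` E -> exists2 nu : R, 0 < nu &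
  forall f, test_fun E f -> (\int[mu]_(x in K) (enorm (grad f x) ^+ 2)%:E <= (nu * fm f f)%:E)%E.
Proof.
move=> cK KE; have [nu nu0 H] := hell cK KE; exists nu => // f tf.
have mK := compact_measurable_rV cK.
have fi := form0_integrable tf tf.
have nfi := integrable_realZ nu mE fi.
have menorm : measurable_fun setT (fun x => enorm (grad f x) ^+ 2).
  rewrite (_ : (fun x => _) = fun x => \sum_i (partial_derivative i f x) ^+ 2); last first.
    by apply/funext => x; rewrite enorm_sqrE; apply: eq_bigr => i _; rewrite gradE.
  by apply: measurable_sum => i; apply: measurable_funX; exact: partial_measurable.
apply: (@le_trans _ _ (\int[mu]_(x in K) (nu * Q x (grad f x))%:E)%E).
  apply: ge0_le_integral => //.
  - by move=> x _; rewrite lee_fin sqr_ge0.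
  - by apply/measurable_EFinP; exact: measurable_funS menorm.
  - apply/measurable_EFinP; apply: (measurable_funS mE KE).
    exact: integrable_real_measurable nfi.
  - by move=> x Kx; rewrite lee_fin; have [] := H x (grad f x) Kx.
apply: (@le_trans _ _ (\int[mu]_(x in E) (nu * Q x (grad f x))%:E)%E).
  apply: ge0_subset_integral => //; first exact: measurable_int nfi.
  by move=> x Ex; rewrite lee_fin mulr_ge0 ?(ltW nu0)//; exact: quad_ge0.
by rewrite (integral_EFin mE nfi) (RintegralZl nu mE fi).
Qed.

(** The point is that the set from which [wgrad] is chosen is inhabited: each partial derivative is
    Cauchy in L^2 on every [Kn j], and the limits are assembled coordinatewise. *)
Lemma wgradP u : form_dom mu E A E u -> measurable_fun setT (wgrad mu E A u) /\
  exists2 f_ : nat -> F, form_approx mu E A E f_ u &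
    forall K, compact K -> K `<=` E ->
      (\int[mu]_(x in K) (enorm (grad (f_ n) x - wgrad mu E A u x) ^+ 2)%R%:E)%E
        @[n --> \oo] --> 0%E.
Proof.
move=> [f_ af].
pose W := [set G : Rd -> Rd | measurable_fun setT G /\
    exists2 f_ : nat -> F, form_approx mu E A E f_ u &
      forall K, compact K -> K `<=` E ->
        (\int[mu]_(x in K) (enorm (grad (f_ n) x - G x) ^+ 2)%R%:E)%E
          @[n --> \oo] --> 0%E].
suff ex : exists G, W G by exact: (getPex ex).
have [Kn [cKn ndKn exKn]] := hexh.
have tf n : test_fun E (f_ n) by have [/(_ n)[]] := af.
have sf n : smooth (f_ n) by case: (tf n).
have mKn n : measurable (Kn n) by apply: compact_measurable_rV; case: (cKn n).
have [_ cf _ _] := af.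
have RF i : exists2 g : Rd -> R, measurable_fun setT g & forall j e, 0 < e -> exists N, forall n,
  (N <= n)%N ->
     (\int[mu]_(x in Kn j) ((partial_derivative i (f_ n) x - g x) ^+ 2)%:E <= e%:E)%E.
  apply: Riesz_Fischer2 => //.
    by move=> n; exact: partial_measurable.
  move=> j e e0; have [cK KE] := cKn j; have [nu nu0 Hnu] := enorm_grad_integral_le cK KE.
  have [N HN] := cf (e / nu) (divr_gt0 e0 nu0); exists N => m n Nm Nn.
  apply: (@le_trans _ _ (\int[mu]_(x in Kn j) (enorm (grad (fun x =>
    f_ m x - f_ n x) x) ^+ 2)%:E)%E).
    have sq x : grad (fun x => f_ m x - f_ n x) x ord0 i = partial_derivative i (f_ m) x -
      partial_derivative i (f_ n) x.
      by rewrite gradB// !mxE.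
    apply: ge0_le_integral => //.
    - by move=> x _; rewrite lee_fin sqr_ge0.
    - apply/measurable_EFinP; apply: (measurable_funS measurableT) => //.
      by apply: measurable_funX; apply: measurable_funB; exact: partial_measurable.
    - apply/measurable_EFinP; apply: (measurable_funS measurableT) => //.
      rewrite [X in measurable_fun _ X](_ : _ = fun x => \sum_i (partial_derivative i (fun x =>
        f_ m x - f_ n x) x) ^+ 2); last first.
        by apply/funext => x; rewrite enorm_sqrE; apply: eq_bigr => k _; rewrite gradE.
      by apply: measurable_sum => k; apply: measurable_funX; apply: partial_measurable;
        exact: test_sub.
    - by move=> x _; rewrite lee_fin -sq; exact: coord_sqr_le.
  apply: le_trans (Hnu _ (test_sub (tf m) (tf n))) _.
  by rewrite lee_fin mulrC -ler_pdivlMr// ltW//; exact: HN.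
pose g i := sval (cid2 (RF i)).
have mg i : measurable_fun setT (g i) by rewrite /g; case: cid2.
have gP i : forall j e, 0 < e -> exists N, forall n, (N <= n)%N ->
     (\int[mu]_(x in Kn j) ((partial_derivative i (f_ n) x - g i x) ^+ 2)%:E <= e%:E)%E.
  by rewrite /g; case: cid2.
exists (fun x => \row_i g i x); split=> /=.
  apply: measurable_fun_rV => i; rewrite [X in measurable_fun _ X](_ : _ = g i)//.
  by apply/funext => x; rewrite mxE.
exists f_ => // K cK KE; have [j Kj] := exKn K cK KE.
have mK := compact_measurable_rV cK.
apply: ereal_cvg0P.
  by move=> n; apply: integral_ge0 => x _; rewrite lee_fin sqr_ge0.
(* [d.+1] instead of [d] keeps the denominator nonzero in dimension 0. *)
move=> e e0; have ed : 0 < e / d.+1%:R by rewrite divr_gt0.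
have [N NP] := choice (fun i => gP i j _ ed).
exists (\max_i N i)%N => n Nn.
have mpg i : measurable_fun setT (fun x => (partial_derivative i (f_ n) x - g i x) ^+ 2).
  by apply: measurable_funX; apply: measurable_funB => //; exact: partial_measurable.
rewrite [X in integral _ _ X](_ : _ = fun x => (\sum_i ((partial_derivative i (f_ n) x - g i x)
  ^+ 2)%:E)%E); last first.
  apply/funext => x; rewrite enorm_sqrE sumEFin; congr EFin; apply: eq_bigr => i _.
  by rewrite !mxE.
rewrite ge0_integral_sum//; last 2 first.
- by move=> i; apply/measurable_EFinP; exact: measurable_funS (mpg i).
- by move=> i x _; rewrite lee_fin sqr_ge0.
apply: (@le_trans _ _ (\sum_(i < d) (e / d.+1%:R)%:E)%E).
  apply: lee_sum => i _; apply: le_trans (NP i n (leq_trans (leq_bigmax i) Nn)).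
  apply: ge0_subset_integral => //.
  - by apply/measurable_EFinP; exact: measurable_funS (mpg i).
  - by move=> x _; rewrite lee_fin sqr_ge0.
rewrite sumEFin lee_fin sumr_const card_ord -[leLHS]mulr_natr mulrAC ler_pdivrMr//.
by rewrite ler_wpM2l ?(ltW e0)// ler_nat.
Qed.

(** The vector form of [L2_mul_small], with the smallest of the coordinate thresholds. *)
Lemma dot_mul_small K (h : 'I_d -> F) e : measurable K ->
  (forall i, measurable_fun K (h i)) ->
  (forall i, mu.-integrable K (EFin \o (fun x => h i x ^+ 2))) -> 0 < e ->
  exists2 del, 0 < del & forall k : 'I_d -> F, (forall i, measurable_fun K (k i)) ->
    (forall i, (\int[mu]_(x in K) (k i x ^+ 2)%:E <= del%:E)%E) ->
    mu.-integrable K (EFin \o (fun x => \sum_i h i x * k i x)) /\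
    \int[mu]_(x in K) `|\sum_i h i x * k i x| <= e.
Proof.
move=> mK mh hi e0; have ed : 0 < e / d.+1%:R by rewrite divr_gt0.
have H i := L2_mul_small mK (mh i) (hi i) ed.
pose de i := sval (cid2 (H i)).
have de0 i : 0 < de i by rewrite /de; case: cid2.
have deP i : forall k : Rd -> R, measurable_fun K k ->
    (\int[mu]_(x in K) (k x ^+ 2)%:E <= (de i)%:E)%E ->
    mu.-integrable K (EFin \o (fun x => h i x * k x)) /\
    \int[mu]_(x in K) `|h i x * k x| <= e / d.+1%:R.
  by rewrite /de; case: cid2.
exists (\big[Num.min/1]_i de i).
  by apply: (big_ind (fun x => 0 < x)) => // x y x0 y0; rewrite lt_min x0.
move=> k mk kd.
have kP i : mu.-integrable K (EFin \o (fun x => h i x * k i x)) /\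
    \int[mu]_(x in K) `|h i x * k i x| <= e / d.+1%:R.
  apply: deP => //; apply: le_trans (kd i) _.
  by rewrite lee_fin; exact: bigmin_le_cond.
have int : mu.-integrable K (EFin \o (fun x => \sum_i h i x * k i x)).
  rewrite (_ : _ \o _ = fun x => (\sum_i (h i x * k i x)%:E)%E); last first.
    by apply/funext => x /=; rewrite sumEFin.
  by apply: integrable_sum => // i _; case: (kP i).
split => //.
have inta i : mu.-integrable K (EFin \o (fun x => `|h i x * k i x|)).
  by apply: integrable_real_abs => //; case: (kP i).
have intas : mu.-integrable K (EFin \o (fun x => \sum_i `|h i x * k i x|)).
  rewrite (_ : _ \o _ = fun x => (\sum_i (`|h i x * k i x|)%:E)%E); last first.
    by apply/funext => x /=; rewrite sumEFin.
  by apply: integrable_sum => // i _; exact: inta.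
apply: (@le_trans _ _ (\int[mu]_(x in K) \sum_i `|h i x * k i x|)).
  apply: le_Rintegral => //; first exact: integrable_real_abs.
  by move=> x _; exact: ler_norm_sum.
rewrite -lee_fin -(integral_EFin mK intas).
under eq_integral do rewrite -sumEFin.
rewrite ge0_integral_sum//; last first.
  by move=> i; exact: measurable_int (inta i).
apply: (@le_trans _ _ (\sum_(i < d) (e / d.+1%:R)%:E)%E).
  by apply: lee_sum => i _; rewrite (integral_EFin mK (inta i)) lee_fin; case: (kP i).
rewrite sumEFin lee_fin sumr_const card_ord -[leLHS]mulr_natr mulrAC ler_pdivrMr//.
by rewrite ler_wpM2l ?(ltW e0)// ler_nat.
Qed.

Lemma Rintegral_sub_support K (phi : Rd -> R) : K `<=` E ->
  (forall x, E x -> ~ K x -> phi x = 0) ->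
  \int[mu]_(x in E) phi x = \int[mu]_(x in K) phi x.
Proof.
move=> KE p0; rewrite Rintegral_mkcond [RHS]Rintegral_mkcond; congr Rintegral.
apply/funext => x; rewrite !patchE; case: ifPn => [|/negP] xE; case: ifPn => [|/negP] xK //.
  apply: p0; first exact/set_mem.
  by move=> Kx; apply: xK; exact/mem_set.
by exfalso; apply: xE; apply/mem_set; apply: KE; exact/set_mem.
Qed.

Lemma drift_locM K c i : compact K -> K `<=` E -> bounded_cpt c ->
  measurable_fun K (fun x => B x ord0 i * c x) /\
  mu.-integrable K (EFin \o (fun x => (B x ord0 i * c x) ^+ 2)).
Proof.
move=> cK KE bc; have [mB Bi] := hB_loc i cK KE; have [mc _] := bc.
have mcK : measurable_fun K c by exact: measurable_funS mc.
split; first exact: measurable_funM.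
rewrite (_ : (fun x => _) = fun x => B x ord0 i ^+ 2 * (c x * c x)).
  by apply: bounded_cpt_locM => //; exact: bounded_cptM.
by apply/funext => x; rewrite exprMn expr2.
Qed.

(** From [|b| <= 1 + b^2], compact subsets of [E] having finite measure. *)
Lemma drift_sqr_integrable K i : compact K -> K `<=` E ->
  mu.-integrable K (EFin \o (fun x => B x ord0 i)).
Proof.
move=> cK KE; have [mB Bi] := hB_loc i cK KE; have mK := compact_measurable_rV cK.
apply: (@le_integrable_real _ _ _ mu _ _ (fun x => 1 + B x ord0 i ^+ 2)) => //.
  move=> x _; rewrite -(real_normK (num_real (B x ord0 i))).
  by move: `|_| => z; have := sqr_ge0 (z - 2^-1); lra.
by apply: integrable_realD => //; exact: L1loc_cst.
Qed.

Lemma drift_test_integrable f c : test_fun E f -> bounded_cpt c ->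
  mu.-integrable E (EFin \o (fun x => dotp (B x) (grad f x) * c x)).
Proof.
move=> tf bc; rewrite (_ : EFin \o _ = fun x =>
  (\sum_i (B x ord0 i * (partial_derivative i f x * c x))%:E)%E).
  apply: integrable_sum => // i _; apply: bounded_cpt_integrable.
    by move=> K cK KE; exact: drift_sqr_integrable.
  by apply: bounded_cptM => //; exact: test_partial_bounded_cpt.
apply/funext => x /=; rewrite sumEFin; congr EFin; rewrite /dotp mulr_suml.
by apply: eq_bigr => i _; rewrite gradE mulrA.
Qed.

(** For a test function [f] in place of [u], the difference of the two sides is the integral of
    [<B, grad (f g)>], which is 0 as [f g] is again a test function. Everything takes place on the
    compact set where [g] lives and [B] is square integrable, so local L^2 convergence of [f_] and
    of its gradients gives the limit. *)
Lemma drift_by_parts u g : form_dom mu E A E u -> test_fun E g ->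
  \int[mu]_(x in E) (dotp (B x) (wgrad mu E A u x) * g x) =
  - \int[mu]_(x in E) (dotp (B x) (grad g x) * u x).
Proof.
move=> du tg; have [mW [f_ af cW]] := wgradP du.
have [_ _ u2 Lf] := af.
have tf n : test_fun E (f_ n) by have [/(_ n)[]] := af.
have [mu_ ui] := (Lfun2P _ _).1 u2.
have [sg _ _] := tg.
pose K := E `&` supp setT g.
have cK : compact K by exact: test_supp_compact.
have KE : K `<=` E by move=> x [].
have mK : measurable K by exact: compact_measurable_rV.
have bg := test_bounded_cpt tg.
have nK x : E x -> ~ K x -> ~ supp setT g x by move=> Ex nKx sx; apply: nKx.
have g0 x : E x -> ~ K x -> g x = 0 by move=> Ex nKx; apply: supp_eq0; exact: nK.
have dg0 x : E x -> ~ K x -> grad g x = 0.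
  by move=> Ex nKx; apply/rowP => i; rewrite gradE mxE supp_partial//; exact: nK.
rewrite (Rintegral_sub_support KE); last by move=> x Ex nKx; rewrite g0 ?mulr0.
rewrite (Rintegral_sub_support KE); last first.
  by move=> x Ex nKx; rewrite dg0// dotpC -(scale0r (B x)) dotpZl !mul0r.
set a := Rintegral _ _ _; set b := Rintegral _ _ _.
pose an n := \int[mu]_(x in K) (dotp (B x) (grad (f_ n) x) * g x).
pose bn n := \int[mu]_(x in K) (dotp (B x) (grad g x) * f_ n x).
have ani n : mu.-integrable K (EFin \o (fun x => dotp (B x) (grad (f_ n) x) * g x)).
  exact: (integrableS mE mK KE (drift_test_integrable (tf n) bg)).
have bni n : mu.-integrable K (EFin \o (fun x => dotp (B x) (grad g x) * f_ n x)).
  exact: (integrableS mE mK KE (drift_test_integrable tg (test_bounded_cpt (tf n)))).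
have abn n : an n + bn n = 0.
  rewrite /an /bn -(RintegralD mK (ani n) (bni n)) -(hB_div (test_mul (tf n) sg)).
  have [sf _ _] := tf n.
  rewrite (Rintegral_sub_support KE).
    apply: eq_Rintegral => x _; rewrite gradM// dotpDr !dotpZr; ring.
  by move=> x Ex nKx; rewrite gradM// dg0// g0// scaler0 scale0r addr0 dotpC -(scale0r (B x))
    dotpZl mul0r.
have small e : 0 < e -> `|a + b| <= e + e.
  move=> e0.
  have h1 i := drift_locM i cK KE bg.
  have h2 i := drift_locM i cK KE (test_partial_bounded_cpt i tg).
  have [d1 d10 H1] := dot_mul_small mK (fun i => (h1 i).1) (fun i => (h1 i).2) e0.
  have [d2 d20 H2] := dot_mul_small mK (fun i => (h2 i).1) (fun i => (h2 i).2) e0.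
  have I0 n : (0 <= \int[mu]_(x in K) (enorm (grad (f_ n) x - wgrad mu E A u x) ^+ 2)%R%:E)%E.
    by apply: integral_ge0 => x _; rewrite lee_fin sqr_ge0.
  have n1 := ereal_cvg0_near (cW K cK KE) d10 I0.
  have n2 := Lnorm2_cvg0 Lf d20.
  have [n [N1 N2]] : exists n,
     (\int[mu]_(x in K) (enorm (grad (f_ n) x - wgrad mu E A u x) ^+ 2)%R%:E <= d1%:E)%E /\
     (\int[mu]_x ((f_ n x - u x) ^+ 2)%:E <= d2%:E)%E.
    by have [n _ Hn] := filterI n1 n2; exists n; exact: (Hn n (leqnn n)).
  have mWi i : measurable_fun setT (fun x => wgrad mu E A u x ord0 i).
    exact: (measurableT_comp (measurable_coord i) mW).
  have mdi i : measurable_fun setT (fun x => partial_derivative i (f_ n) x - wgrad mu E A u x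
    ord0 i).
    by apply: measurable_funB => //; exact: partial_measurable.
  have menorm : measurable_fun setT (fun x => enorm (grad (f_ n) x - wgrad mu E A u x) ^+ 2).
    rewrite [X in measurable_fun _ X](_ : _ = fun x =>
        \sum_i (partial_derivative i (f_ n) x - wgrad mu E A u x ord0 i) ^+ 2).
      by apply: measurable_sum => i; apply: measurable_funX.
    by apply/funext => x; rewrite enorm_sqrE; apply: eq_bigr => i _; rewrite !mxE.
  have mf : measurable_fun setT (f_ n) by have [] := test_bounded_cpt (tf n).
  have mfu : measurable_fun setT (fun x => f_ n x - u x) by exact: measurable_funB.
  have [i1 le1] := H1 (fun i x => partial_derivative i (f_ n) x - wgrad mu E A u x ord0 i)
    (fun i => measurable_funS measurableT (@subsetT _ _) (mdi i))
    ltac:(move=> i; apply: le_trans N1; apply: ge0_le_integral => //;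
      [by move=> x _; rewrite lee_fin sqr_ge0
      |by apply/measurable_EFinP; apply: (measurable_funS measurableT) => //; exact: measurable_funX
      |by apply/measurable_EFinP; apply: (measurable_funS measurableT)
      |by move=> x _; rewrite lee_fin; apply: le_trans (coord_sqr_le _ i); rewrite !mxE]).
  have [i2 le2] := H2 (fun i x => f_ n x - u x)
    (fun i => measurable_funS measurableT (@subsetT _ _) mfu)
    ltac:(move=> i; apply: le_trans N2; apply: ge0_subset_integral => //;
      [by apply/measurable_EFinP; exact: measurable_funX
      |by move=> x _; rewrite lee_fin sqr_ge0]).
  have E1 x : \sum_i B x ord0 i * g x * (partial_derivative i (f_ n) x - wgrad mu E A u x ord0 i) =
     dotp (B x) (grad (f_ n) x) * g x - dotp (B x) (wgrad mu E A u x) * g x.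
    rewrite /dotp !mulr_suml -sumrB; apply: eq_bigr => i _; rewrite gradE; ring.
  have E2 x : \sum_i B x ord0 i * partial_derivative i g x * (f_ n x - u x) =
     dotp (B x) (grad g x) * f_ n x - dotp (B x) (grad g x) * u x.
    rewrite /dotp !mulr_suml -sumrB; apply: eq_bigr => i _; rewrite gradE; ring.
  have {}i1 : mu.-integrable K (EFin \o (fun x => dotp (B x) (grad (f_ n) x) * g x - dotp (B x)
    (wgrad mu E A u x) * g x)).
    by apply: eq_integrable i1 => // x _; rewrite /= E1.
  have {}i2 : mu.-integrable K (EFin \o (fun x => dotp (B x) (grad g x) * f_ n x - dotp (B x)
    (grad g x) * u x)).
    by apply: eq_integrable i2 => // x _; rewrite /= E2.
  (* Integrability of the limit integrands is not known beforehand: they are recovered as the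
     approximating ones minus an integrable error. *)
  have ai : mu.-integrable K (EFin \o (fun x => dotp (B x) (wgrad mu E A u x) * g x)).
    have := integrable_realB mK (ani n) i1.
    by apply: eq_integrable => // x _ /=; rewrite opprB addrC subrK.
  have bi : mu.-integrable K (EFin \o (fun x => dotp (B x) (grad g x) * u x)).
    have := integrable_realB mK (bni n) i2.
    by apply: eq_integrable => // x _ /=; rewrite opprB addrC subrK.
  have -> : a + b = - ((an n - a) + (bn n - b)) by rewrite addrACA abn; ring.
  rewrite normrN; apply: le_trans (ler_normD _ _) _; apply: lerD.
    rewrite /an /a -(RintegralB mK (ani n) ai).
    apply: le_trans (le_normr_Rintegral mK i1) _; apply: le_trans le1.
    by under [leRHS]eq_Rintegral do rewrite E1.
  rewrite /bn /b -(RintegralB mK (bni n) bi).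
  apply: le_trans (le_normr_Rintegral mK i2) _; apply: le_trans le2.
  by under [leRHS]eq_Rintegral do rewrite E2.
apply/eqP; rewrite -addr_eq0 -normr_le0; apply/ler_addgt0Pl => e e0.
by rewrite addr0 (splitr e); apply: small; rewrite divr_gt0.
Qed.

End form_theory.

(** * Test functions of small energy *)

Section weighted_real_integrals.
Context d0 (T : measurableType d0) (R : realType) (mu : {measure set T -> \bar R}).
Implicit Types (D S : set T) (f g h : T -> R).

Lemma ae_le_integrable_real D f g : measurable D -> measurable_fun D f ->
  {ae mu, forall x, D x -> `|f x| <= g x} -> mu.-integrable D (EFin \o g) ->
  mu.-integrable D (EFin \o f).
Proof.
move=> mD mf fg gi; have mg := integrable_real_measurable gi.
have [_ lty] := integrableP _ _ _ gi.
apply/integrableP; split; first exact/measurable_EFinP.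
apply: le_lt_trans lty; apply: ae_ge0_le_integral => //.
- by apply: measurableT_comp => //; exact/measurable_EFinP.
- by apply: measurableT_comp => //; exact/measurable_EFinP.
- by apply: filterS fg => x fg Dx /=; rewrite lee_fin (le_trans (fg Dx))// ler_norm.
Qed.

Lemma ge0_subset_Rintegral S D f : measurable S -> measurable D -> S `<=` D ->
  mu.-integrable D (EFin \o f) -> (forall x, D x -> 0 <= f x) ->
  \int[mu]_(x in S) f x <= \int[mu]_(x in D) f x.
Proof.
move=> mS mD SD fi f0; rewrite -lee_fin -!integral_EFin//; last exact: integrableS fi.
apply: ge0_subset_integral => //.
exact: measurable_int fi.
Qed.

Lemma Rintegral_indic S D h : S `<=` D ->
  \int[mu]_(x in D) (\1_S x * h x) = \int[mu]_(x in S) h x.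
Proof.
move=> SD; rewrite -{2}(setIidr SD) Rintegral_mkcondr; apply: eq_Rintegral => x _.
by rewrite patchE indicE; case: (x \in S); rewrite ?mul1r ?mul0r.
Qed.

Lemma integrable_indicM S D h : measurable S -> measurable D -> mu.-integrable D (EFin \o h) ->
  mu.-integrable D (EFin \o (fun x => \1_S x * h x)).
Proof.
move=> mS mD hi; apply: (@le_integrable_real _ _ _ mu _ _ (fun x => `|h x|)) => //.
- apply: measurable_funM; first exact: measurable_indic.
  exact: integrable_real_measurable hi.
- move=> x _; rewrite normrM indicE; case: (x \in S); first by rewrite normr1 mul1r.
  by rewrite normr0 mul0r.
- exact: integrable_real_abs.
Qed.

Lemma integrable_real_sum D N (h : 'I_N -> T -> R) : measurable D ->
  (forall k, mu.-integrable D (EFin \o h k)) ->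
  mu.-integrable D (EFin \o (fun x => \sum_k h k x)) /\
  \int[mu]_(x in D) (\sum_k h k x) = \sum_k \int[mu]_(x in D) h k x.
Proof.
move=> mD; elim: N h => [|N IH] h hi.
  split.
    apply: (eq_integrable mD (cst 0%E)); last exact: integrable0.
    by move=> x _ /=; rewrite big_ord0.
  by under eq_Rintegral do rewrite big_ord0; rewrite big_ord0 Rintegral_cst// mul0r.
have [IH1 IH2] := IH (fun k => h (widen_ord (leqnSn N) k)) (fun k => hi _).
have eqh : (fun x => \sum_(k < N.+1) h k x) =
    (fun x => \sum_(k < N) h (widen_ord (leqnSn N) k) x + h ord_max x).
  by apply/funext => x; rewrite big_ord_recr.
split; first by rewrite eqh; exact: integrable_realD.
by rewrite [X in Rintegral _ _ X]eqh RintegralD// IH2 big_ord_recr.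
Qed.

End weighted_real_integrals.

(** * Dyadic sums of the volume growth *)

Section dyadic_sums.
Context {R : realType}.
Local Notation leb := (@lebesgue_measure R).
Variables v1 v2 : R -> R.
Let V r := v1 r + v2 r.
Hypothesis v1_nd : forall r s, 0 < r -> r <= s -> v1 r <= v1 s.
Hypothesis v2_nd : forall r s, 0 < r -> r <= s -> v2 r <= v2 s.
Hypothesis v1_gt0 : forall r, 0 < r -> 0 < v1 r.
Hypothesis v2_ge0 : forall r, 0 < r -> 0 <= v2 r.
Let a (n : nat) : R := \int[leb]_(r in `[1, n%:R]) (r / V r).

Definition dyadic_S (N : nat) : R := \sum_(k < N) 4 ^+ k / V (2 ^+ k.+1).
Definition dyadic_L (N : nat) : R := \sum_(k < N) (v2 (2 ^+ k.+1) - v2 (2 ^+ k)) / V (2 ^+ k.+1).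

Let V_nd r s : 0 < r -> r <= s -> V r <= V s.
Proof. by move=> r0 rs; rewrite lerD ?v1_nd ?v2_nd. Qed.

Let V_gt0 r : 0 < r -> 0 < V r.
Proof. by move=> r0; rewrite ltr_pwDl ?v1_gt0 ?v2_ge0. Qed.

Let p2 k : (0 : R) < 2 ^+ k. Proof. by rewrite exprn_gt0. Qed.

Lemma dyadic_integrable (M : R) :
  leb.-integrable (`[1, M]%classic : set (measurableTypeR R)) (EFin \o (fun r => r / V r)).
Proof.
(* Monotonicity of [V] is known for positive arguments only; the maximum with 1 extends it to the
   whole line and changes nothing on the interval of integration. *)
have mV : measurable_fun (`[1, M]%classic : set (measurableTypeR R)) (fun r =>
  (V (Num.max r 1))^-1).
  apply: nonincreasing_measurable => // r s rs.
  have m1 t : 0 < Num.max t 1 :> R by rewrite lt_max ltr01 orbT.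
  rewrite lef_pV2 ?posrE ?V_gt0//; apply: V_nd => //.
  by rewrite ge_max !le_max rs lexx orbT.
apply: (@le_integrable_real _ _ _ leb _ _ (fun=> `|M| / V 1)) => //.
- apply: (@eq_measurable_fun _ _ (measurableTypeR R) (measurableTypeR R) _ (fun r =>
  r * (V (Num.max r 1))^-1)).
    by move=> r /set_mem; rewrite /= in_itv/= => /andP[r1 _]; rewrite max_l.
  by apply: measurable_funM => //; exact: measurable_id.
- move=> r; rewrite /= in_itv/= => /andP[r1 rM]; have r0 : 0 < r by rewrite (lt_le_trans ltr01).
  rewrite ger0_norm ?divr_ge0 ?(ltW r0) ?(ltW (V_gt0 r0))//.
  apply: ler_pM; rewrite ?(ltW r0) ?invr_ge0 ?(ltW (V_gt0 r0))//.
    by rewrite (le_trans rM)// ler_norm.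
  by rewrite lef_pV2 ?posrE ?V_gt0// V_nd.
- apply: continuous_compact_integrable; first exact: segment_compact.
  by move=> x; exact: cst_continuous.
Qed.

(** On []2^N, 2^(N+1)]] the integrand is at most [2^(N+1) / V (2^N)] and the length is [2^N]; the
    product is [8 * 4^(N-1) / V (2^N)], that is 8 times the term of index [N - 1] in [dyadic_S]. *)
Lemma dyadic_step N : (0 < N)%N ->
  a (2 ^ N.+1) <= a (2 ^ N) + 8 * (4 ^+ N.-1 / V (2 ^+ N)).
Proof.
move=> N0.
have ii := dyadic_integrable (2 ^ N.+1)%:R.
have p2N : 1 <= (2 ^ N)%:R :> R by rewrite ler1n expn_gt0.
have le2 : (2 ^ N)%:R <= (2 ^ N.+1)%:R :> R by rewrite ler_nat leq_exp2l.
have D := @Rintegral_itvB R (fun r => r / V r) (BLeft 1) (BRight (2 ^ N.+1)%:R) (2 ^ N)%:R ii.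
rewrite !bnd_simp in D; have {}D := D p2N le2.
rewrite -lerBlDl /a D.
set I := (X in Rintegral _ X); set c := 2 ^+ N.+1 / V (2 ^+ N).
have sub : I `<=` `[1, (2 ^ N.+1)%:R].
  by apply: subset_itvr; rewrite bnd_simp.
have mI : measurable (I : set (measurableTypeR R)) by exact: measurable_itv.
have iI : leb.-integrable (I : set (measurableTypeR R)) (EFin \o (fun r => r / V r)).
  by apply: (@integrableS _ (measurableTypeR R) R leb _ _ _ _ _ sub ii); exact: measurable_itv.
have lebI : leb I = (2 ^+ N)%:E.
  rewrite /I lebesgue_measure_itv/= lte_fin ltr_nat ltn_exp2l// ltnSn -EFinB !natrX exprS.
  by congr EFin; ring.
have ci : leb.-integrable (I : set (measurableTypeR R)) (EFin \o (fun=> c)).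
  apply/integrableP; split; first exact/measurable_EFinP.
  rewrite integral_cst; last exact: mI.
  by rewrite [X in (_ * X)%E]lebI -EFinM ltry.
apply: (@le_trans _ _ (\int[leb]_(r in I) c)).
  apply: le_Rintegral => // r; rewrite /I/= in_itv/= !natrX => /andP[r1 r2].
  have r0 : 0 < r by rewrite (lt_trans (p2 N)).
  apply: ler_pM; rewrite ?(ltW r0) ?invr_ge0 ?(ltW (V_gt0 r0))//.
  by rewrite lef_pV2 ?posrE ?V_gt0// V_nd// ltW.
have -> : \int[leb]_(r in I) c = c * 2 ^+ N.
  by rewrite Rintegral_cst; [rewrite [X in fine X]lebI | exact: mI].
rewrite /c le_eqVlt; apply/orP; left; apply/eqP.
case: N N0 {ii p2N le2 D I c sub mI iI lebI ci} => // N _ /=.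
have -> : (4 : R) = 2 ^+ 2 by rewrite expr2; ring.
rewrite -exprM mul2n -addnn !exprS exprD; ring.
Qed.

Lemma dyadic_S_lower N : a (2 ^ N.+1) <= a 2 + 8 * dyadic_S N.
Proof.
elim: N => [|N IH]; first by rewrite /dyadic_S big_ord0 mulr0 addr0 expn1.
apply: le_trans (dyadic_step (ltn0Sn N)) _.
by rewrite /dyadic_S big_ord_recr/= mulrDr addrA lerD2r.
Qed.

Lemma dyadic_S_nd N M : (N <= M)%N -> dyadic_S N <= dyadic_S M.
Proof.
move=> NM; have -> : M = (N + (M - N))%N by rewrite subnKC.
elim: (M - N)%N => [|k IH]; first by rewrite addn0.
apply: le_trans IH _; rewrite addnS /dyadic_S big_ord_recr/= lerDl.
by rewrite divr_ge0 ?exprn_ge0// ltW// V_gt0.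
Qed.

(** With [c = v1 1] each term is at most [(y - x) / (c + y)], hence at most
    [ln (c + y) - ln (c + x)] by [ln (1 - t) <= - t], and the sum telescopes. The last step is [c +
    v2 <= c * m + m = (1 + 1 / c) * m * c]. *)
Lemma dyadic_L_upper N :
  dyadic_L N <= ln (1 + (v1 1)^-1) + ln (Num.max (v2 (2 ^+ N)) 1).
Proof.
set c := v1 1; have c0 : 0 < c by exact: v1_gt0.
have pos k : 0 < c + v2 (2 ^+ k) by rewrite ltr_pwDl ?v2_ge0.
have tel : dyadic_L N <= ln (c + v2 (2 ^+ N)) - ln (c + v2 (2 ^+ 0)).
  elim: N => [|N IH]; first by rewrite /dyadic_L big_ord0 subrr.
  rewrite /dyadic_L big_ord_recr/=.
  set y := v2 (2 ^+ N.+1); set x := v2 (2 ^+ N).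
  have xy : x <= y by apply: v2_nd => //; rewrite ler_eXn2l ?ltr1n.
  have cV : c + y <= V (2 ^+ N.+1).
    by rewrite /V lerD2r; apply: v1_nd => //; rewrite exprn_ege1// ler1n.
  have cy : 0 < c + y by exact: pos.
  have cx : 0 < c + x by exact: pos.
  have step : (y - x) / V (2 ^+ N.+1) <= ln (c + y) - ln (c + x).
    apply: (@le_trans _ _ ((y - x) / (c + y))).
      by rewrite ler_wpM2l ?subr_ge0// lef_pV2 ?posrE// V_gt0.
    rewrite -lerN2 opprB -ln_div ?posrE//.
    have -> : (c + x) / (c + y) = 1 + - ((y - x) / (c + y)) by field; rewrite gt_eqF.
    apply: le_ln1Dx; rewrite ltrN2 ltr_pdivrMr// mul1r.
    by move: cx; lra.
  have -> : ln (c + y) - ln (c + v2 (2 ^+ 0)) = (ln (c + x) - ln (c + v2 (2 ^+ 0))) + (ln (c + y)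
    - ln (c + x)) by ring.
  by apply: lerD.
apply: le_trans tel _.
set m := Num.max _ _; have m1 : 1 <= m by rewrite le_max lexx orbT.
have vm : v2 (2 ^+ N) <= m by rewrite le_max lexx.
have v0 := v2_ge0 (p2 0).
have m0 : 0 < m by exact: lt_le_trans m1.
have k0 : 0 < 1 + c^-1 by rewrite addr_gt0 ?invr_gt0.
have km : 0 < (1 + c^-1) * m by exact: mulr_gt0.
have pN := pos N; have p0 := pos 0%N.
have kp : 0 < (1 + c^-1) * m * (c + v2 (2 ^+ 0)) by exact: mulr_gt0.
rewrite -lnM ?posrE// lerBlDr -lnM ?posrE// ler_ln ?posrE//.
apply: (@le_trans _ _ ((1 + c^-1) * m * c)).
  have -> : (1 + c^-1) * m * c = c * m + m by field; rewrite gt_eqF.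
  by apply: lerD => //; rewrite ler_peMr// ltW.
by rewrite ler_wpM2l ?lerDl// ltW.
Qed.

Hypothesis a_infty : a n @[n --> \oo] --> +oo.
Hypothesis a_log : ln (Num.max (v2 n%:R) 1) / a n @[n --> \oo] --> (0 : R).

Lemma dyadic_ratio_small e : 0 < e -> exists N,
  [/\ 0 < dyadic_S N, (dyadic_S N)^-1 <= e & dyadic_L N / dyadic_S N <= e].
Proof.
move=> e0; pose C := ln (1 + (v1 1)^-1).
have C0 : 0 <= C by apply: ln_ge0; rewrite lerDl invr_ge0 ltW// v1_gt0.
have e32 : 0 < e / 32 by rewrite divr_gt0.
(* [a (2^N) >= 2 * a 2] gives [a (2^N) <= 16 * dyadic_S N]. The bound [16 / e] then settles the
   inverse of [dyadic_S], and [32 * C / e] makes the constant [C] of [dyadic_L_upper] at most half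
   of [e * dyadic_S N]; the other half is the logarithm, at most [e / 32] times [a (2^N)]. *)
pose M := Num.max (2 * a 2) (Num.max 1 (Num.max (16 / e) (32 * C / e))).
have n1 : \forall n \near \oo, M <= a n by move/cvgryPge : a_infty; exact.
have n2 : \forall n \near \oo, ln (Num.max (v2 n%:R) 1) / a n <= e / 32.
  move/cvgrPdist_le : a_log => /(_ _ e32); apply: filterS => n.
  by rewrite sub0r normrN; apply: le_trans; exact: ler_norm.
have [n0 _ Hn] := filterI n1 n2.
(* The successor matches the exponent on the left of [dyadic_S_lower n0]. *)
pose N := n0.+1.
have Nn : (n0 <= 2 ^ N)%N by rewrite (leq_trans (ltnW (ltn_expl n0 (isT : (1 < 2)%N))))// leq_exp2l.
have [H1 H2] := Hn (2 ^ N)%N Nn.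
move: H1; rewrite /M !ge_max => /andP[Ma /andP[M1 /andP[M2 M3]]].
set A := a (2 ^ N) in Ma M1 M2 M3 H2.
have A0 : 0 < A by rewrite (lt_le_trans ltr01).
have AS : A <= 16 * dyadic_S N.
  have : A <= a 2 + 8 * dyadic_S N.
    apply: le_trans (dyadic_S_lower n0) _; rewrite lerD2l ler_wpM2l//.
    by apply: dyadic_S_nd; exact: leqnSn.
  by move: Ma; lra.
set S := dyadic_S N in AS *.
have S0 : 0 < S by move: AS A0; lra.
exists N; split => //.
  rewrite -/S -[e]invrK lef_pV2 ?posrE ?invr_gt0//.
  by move: M2 AS; rewrite -[16 / e]/(16 * e^-1); lra.
rewrite -/S ler_pdivrMr//; apply: le_trans (dyadic_L_upper N) _; rewrite -/C.
have -> : e * S = e / 2 * S + e / 2 * S by field.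
apply: lerD.
  have : 32 * C <= A * e by rewrite -ler_pdivrMr.
  by move: AS e0 S0; nra.
move: H2; rewrite ler_pdivrMr// natrX => H2; apply: le_trans H2 _.
by move: AS e0; nra.
Qed.

End dyadic_sums.

(** * The radial profile and its derivative *)

Section radial_profile.
Context {R : realType}.
Variables (N : nat) (w : nat -> R).
Hypothesis w_ge0 : forall k, 0 <= w k.
Hypothesis w_sum : \sum_(k < N) w k = 1.

Let p2 k : (0 : R) < 2 ^+ k. Proof. by rewrite exprn_gt0. Qed.

Let arg k (r : R) : R := (2 ^+ k)^-1 * (r - 2 ^+ k).

(** It starts at 1 and loses exactly [w k] across the k-th dyadic interval [[2^k, 2^(k+1)]], which
    [arg k] maps affinely onto [0, 1]; as the weights add up to 1, it ends at 0. *)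
Definition profile (r : R) : R := 1 - \sum_(k < N) w k * (1 - step (arg k r)).
Definition profile' (r : R) : R := \sum_(k < N) (w k / 2 ^+ k) * step' (arg k r).

(** The indicator of [[2^k, 2^(k+1)[], written as a difference so that integrals over shells become
    differences of integrals over sublevel sets. *)
Definition shell k (r : R) : R := (r < 2 ^+ k.+1)%R%:R - (r < 2 ^+ k)%R%:R.

Let shellE k r : shell k r = ((2 ^+ k <= r) && (r < 2 ^+ k.+1))%R%:R.
Proof.
rewrite /shell leNgt; case: (ltP r (2 ^+ k)) => rk /=; last by rewrite subr0.
by rewrite (lt_le_trans rk) ?subrr// ler_eXn2l ?ltr1n.
Qed.

Lemma shell_le k r : 2 ^+ k * shell k r <= r * shell k r.
Proof.
rewrite shellE; case: (leP (2 ^+ k) r) => rk /=; last by rewrite !mulr0.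
by rewrite ler_wpM2r.
Qed.

Lemma arg_le0 k r : r <= 2 ^+ k -> arg k r <= 0.
Proof. by move=> rk; rewrite /arg mulr_ge0_le0 ?invr_ge0 ?(ltW (p2 k))// subr_le0. Qed.

Lemma arg_ge1 k r : 2 ^+ k.+1 <= r -> 1 <= arg k r.
Proof.
move=> rk; rewrite /arg ler_pdivlMl// mulr1 lerBrDr.
by apply: le_trans rk; rewrite exprS mulr2n mulrDl !mul1r.
Qed.

Lemma is_derive_profile (r : R) : is_derive r 1 profile (profile' r).
Proof.
have D1 k : is_derive r 1 (arg k) (2 ^+ k)^-1.
  by apply: (is_derive_eq (is_deriveZ _ (is_deriveB (is_derive_id (r : R) (1 : R)) (is_derive_cst
    (2 ^+ k : R) (r : R) (1 : R))))); rewrite subr0 /GRing.scale/= mulr1.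
have D2 k : is_derive r 1 (fun y => step (arg k y)) ((2 ^+ k)^-1 * step' (arg k r)).
  by have := @is_derive1_comp R step _ r _ _ (is_derive_step _) (D1 k); rewrite mulrC.
have D3 k : is_derive r 1 (fun y => w k * (1 - step (arg k y))) (- ((w k / 2 ^+ k) * step' (arg k
  r))).
  apply: (is_derive_eq (is_deriveZ (w k) (is_deriveB (is_derive_cst (1 : R) (r : R) (1 : R)) (D2
    k)))).
  by rewrite sub0r /GRing.scale/= mulrN mulrA.
have D4 := is_derive_sum (fun k : 'I_N => D3 k).
have D5 := is_deriveB (is_derive_cst (1 : R) (r : R) (1 : R)) D4.
rewrite (_ : profile = cst 1 - \sum_(k < N) (fun y => w k * (1 - step (arg k y)))); last first.
  by apply/funext => y; rewrite /profile !fctE fct_sumE.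
by apply: (is_derive_eq D5); rewrite sub0r sumrN opprK.
Qed.

Lemma profile_continuous : continuous profile.
Proof.
move=> x; apply: differentiable_continuous; apply/derivable1_diffP.
by have [] := is_derive_profile x.
Qed.

Lemma profile_le1 r : r <= 1 -> profile r = 1.
Proof.
move=> r1; rewrite /profile big1 ?subr0// => k _.
by rewrite step_le0 ?subrr ?mulr0// arg_le0// (le_trans r1)// exprn_ege1// ler1n.
Qed.

Lemma profile_ge r : 2 ^+ N <= r -> profile r = 0.
Proof.
move=> rN; rewrite /profile -[X in X - _]w_sum; apply/eqP; rewrite subr_eq0; apply/eqP;
  apply: eq_bigr => k _.
rewrite step_ge1 ?subr0 ?mulr1// arg_ge1// (le_trans _ rN)// ler_eXn2l ?ltr1n//.
Qed.

Lemma profile'_ge r : 2 ^+ N <= r -> profile' r = 0.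
Proof.
move=> rN; rewrite /profile' big1// => k _.
by rewrite step'_ge1 ?mulr0// arg_ge1// (le_trans _ rN)// ler_eXn2l ?ltr1n.
Qed.

Lemma profile_itv r : 0 <= profile r <= 1.
Proof.
have h k : 0 <= w k * (1 - step (arg k r)) <= w k.
  have /andP[s0 s1] := step_itv (arg k r).
  by rewrite mulr_ge0 ?subr_ge0//= ler_piMr// gerBl.
rewrite /profile subr_ge0 gerBl sumr_ge0 ?andbT; last by move=> k _; have /andP[] := h k.
by rewrite -[leRHS]w_sum ler_sum// => k _; have /andP[] := h k.
Qed.

Lemma profile'_bounded : exists2 C : R, 0 <= C & forall r, `|profile' r| <= C.
Proof.
have [C C0 HC] := @step'_bounded R.
exists (\sum_(k < N) (w k / 2 ^+ k) * C); first by rewrite sumr_ge0// => k _;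
  rewrite mulr_ge0 ?divr_ge0// ltW.
move=> r; apply: le_trans (ler_norm_sum _ _ _) _; apply: ler_sum => k _.
have wk : 0 <= w k / 2 ^+ k by rewrite divr_ge0// ltW.
by rewrite normrM (ger0_norm wk) ler_wpM2l.
Qed.

Lemma profile_lipschitz : exists2 C : R, 0 <= C & forall r s,
  `|profile r - profile s| <= C * `|r - s| /\ `|profile' r - profile' s| <= C * `|r - s|.
Proof.
have [C C0 HC] := profile'_bounded.
have [D D0 HD] := @step'_lipschitz R.
pose D' := \sum_(k < N) (w k / 2 ^+ k) * (D * (2 ^+ k)^-1).
have D'0 : 0 <= D'.
  by rewrite sumr_ge0// => k _; rewrite !mulr_ge0 ?invr_ge0// ltW.
exists (C + D'); first by rewrite addr_ge0.
move=> r s; split.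
  suff : `|profile r - profile s| <= C * `|r - s|.
    by move/le_trans; apply; rewrite ler_wpM2r// lerDl.
  wlog rs : r s / r < s.
    move=> H; have [rs|sr|->] := ltgtP r s; first exact: H.
      by rewrite distrC (distrC r); exact: H.
    by rewrite !subrr normr0 mulr0.
  have [c _ Eq] := @MVT R profile profile' r s rs (fun c _ => is_derive_profile c)
    (continuous_subspaceT profile_continuous).
  by rewrite distrC Eq normrM (distrC r) ler_wpM2r.
suff : `|profile' r - profile' s| <= D' * `|r - s|.
  by move/le_trans; apply; rewrite ler_wpM2r// lerDr.
rewrite /profile' -sumrB mulr_suml; apply: le_trans (ler_norm_sum _ _ _) _.
apply: ler_sum => k _; rewrite -mulrBr normrM -mulrA.
have wk : 0 <= w k / 2 ^+ k by rewrite divr_ge0// ltW.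
rewrite (ger0_norm wk) ler_wpM2l//; apply: le_trans (HD _ _) _.
rewrite -mulrA ler_wpM2l// /arg -mulrBr normrM gtr0_norm ?invr_gt0//.
by rewrite (_ : r - 2 ^+ k - _ = r - s)//; ring.
Qed.

(** The shells are disjoint: at every [r] at most one summand is nonzero, so the square of the sum
    is the sum of the squares. *)
Lemma profile'_shell C r : 0 <= C -> (forall x : R, `|step' x| <= C) ->
  `|profile' r| <= \sum_(k < N) C * (w k / 2 ^+ k) * shell k r /\
  (profile' r) ^+ 2 <= \sum_(k < N) (C * (w k / 2 ^+ k)) ^+ 2 * shell k r.
Proof.
move=> C0 HC.
have b k : 0 <= C * (w k / 2 ^+ k) by rewrite mulr_ge0 ?divr_ge0// ltW.
have le1 : `|profile' r| <= \sum_(k < N) C * (w k / 2 ^+ k) * shell k r.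
  apply: le_trans (ler_norm_sum _ _ _) _; apply: ler_sum => k _.
  have wk : 0 <= w k / 2 ^+ k by rewrite divr_ge0// ltW.
  rewrite normrM (ger0_norm wk); move: (w k / _) wk => u wk.
  rewrite (mulrC C) -mulrA ler_wpM2l//.
  rewrite shellE; case: (leP (2 ^+ k) r) => rk /=; last first.
    by rewrite step'_le0 ?normr0 ?mulr0// arg_le0// ltW.
  case: (ltP r (2 ^+ k.+1)) => rk' /=; last by rewrite step'_ge1 ?normr0 ?mulr0// arg_ge1.
  by rewrite mulr1.
split=> //.
have sq (c : nat -> R) : (\sum_(k < N) c k * shell k r) ^+ 2 = \sum_(k < N) c k ^+ 2 * shell k r.
  elim: N => [|n IH]; first by rewrite !big_ord0 expr0n.
  rewrite !big_ord_recr/= sqrrD IH; set x := \sum_(k < n) c k * shell k r.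
  have x0 : x * (c n * shell n r) = 0.
    rewrite shellE; case: (leP (2 ^+ n) r) => rn /=; last by rewrite !mulr0.
    rewrite /x big1 ?mul0r// => k _; rewrite shellE.
    have kr : 2 ^+ k.+1 <= r by rewrite (le_trans _ rn)// ler_eXn2l ?ltr1n.
    by rewrite ltNge kr andbF mulr0.
  rewrite x0 mul0rn addr0; congr (_ + _); rewrite exprMn; congr (_ * _).
  by rewrite shellE; case: (_ && _); rewrite ?expr1n ?expr0n.
rewrite -(sq (fun k => C * (w k / 2 ^+ k))) -[X in X <= _]real_normK ?num_real// lerXn2r ?nnegrE//.
by apply: le_trans le1.
Qed.

End radial_profile.

Lemma smooth_profile {R : realType} {d : nat} N (w : nat -> R) (f : 'rV[R]_d -> R) :
  smooth f -> smooth (fun x => profile N w (f x)).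
Proof.
move=> sf; apply: smoothB; first exact: smooth_cst.
apply: smooth_sum => k; apply: smoothZ; apply: smoothB; first exact: smooth_cst.
by apply: smooth_step; apply: smoothZ; apply: smoothB => //; exact: smooth_cst.
Qed.

(** * Test functions built from the exhaustion function *)

Section distance_function.
Context {R : realType} {d : nat}.
Local Notation Rd := 'rV[R]_d.
Local Notation F := (Rd -> R).
Variables (mu : {sigma_finite_measure set Rd -> \bar R}) (E : set Rd).
Variables (A : Rd -> 'M[R]_d) (B : Rd -> Rd) (rho : Rd -> R) (grho : Rd -> Rd).
Hypothesis mE : measurable E.
Hypothesis oE : open E \/ closed E.
Hypothesis muK : forall K, compact K -> K `<=` E -> (mu K < +oo)%E.
Hypothesis hA_loc : forall i j, L1loc mu E (fun x => A x i j).
Local Notation Q x xi := (dotp (mx_apply (A x) xi) xi).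
Hypothesis hell : forall K, compact K -> K `<=` E -> exists2 nu : R, 0 < nu &
  forall x xi, K x -> enorm xi ^+ 2 <= nu * Q x xi /\ Q x xi <= nu * enorm xi ^+ 2.
Hypothesis hexh : exists Kn : nat -> set Rd,
  [/\ forall n, compact (Kn n) /\ Kn n `<=` E, forall m n, (m <= n)%N -> Kn m `<=` Kn n &
      forall K, compact K -> K `<=` E -> exists n, K `<=` Kn n].
Hypothesis hB_loc : forall i, L2loc mu E (fun x => B x ord0 i).
Hypothesis hrho_ge0 : forall x, E x -> 0 <= rho x.
Hypothesis hrho_cont : {within E, continuous rho}.
Hypothesis hrho_grad : is_wgrad_loc mu E A rho grho.
Hypothesis hrho_grad_loc : forall i, Linfloc mu E (fun x => grho x ord0 i).
Hypothesis hrho_sub : forall r, 0 < r -> rel_compact_open E (sublevel E rho r).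
Implicit Types (f g h b u v : F) (K : set Rd).
Local Notation sub := (sublevel E rho).
Local Notation vol1 := (vol1 mu E A rho grho).
Local Notation vol2 := (vol2 mu E B rho grho).

Lemma measurable_sublevel r : measurable (sub r).
Proof.
have [r0|r0] := ltP 0 r.
  by have [[U oU ->] _ _] := hrho_sub r0; apply: measurableI => //; exact: open_measurable_mx.
rewrite (_ : sub r = set0)//; apply/seteqP; split=> x // [Ex] /=.
by rewrite ltNge (le_trans r0)// hrho_ge0.
Qed.

Lemma measurable_rho : measurable_fun E rho.
Proof.
apply: (measurability _ (RGenInftyO.measurableE R)).
move=> _ [_ [r ->] <-].
rewrite (_ : E `&` _ = sub r); first exact: measurable_sublevel.
by apply/seteqP; split=> x [Ex]; rewrite /= in_itv.
Qed.

(** The closure is taken in the whole space, but relative compactness keeps it in [E], where [rho]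
    is continuous. *)
Lemma closure_sublevel_le r x : 0 < r -> closure (sub r) x -> rho x <= r.
Proof.
move=> r0 cx; have [_ _ subE] := hrho_sub r0; have Ex := subE _ cx.
rewrite leNgt; apply/negP => rx.
have nr : nbhs (rho x) [set y | r < y] by apply: open_nbhs_nbhs; split => //; exact: open_gt.
have := @hrho_cont x [set y | r < y] nr.
rewrite /nbhs/= -(nbhs_subspace_in Ex) => near_gt.
have [y [[Ey yr] /(_ Ey) /= ry]] := cx _ near_gt.
by move: (lt_trans ry yr); rewrite ltxx.
Qed.

Lemma sublevel_le r s : r <= s -> sub r `<=` sub s.
Proof. by move=> rs x [Ex /= xr]; split => //=; exact: lt_le_trans rs. Qed.

Lemma ae_boundedM_integrable h b K : measurable K -> mu.-integrable K (EFin \o h) ->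
  measurable_fun K b -> (exists M : R, {ae mu, forall x, K x -> `|b x| <= M}) ->
  mu.-integrable K (EFin \o (fun x => h x * b x)).
Proof.
move=> mK hi mb [M bM].
have mh := integrable_real_measurable hi.
apply: (@ae_le_integrable_real _ _ _ mu _ _ (fun x => M * `|h x|)) => //.
- exact: measurable_funM.
- by apply: filterS bM => x + Kx => /(_ Kx) bx; rewrite normrM mulrC ler_wpM2r.
- by apply: integrable_realZ => //; exact: integrable_real_abs.
Qed.

Lemma quad_rho_integrable K : compact K -> K `<=` E ->
  mu.-integrable K (EFin \o (fun x => Q x (grho x))).
Proof.
move=> cK KE; have mK := compact_measurable_rV cK.
rewrite (_ : _ \o _ = fun x => (\sum_i (\sum_j A x i j * (grho x ord0 j * grho x ord0 i))%:E)%E);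
  last first.
  by apply/funext => x /=; rewrite dotpE sumEFin.
apply: integrable_sum => // i _; under [X in integrable _ _ X]funext do rewrite -sumEFin.
apply: integrable_sum => // j _; apply: ae_boundedM_integrable => //.
- exact: hA_loc.
- by apply: measurable_funM; [have [] := hrho_grad_loc j cK KE|have [] := hrho_grad_loc i cK KE].
have [_ [M1 H1]] := hrho_grad_loc j cK KE; have [_ [M2 H2]] := hrho_grad_loc i cK KE.
exists (M1 * M2); move: H1 H2; apply: filterS2 => x H1 H2 Kx.
by rewrite normrM ler_pM// ?H1 ?H2.
Qed.

Lemma drift_rho_integrable K : compact K -> K `<=` E ->
  mu.-integrable K (EFin \o (fun x => dotp (B x) (grho x))).
Proof.
move=> cK KE; have mK := compact_measurable_rV cK.
rewrite (_ : _ \o _ = fun x => (\sum_i (B x ord0 i * grho x ord0 i)%:E)%E); last first.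
  by apply/funext => x /=; rewrite sumEFin.
apply: integrable_sum => // i _; have [mg bg] := hrho_grad_loc i cK KE.
by apply: ae_boundedM_integrable => //; exact: (drift_sqr_integrable muK hB_loc i cK KE).
Qed.

Let cpt r : 0 < r -> compact (closure (sub r)) /\ closure (sub r) `<=` E.
Proof. by move=> r0; have [_ cK KE] := hrho_sub r0. Qed.

Lemma weighted_drift_integrable r : 0 < r ->
  mu.-integrable (closure (sub r)) (EFin \o (fun x => rho x * `|dotp (B x) (grho x)|)).
Proof.
move=> r0; have [cK KE] := cpt r0; have mK := compact_measurable_rV cK.
rewrite (_ : _ \o _ = EFin \o (fun x => `|dotp (B x) (grho x)| * rho x)); last first.
  by apply/funext => x /=; rewrite mulrC.
apply: ae_boundedM_integrable => //.
- by apply: integrable_real_abs => //; exact: drift_rho_integrable.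
- exact: measurable_funS measurable_rho.
- exists r; apply: aeW => x Kx; rewrite ger0_norm ?closure_sublevel_le//.
  by apply: hrho_ge0; exact: KE.
Qed.

Lemma vol1_nd r s : 0 < r -> r <= s -> vol1 r <= vol1 s.
Proof.
move=> r0 rs; have s0 : 0 < s by exact: lt_le_trans rs.
have [cK KE] := cpt s0; have mK := compact_measurable_rV cK.
apply: (ge0_subset_Rintegral (measurable_sublevel r) (measurable_sublevel s) (sublevel_le rs)).
  apply: integrableS (quad_rho_integrable cK KE) => //; first exact: measurable_sublevel.
  exact: subset_closure.
by move=> x [Ex _]; exact: (quad_ge0 hell).
Qed.

Lemma vol2_nd r s : 0 < r -> r <= s -> vol2 r <= vol2 s.
Proof.
move=> r0 rs; have s0 : 0 < s by exact: lt_le_trans rs.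
have [cK KE] := cpt s0; have mK := compact_measurable_rV cK.
apply: (ge0_subset_Rintegral (measurable_sublevel r) (measurable_sublevel s) (sublevel_le rs)).
  apply: integrableS (weighted_drift_integrable s0) => //; first exact: measurable_sublevel.
  exact: subset_closure.
by move=> x [Ex _]; rewrite mulr_ge0// hrho_ge0.
Qed.

Lemma vol2_ge0 r : 0 <= vol2 r.
Proof. by apply: Rintegral_ge0 => x [Ex _]; rewrite mulr_ge0// hrho_ge0. Qed.

(** The pointwise squared distance of [f] to [rho], gradients included, in which all approximation
    errors are measured. *)
Definition grad_dist2 f x : R := (f x - rho x) ^+ 2 + enorm (grad f x - grho x) ^+ 2.

(** On the sublevel set [rho] and [grho] agree a.e. with some [w] of the form domain and its weak
    gradient. The sequence defining [wgrad w] converges to [w] in L^2 and, with its gradients, in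
    L^2 on the compact closure, so one late member serves both. *)
Lemma rho_approx r del : 0 < r -> 0 < del -> exists f, [/\ test_fun E f,
  mu.-integrable (sub r) (EFin \o grad_dist2 f) & \int[mu]_(x in sub r) grad_dist2 f x <= del].
Proof.
move=> r0 del0; have [cK KE] := cpt r0; have mK := compact_measurable_rV cK.
have mS := measurable_sublevel r.
have [mG /(_ _ (hrho_sub r0)) [w dw ww]] := hrho_grad.
have [mW [f_ af cW]] := wgradP mE oE hA_loc hell hexh dw.
have [tf _ w2 Lf] := af.
have [mw _] := (Lfun2P _ _).1 w2.
have d2 : 0 < del / 2 by rewrite divr_gt0.
have I0 n : (0 <= \int[mu]_(x in closure (sub r)) (enorm (grad (f_ n) x - wgrad mu E A w x) ^+
  2)%R%:E)%E.
  by apply: integral_ge0 => x _; rewrite lee_fin sqr_ge0.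
have n1 := ereal_cvg0_near (cW _ cK KE) d2 I0.
have n2 := Lnorm2_cvg0 Lf d2.
have [n [N1 N2]] : exists n,
   (\int[mu]_(x in closure (sub r)) (enorm (grad (f_ n) x - wgrad mu E A w x) ^+ 2)%R%:E <= (del
     / 2)%:E)%E /\
   (\int[mu]_x ((f_ n x - w x) ^+ 2)%:E <= (del / 2)%:E)%E.
  by have [n _ Hn] := filterI n1 n2; exists n; exact: (Hn n (leqnn n)).
have [tn _] := tf n.
have mge (G : Rd -> Rd) : measurable_fun setT G -> measurable_fun setT (fun x =>
  enorm (grad (f_ n) x - G x) ^+ 2).
  move=> mG'; rewrite [X in measurable_fun _ X](_ : _ = fun x =>
      \sum_i (partial_derivative i (f_ n) x - G x ord0 i) ^+ 2).
    apply: measurable_sum => i; apply: measurable_funX; apply: measurable_funB.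
      exact: (partial_measurable oE).
    exact: (measurableT_comp (measurable_coord i) mG').
  by apply/funext => x; rewrite enorm_sqrE; apply: eq_bigr => i _; rewrite !mxE.
have mf : measurable_fun setT (f_ n) by have [] := test_bounded_cpt oE tn.
have mgd : measurable_fun (sub r) (grad_dist2 (f_ n)).
  apply: measurable_funD; last by apply: measurable_funS (mge _ mG).
  apply: measurable_funX; apply: measurable_funB; first exact: measurable_funS mf.
  by apply: measurable_funS measurable_rho => //; move=> x [].
have gd0 x : 0 <= grad_dist2 (f_ n) x by rewrite addr_ge0 ?sqr_ge0.
pose dw2 x := (f_ n x - w x) ^+ 2 + enorm (grad (f_ n) x - wgrad mu E A w x) ^+ 2.
have mdw : measurable_fun setT dw2.
  by apply: measurable_funD; [apply: measurable_funX; exact: measurable_funB|exact: mge].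
have le : (\int[mu]_(x in sub r) (grad_dist2 (f_ n) x)%:E <= del%:E)%E.
  apply: (@le_trans _ _ (\int[mu]_(x in sub r) (dw2 x)%:E)%E).
    apply: ae_ge0_le_integral => //.
    - by move=> x _; rewrite lee_fin.
    - exact/measurable_EFinP.
    - by move=> x _; rewrite lee_fin addr_ge0 ?sqr_ge0.
    - by apply/measurable_EFinP; exact: measurable_funS mdw.
    - by apply: filterS ww => x + Sx => /(_ Sx) [e1 e2]; rewrite lee_fin /grad_dist2 e1 e2.
  under eq_integral do rewrite /dw2 EFinD.
  rewrite ge0_integralD//; first last.
  - by apply/measurable_EFinP; apply: measurable_funS (mge _ mW).
  - by move=> x _; rewrite lee_fin sqr_ge0.
  - apply/measurable_EFinP; apply: (@measurable_funS _ _ _ _ setT) => //.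
    by apply: measurable_funX; exact: measurable_funB.
  - by move=> x _; rewrite lee_fin sqr_ge0.
  rewrite [del]splitr EFinD; apply: leeD.
    apply: le_trans N2; apply: ge0_subset_integral => //.
      by apply/measurable_EFinP; apply: measurable_funX; exact: measurable_funB.
    by move=> x _; rewrite lee_fin sqr_ge0.
  apply: le_trans N1; apply: ge0_subset_integral => //.
  - by apply/measurable_EFinP; apply: measurable_funS (mge _ mW).
  - by move=> x _; rewrite lee_fin sqr_ge0.
  - exact: subset_closure.
have gi := ge0_Rintegral_integrable mS mgd (fun x _ => gd0 x) le.
by exists (f_ n); split => //; rewrite -lee_fin -integral_EFin.
Qed.

(** Expansion of [|t x - y|^2 >= 0] and [|t x + y|^2 >= 0]. The free weight [t] makes the term with
    [B], fixed and square integrable, as small as desired. *)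
Lemma dotp_amgm t (x y : Rd) : 0 < t ->
  `|dotp x y| <= (t * enorm x ^+ 2 + t^-1 * enorm y ^+ 2) / 2.
Proof.
move=> t0; rewrite !enorm_sqr.
have h1 := dotp_ge0 (t *: x - y); have h2 := dotp_ge0 (t *: x + y).
rewrite !(dotpBl, dotpBr, dotpDl, dotpDr, dotpZl, dotpZr) (dotpC y x) in h1 h2.
rewrite ler_norml; apply/andP; split; rewrite -subr_ge0.
  rewrite (_ : _ - _ = (2 * t)^-1 * (t * (t * dotp x x) + t * dotp x y + (t * dotp x y + dotp y
    y))).
    by rewrite mulr_ge0// invr_ge0 mulr_ge0// ltW.
  by field; rewrite gt_eqF.
rewrite (_ : _ - _ = (2 * t)^-1 * (t * (t * dotp x x) - t * dotp x y - (t * dotp x y - dotp y y))).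
  by rewrite mulr_ge0// invr_ge0 mulr_ge0// ltW.
by field; rewrite gt_eqF.
Qed.

Section cutoff_composition.
Variables (N : nat) (w : nat -> R).
Hypothesis w_ge0 : forall k, 0 <= w k.
Hypothesis w_sum : \sum_(k < N) w k = 1.
Let P := profile N w.
Let P' := profile' N w.
Local Notation V := (sub (2 ^+ N.+1)).
Let p2 k : (0 : R) < 2 ^+ k. Proof. by rewrite exprn_gt0. Qed.
Let q x := Q x (grho x).
Let be x := dotp (B x) (grho x).

Let mV : measurable V. Proof. exact: measurable_sublevel. Qed.
Let VE x : V x -> E x. Proof. by case. Qed.
Let Vcl : V `<=` closure V. Proof. exact: subset_closure. Qed.
Let cV : compact (closure V) /\ closure V `<=` E. Proof. exact: cpt. Qed.
Let mcV : measurable (closure V). Proof. by apply: compact_measurable_rV; case: cV. Qed.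
Let integrableV h : mu.-integrable (closure V) (EFin \o h) -> mu.-integrable V (EFin \o h).
Proof. by apply: integrableS => //; exact: mcV. Qed.

Let mrho : measurable_fun V rho.
Proof. by apply: measurable_funS measurable_rho => // x []. Qed.

Lemma shell_integral k h : (k < N)%N -> mu.-integrable V (EFin \o h) ->
  mu.-integrable V (EFin \o (fun x => shell k (rho x) * h x)) /\
  \int[mu]_(x in V) (shell k (rho x) * h x) =
    \int[mu]_(x in sub (2 ^+ k.+1)) h x - \int[mu]_(x in sub (2 ^+ k)) h x.
Proof.
move=> kN hi.
have sV j : (j <= N)%N -> sub (2 ^+ j) `<=` V.
  by move=> jN; apply: sublevel_le; rewrite ler_eXn2l ?ltr1n// (leq_trans jN).
have Eq x : V x -> shell k (rho x) * h x =
    \1_(sub (2 ^+ k.+1)) x * h x - \1_(sub (2 ^+ k)) x * h x.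
  move=> Vx; have Ex := VE Vx; rewrite /shell !indicE -mulrBl; congr ((_ - _) * _).
    by congr (_%:R); congr nat_of_bool; apply/idP/idP => [h1|/set_mem[]//]; apply/mem_set; split.
  by congr (_%:R); congr nat_of_bool; apply/idP/idP => [h1|/set_mem[]//]; apply/mem_set; split.
have i1 := integrable_indicM (measurable_sublevel (2 ^+ k.+1)) mV hi.
have i2 := integrable_indicM (measurable_sublevel (2 ^+ k)) mV hi.
split.
  apply: eq_integrable (integrable_realB mV i1 i2) => // x /set_mem Vx /=.
  by rewrite Eq.
under eq_Rintegral => x /set_mem Vx do rewrite Eq//.
rewrite RintegralB//.
by rewrite !Rintegral_indic//; apply: sV => //; exact: ltnW.
Qed.

Let qi : mu.-integrable V (EFin \o q).
Proof. by apply: integrableV; apply: quad_rho_integrable; case: cV. Qed.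

Let bi : mu.-integrable V (EFin \o be).
Proof. by apply: integrableV; apply: drift_rho_integrable; case: cV. Qed.

Let mP' : measurable_fun V (fun x => P' (rho x)).
Proof.
apply: measurableT_comp => //; apply: measurable_sum => k; apply: measurable_funM => //.
apply: (@measurableT_comp _ _ _ _ _ _ (@step' R)) => //; last first.
  by apply: measurable_funM => //; exact: measurable_funB.
apply: continuous_measurable_fun => x.
have [C C0 HC] := @step'_lipschitz R.
apply/cvgrPdist_le => e e0.
near=> y; apply: le_trans (HC x y) _.
have : `|x - y| <= e / (C + 1).
  by near: y; apply: cvgr_dist_le => //; rewrite divr_gt0// ltr_wpDl.
rewrite ler_pdivlMr ?ltr_wpDl// => h; apply: le_trans h.
by rewrite mulrC ler_wpM2l// lerDl.
Unshelve. all: by end_near. Qed.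

Lemma profile_energy C : 0 <= C -> (forall x : R, `|step' x| <= C) ->
  mu.-integrable V (EFin \o (fun x => P' (rho x) ^+ 2 * q x)) /\
  \int[mu]_(x in V) (P' (rho x) ^+ 2 * q x) <=
    \sum_(k < N) (C * (w k / 2 ^+ k)) ^+ 2 * (vol1 (2 ^+ k.+1) - vol1 (2 ^+ k)).
Proof.
move=> C0 HC.
have si k : (k < N)%N -> _ := fun kN => shell_integral kN qi.
have sii (k : 'I_N) : mu.-integrable V (EFin \o (fun x => (C * (w k / 2 ^+ k)) ^+ 2 * (shell k
  (rho x) * q x))).
  by apply: integrable_realZ => //; have [] := si k (ltn_ord k).
have [I1 I2] := integrable_real_sum mV sii.
have q0 x : V x -> 0 <= q x by move=> /VE Ex; exact: (quad_ge0 hell).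
have le x : V x -> P' (rho x) ^+ 2 * q x <= \sum_(k < N) (C * (w k / 2 ^+ k)) ^+ 2 * (shell k
  (rho x) * q x).
  move=> Vx; have [_ h] := profile'_shell N w_ge0 (rho x) C0 HC.
  under eq_bigr do rewrite mulrA.
  by rewrite -mulr_suml ler_wpM2r// q0.
have i : mu.-integrable V (EFin \o (fun x => P' (rho x) ^+ 2 * q x)).
  apply: le_integrable_real I1 => //.
    apply: measurable_funM; first exact: measurable_funX.
    exact: integrable_real_measurable qi.
  by move=> x Vx; rewrite ger0_norm ?le// mulr_ge0 ?sqr_ge0 ?q0.
split=> //; apply: (@le_trans _ _ (\int[mu]_(x in V) (\sum_(k < N) (C * (w k / 2 ^+ k)) ^+ 2 *
  (shell k (rho x) * q x)))).
  exact: le_Rintegral.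
rewrite I2 ler_sum// => k _; have [h1 h2] := si k (ltn_ord k).
by rewrite RintegralZl// h2.
Qed.

(** On the k-th shell [rho >= 2^k], so the weight [rho] in [vol2] yields a second factor
    [1 / 2^k]. *)
Lemma profile_drift C : 0 <= C -> (forall x : R, `|step' x| <= C) ->
  mu.-integrable V (EFin \o (fun x => `|P' (rho x)| * `|be x|)) /\
  \int[mu]_(x in V) (`|P' (rho x)| * `|be x|) <=
    \sum_(k < N) (C * (w k / 2 ^+ k) / 2 ^+ k) * (vol2 (2 ^+ k.+1) - vol2 (2 ^+ k)).
Proof.
move=> C0 HC; pose rb x := rho x * `|be x|.
have rbi : mu.-integrable V (EFin \o rb) by apply: integrableV; exact: weighted_drift_integrable.
have si k : (k < N)%N -> _ := fun kN => shell_integral kN rbi.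
have sii (k : 'I_N) : mu.-integrable V (EFin \o (fun x => C * (w k / 2 ^+ k) / 2 ^+ k * (shell k
  (rho x) * rb x))).
  by apply: integrable_realZ => //; have [] := si k (ltn_ord k).
have [I1 I2] := integrable_real_sum mV sii.
have le x : V x -> `|P' (rho x)| * `|be x| <= \sum_(k < N) (C * (w k / 2 ^+ k) / 2 ^+ k) * (shell
  k (rho x) * rb x).
  move=> Vx; have [h _] := profile'_shell N w_ge0 (rho x) C0 HC.
  apply: le_trans (ler_wpM2r (normr_ge0 (be x)) h) _; rewrite mulr_suml; apply: ler_sum => k _.
  have c0 : 0 <= C * (w k / 2 ^+ k) by rewrite mulr_ge0// divr_ge0// ltW.
  move: (C * (w k / 2 ^+ k)) c0 => c c0.
  have -> : c / 2 ^+ k * (shell k (rho x) * rb x) =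
      c * ((2 ^+ k)^-1 * (rho x * shell k (rho x)) * `|be x|) by rewrite /rb; ring.
  rewrite -[leLHS]mulrA (ler_wpM2l c0)// ler_wpM2r// ler_pdivlMl//.
  exact: shell_le.
have i : mu.-integrable V (EFin \o (fun x => `|P' (rho x)| * `|be x|)).
  apply: le_integrable_real I1 => //.
    apply: measurable_funM; first exact: measurableT_comp.
    by apply: measurableT_comp => //; exact: integrable_real_measurable bi.
  by move=> x Vx; rewrite ger0_norm ?le// mulr_ge0.
split=> //; apply: (@le_trans _ _ (\int[mu]_(x in V) (\sum_(k < N) (C * (w k / 2 ^+ k) / 2 ^+ k)
  * (shell k (rho x) * rb x)))).
  exact: le_Rintegral.
rewrite I2 ler_sum// => k _; have [h1 h2] := si k (ltn_ord k).
by rewrite RintegralZl// h2.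
Qed.

(** The profile vanishes where [rho >= 2^N]; passing to the next dyadic level for [V] leaves room
    for a cutoff that is 1 on [K0] and supported in [V] as far as [E] is concerned. *)
Let K0 := closure (sub (2 ^+ N)).
Let cK0 : compact K0 /\ K0 `<=` E. Proof. exact: cpt. Qed.

Let K0V : K0 `<=` V.
Proof.
move=> x Kx; split; first by case: cK0 => _; apply.
apply: le_lt_trans (closure_sublevel_le _ Kx) _ => //.
by rewrite /= ltr_eXn2l ?ltr1n.
Qed.

(** [V] is open relative to [E] only. For open [E] the open set [U] is cut with [E] to keep the
    support inside; otherwise the cutoff may extend beyond [E]. *)
Let cutoff : exists eta : F, [/\ test_fun E eta, forall x, E x -> ~ V x -> ~ supp setT eta x,
  forall x, 0 <= eta x <= 1 & forall x, K0 x -> eta x = 1 /\ forall i,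
    partial_derivative i eta x = 0].
Proof.
have [[U oU VU] _ _] := hrho_sub (p2 N.+1); have [cK KE] := cK0.
have [Om [oOm KOm OmV OmE]] : exists Om, [/\ open Om, K0 `<=` Om,
    forall x, E x -> Om x -> V x & open E -> Om `<=` E].
  have KU x : K0 x -> U x by move=> /K0V; rewrite VU => -[].
  have [oEE|nE] := pselect (open E).
    exists (E `&` U); split => //; first exact: openI.
      by move=> x Kx; split; [exact: KE|exact: KU].
    by move=> x Ex; rewrite VU.
  by exists U; split => // x Ex Ux; rewrite VU.
have [eta [seta ceta sOm e01 eK]] := smooth_cutoff cK oOm KOm.
exists eta; split => //.
  by split => // oEE; apply: subset_trans sOm _; exact: OmE.
by move=> x Ex nV /sOm Omx; apply: nV; exact: OmV.
Qed.

Let grho_bound : exists2 M, 0 <= M & {ae mu, forall x, V x -> forall i, `|grho x ord0 i| <= M}.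
Proof.
have [cK KE] := cV.
have H i : exists M, {ae mu, forall x, V x -> `|grho x ord0 i| <= M}.
  have [_ [M HM]] := hrho_grad_loc i cK KE; exists M.
  by apply: filterS HM => x HM Vx; apply: HM; exact: Vcl.
have [M HM] := choice H.
exists (\sum_i `|M i|); first by rewrite sumr_ge0.
have : {ae mu, forall x, forall i, V x -> `|grho x ord0 i| <= M i}.
  exact: filter_forall.
apply: filterS => x Hx Vx i; apply: le_trans (Hx i Vx) _.
by apply: le_trans (ler_norm _) _; rewrite (bigD1 i)//= lerDl sumr_ge0.
Qed.

(** [P (f x)] is 1 where [f] vanishes, so it has to be multiplied by [eta]. The error [D] between
    [grad g] and [P' (rho) grho] is at most [c1] times the square root of [grad_dist2 f] in each
    coordinate, a.e. on [V]; it enters the energy through the parallelogram inequality and the drift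
    through [dotp_amgm], and [f] is chosen close enough to [rho] for both. *)
Lemma cutoff_composition eps : 0 < eps -> exists g, [/\ test_fun E g,
    supp E g `<=` V & forall x, 0 <= g x <= 1] /\
  [/\ form0 mu E A g g <= 2 * \int[mu]_(x in V) (P' (rho x) ^+ 2 * q x) + eps,
    \int[mu]_(x in E) `|dotp (B x) (grad g x)| <=
      \int[mu]_(x in V) (`|P' (rho x)| * `|be x|) + eps &
    \int[mu]_(x in sub 1) (g x - 1) ^+ 2 <= eps].
Proof.
move=> eps0.
have [eta [teta eV e01 eK]] := cutoff.
have [seta _ _] := teta.
have [C C0 HC] := profile'_bounded N w_ge0.
have [L L0 HL] := profile_lipschitz N w_ge0.
have [M M0 HM] := grho_bound.
have [M' M'0 HM'] : exists2 M', 0 <= M' & forall x i, E x -> `|partial_derivative i eta x| <= M'.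
  have H i : exists M, forall x, E x -> `|partial_derivative i eta x| <= M.
    have [_ [K [M1 [_ _ _ H]]]] := test_partial_bounded_cpt oE i teta.
    by exists M1 => x Ex; case: (H x Ex).
  have [M1 H1] := choice H.
  exists (\sum_i `|M1 i|); first by rewrite sumr_ge0.
  move=> x i Ex; apply: le_trans (H1 i x Ex) _; apply: le_trans (ler_norm _) _.
  by rewrite (bigD1 i)//= lerDl sumr_ge0.
have [cK KE] := cV.
have [nu nu0 Hnu] := hell cK KE.
(* The three terms of [D]: [P' (f)] times the gradient error, the variation of [P'] times [grho],
   and the variation of [P] times the gradient of [eta]. *)
pose c1 := C + L * M + L * M'.
have c10 : 0 <= c1 by rewrite !addr_ge0// mulr_ge0.
pose c0 := d%:R * c1 ^+ 2.
have c00 : 0 <= c0 by rewrite mulr_ge0 ?sqr_ge0.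
pose Bsq x := enorm (B x) ^+ 2.
have Bsqi : mu.-integrable V (EFin \o Bsq).
  have [h _] := @integrable_real_sum _ _ _ mu V d (fun i x => B x ord0 i ^+ 2) mV
    (fun i => integrableV (hB_loc i cK KE).2).
  by apply: eq_integrable h => // x _ /=; rewrite /Bsq enorm_sqrE.
have IB0 : 0 <= \int[mu]_(x in V) Bsq x by apply: Rintegral_ge0 => x _; exact: sqr_ge0.
set IB := Rintegral _ _ _ in IB0.
(* With this weight in [dotp_amgm] the term with [B] contributes at most [eps / 2]. *)
pose t := eps / (IB + 1).
have t0 : 0 < t by rewrite divr_gt0// ltr_wpDl.
(* Dominates the factors of the error in the three final estimates; the added 1 keeps it
   positive. *)
pose Z := 2 * nu * c0 + c0 / t + L ^+ 2 + 1.
have Z1 : 2 * nu * c0 <= Z /\ c0 / t <= Z /\ L ^+ 2 <= Z /\ 0 < Z.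
  have : 0 <= 2 * nu * c0 by rewrite !mulr_ge0// ltW.
  have : 0 <= c0 / t by rewrite divr_ge0// ltW.
  have : 0 <= L ^+ 2 by exact: sqr_ge0.
  by rewrite /Z; lra.
have [Z2 [Z3 [Z4 Z0]]] := Z1.
have del0 : 0 < eps / (2 * Z) by rewrite divr_gt0// mulr_gt0.
have [f [tf fi fdel]] := rho_approx (p2 N.+1) del0.
have [sf _ _] := tf.
pose g x := eta x * P (f x).
have sP : smooth (fun x => P (f x)) by exact: smooth_profile.
have tg : test_fun E g by exact: test_mul.
have sg : smooth g by case: tg.
have gradg x : grad g x = eta x *: (P' (f x) *: grad f x) + P (f x) *: grad eta x.
  rewrite /g gradM// (grad_comp (is_derive_profile N w (f x)) sf) //.
have g0 x : E x -> ~ V x -> g x = 0 by move=> Ex nV; rewrite /g supp_eq0 ?mul0r//; exact: eV.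
have dg0 x : E x -> ~ V x -> grad g x = 0.
  move=> Ex nV; have ns := eV x Ex nV; apply/rowP => i.
  by rewrite gradg supp_eq0// scale0r add0r !mxE supp_partial ?mulr0.
pose D x := grad g x - P' (rho x) *: grho x.
have HD : {ae mu, forall x, V x -> forall i, `|D x ord0 i| <= c1 * Num.sqrt (grad_dist2 f x)}.
  apply: filterS HM => x HM Vx i; have {HM}hM := HM Vx i.
  have Ex := VE Vx; set s := Num.sqrt _.
  have s2 : s ^+ 2 = grad_dist2 f x by rewrite sqr_sqrtr// addr_ge0 ?sqr_ge0.
  have s0 : 0 <= s by exact: sqrtr_ge0.
  have fs : `|f x - rho x| <= s.
    rewrite -(@ler_pXn2r _ 2) ?nnegrE// s2 real_normK ?num_real//.
    by rewrite lerDl sqr_ge0.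
  have ds : `|partial_derivative i f x - grho x ord0 i| <= s.
    rewrite -(@ler_pXn2r _ 2) ?nnegrE// s2 real_normK ?num_real//.
    apply: (@le_trans _ _ (enorm (grad f x - grho x) ^+ 2)); last by rewrite lerDr sqr_ge0.
    by apply: le_trans (coord_sqr_le _ i); rewrite !mxE.
  have [hP hP'] := HL (f x) (rho x).
  (* Below level [2^N] the cutoff is 1 with zero gradient; from there on the profile and its
     derivative are 0. Subtracting this zero from [D] leaves only terms that contain a difference
     between [f] and [rho]. *)
  have vanish : (eta x - 1) * P' (rho x) * grho x ord0 i + P (rho x) * partial_derivative i eta x
    = 0.
    have [rN|rN] := ltP (rho x) (2 ^+ N).
      have [-> ->] : eta x = 1 /\ partial_derivative i eta x = 0.
        have Kx : K0 x by apply: subset_closure; split.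
        by have [-> ->] := eK x Kx.
      by rewrite subrr !mul0r mulr0 addr0.
    by rewrite /P /P' profile_ge// profile'_ge// mulr0 !mul0r addr0.
  have -> : D x ord0 i = eta x * (P' (f x) * (partial_derivative i f x - grho x ord0 i)
      + (P' (f x) - P' (rho x)) * grho x ord0 i) + (P (f x) - P (rho x)) * partial_derivative i
        eta x.
    rewrite /D gradg !mxE -!/(partial_derivative _ _ _).
    by rewrite -[RHS]addr0 -vanish; ring.
  have -> : c1 * s = C * s + L * M * s + L * M' * s by rewrite /c1; ring.
  have /andP[e0 e1] := e01 x.
  apply: le_trans (ler_normD _ _) _; apply: lerD.
    rewrite normrM (ger0_norm e0); apply: (@le_trans _ _ (1 * (C * s + L * M * s)));
      last by rewrite mul1r.
    apply: ler_pM => //; apply: le_trans (ler_normD _ _) _; apply: lerD; rewrite normrM.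
      by apply: ler_pM.
    rewrite -mulrA [M * s]mulrC mulrA; apply: ler_pM => //; apply: le_trans hP' _.
    by rewrite ler_wpM2l.
  rewrite normrM -mulrA [M' * s]mulrC mulrA; apply: ler_pM => //; last exact: HM'.
  by apply: le_trans hP _; rewrite ler_wpM2l.
have HD2 : {ae mu, forall x, V x -> enorm (D x) ^+ 2 <= c0 * grad_dist2 f x}.
  apply: filterS HD => x HD Vx.
  rewrite enorm_sqrE /c0 -mulrA.
  apply: (@le_trans _ _ (\sum_(i < d) c1 ^+ 2 * grad_dist2 f x)); last first.
    by rewrite sumr_const card_ord mulr_natl.
  apply: ler_sum => i _; rewrite -real_normK ?num_real//.
  have gd0 : 0 <= grad_dist2 f x by rewrite addr_ge0 ?sqr_ge0.
  rewrite -[X in _ * X](sqr_sqrtr gd0) -exprMn lerXn2r ?nnegrE ?HD//.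
  by rewrite mulr_ge0.
exists g; split; first split => //.
- move=> x gx; have Ex := test_supp_sub oE tg gx.
  have [//|nV] := pselect (V x); exfalso; apply: (eV x Ex nV).
  apply: closureS gx => y [_ /= gy]; split => //=.
  by apply: contraNN gy => /eqP y0; rewrite /g y0 mul0r.
- move=> x; have /andP[e0 e1] := e01 x; have /andP[P0 P1] := profile_itv w_ge0 w_sum (f x).
  by rewrite mulr_ge0//= mulr_ile1.
have [S S0 HS] := @step'_bounded R.
have [pei _] := profile_energy S0 HS; have [pdi _] := profile_drift S0 HS.
have gd0 x : 0 <= grad_dist2 f x by rewrite addr_ge0 ?sqr_ge0.
have gradD x : grad g x = P' (rho x) *: grho x + D x by rewrite /D addrC subrK.
have mgd : measurable_fun V (grad_dist2 f) by exact: integrable_real_measurable fi.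
have gdk k : 0 <= k -> k <= Z -> k * \int[mu]_(x in V) grad_dist2 f x <= eps / 2.
  move=> k0 kZ; apply: (@le_trans _ _ (Z * (eps / (2 * Z)))).
    by apply: ler_pM => //; apply: Rintegral_ge0.
  by rewrite le_eqVlt; apply/orP; left; apply/eqP; field; rewrite gt_eqF.
have VsubE : V `<=` E by move=> x; exact: VE.
split.
- rewrite /form0 (Rintegral_sub_support mu VsubE); last first.
    by move=> x Ex nV; rewrite dg0// dotpC -(scale0r (grho x)) dotpZl mul0r.
  have gi := integrableS mE mV VsubE (form0_integrable mE oE hA_loc tg tg).
  have i1 := integrable_realZ 2 mV pei.
  have i2 := integrable_realZ (2 * nu * c0) mV fi.
  apply: (@le_trans _ _ (\int[mu]_(x in V) (2 * (P' (rho x) ^+ 2 * q x) + 2 * nu * c0 *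
    grad_dist2 f x))).
    apply: le_ae_Rintegral => //; first exact: integrable_realD.
    apply: filterS HD2 => x + Vx => /(_ Vx) hD.
    rewrite gradD; apply: le_trans (quad_parallelogram _) _; first exact: (quad_ge0 hell _ (VE Vx)).
    apply: lerD; first by rewrite mx_applyZ dotpZl dotpZr /q expr2 !mulrA.
    have [_ h] := Hnu x (D x) (Vcl Vx).
    rewrite (_ : 2 * nu * c0 * _ = 2 * (nu * (c0 * grad_dist2 f x))); last by ring.
    rewrite ler_wpM2l//; apply: le_trans h _.
    by rewrite (ler_wpM2l (ltW nu0)).
  rewrite RintegralD// !RintegralZl// lerD2l.
  by apply: le_trans (gdk _ _ _) _ => //; [rewrite !mulr_ge0// ltW|move: eps0; lra].
- rewrite (Rintegral_sub_support mu VsubE); last first.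
    by move=> x Ex nV; rewrite dg0// dotpC -(scale0r (grho x)) dotpZl mul0r normr0.
  have gi : mu.-integrable V (EFin \o (fun x => `|dotp (B x) (grad g x)|)).
    apply: integrable_real_abs => //; apply: integrableV.
    rewrite (_ : _ \o _ = fun x => (\sum_i (B x ord0 i * partial_derivative i g x)%:E)%E);
      last first.
      by apply/funext => x /=; rewrite sumEFin; congr EFin; apply: eq_bigr => i _; rewrite gradE.
    apply: integrable_sum => // i _.
    apply: (bounded_cpt_locM cK KE); last exact: (test_partial_bounded_cpt oE).
    exact: (drift_sqr_integrable muK hB_loc).
  have i1 := integrable_realZ (t / 2) mV Bsqi.
  have i2 := integrable_realZ (c0 / t / 2) mV fi.
  have i3 := integrable_realD mV i1 i2.
  apply: (@le_trans _ _ (\int[mu]_(x in V) (`|P' (rho x)| * `|be x| + (t / 2 * Bsq x + c0 / t / 2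
    * grad_dist2 f x)))).
    apply: le_ae_Rintegral => //; first exact: integrable_realD.
    apply: filterS HD2 => x + Vx => /(_ Vx) hD.
    rewrite gradD dotpDr dotpZr; apply: le_trans (ler_normD _ _) _; rewrite normrM lerD2l.
    apply: le_trans (dotp_amgm _ _ t0) _.
    rewrite mulrDl; apply: lerD; first by rewrite mulrAC.
    rewrite mulrAC [leRHS](_ : _ = t^-1 / 2 * (c0 * grad_dist2 f x)); last by ring.
    by rewrite ler_wpM2l// divr_ge0// invr_ge0 ltW.
  rewrite RintegralD// lerD2l RintegralD// !RintegralZl// -/IB.
  have h1 : t * IB <= eps.
    by rewrite /t mulrAC ler_pdivrMr ?ltr_wpDl// ler_wpM2l ?(ltW eps0)// lerDl.
  have h2 := gdk (c0 / t) _ Z3; rewrite divr_ge0 ?(ltW t0)// in h2.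
  move: h1 (h2 isT); move: (Rintegral _ _ _) => I3.
  have -> : t / 2 * IB + c0 / t / 2 * I3 = (t * IB) / 2 + (c0 / t * I3) / 2 by ring.
  by move: (t * IB) (c0 / t * I3) eps0 => y z; lra.
- have s1 : sub 1 `<=` V by apply: sublevel_le; rewrite exprn_ege1// ler1n.
  have g1 x : sub 1 x -> (g x - 1) ^+ 2 <= L ^+ 2 * grad_dist2 f x.
    move=> [Ex /= r1].
    have Kx : K0 x by apply: subset_closure; split => //=; rewrite (lt_le_trans r1)//
      exprn_ege1// ler1n.
    have [e1 _] := eK x Kx; rewrite /g e1 mul1r -(profile_le1 N w (ltW r1)).
    have [hP _] := HL (f x) (rho x).
    rewrite -real_normK ?num_real//; apply: (@le_trans _ _ ((L * `|f x - rho x|) ^+ 2)).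
      by rewrite ler_pXn2r ?nnegrE// mulr_ge0.
    by rewrite exprMn real_normK ?num_real// ler_wpM2l ?sqr_ge0// lerDl sqr_ge0.
  have mg : measurable_fun setT g by have [] := test_bounded_cpt oE tg.
  have fi1 := integrableS mV (measurable_sublevel 1) s1 fi.
  have Li1 := integrable_realZ (L ^+ 2) (measurable_sublevel 1) fi1.
  apply: (@le_trans _ _ (\int[mu]_(x in sub 1) (L ^+ 2 * grad_dist2 f x))).
    apply: le_Rintegral => //; first exact: measurable_sublevel.
    apply: le_integrable_real Li1; first exact: measurable_sublevel.
      apply: measurable_funX; apply: measurable_funB => //.
      exact: (measurable_funS measurableT).
    by move=> x S1; rewrite ger0_norm ?sqr_ge0// g1.
  rewrite RintegralZl//; last exact: measurable_sublevel.
  apply: (@le_trans _ _ (eps / 2)); last by move: eps0; lra.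
  apply: le_trans (gdk _ (sqr_ge0 L) Z4); rewrite ler_wpM2l ?sqr_ge0//.
  by apply: ge0_subset_Rintegral => //; exact: measurable_sublevel.
Qed.

End cutoff_composition.

Local Notation vol_seq := (vol_seq mu E A B rho grho).
Hypothesis hv1_pos : forall r, 0 < r -> 0 < vol1 r.
Hypothesis ha_infty : vol_seq n @[n --> \oo] --> +oo.
Hypothesis ha_log : ln (Num.max (vol2 n%:R) 1) / vol_seq n @[n --> \oo] --> (0 : R).

Lemma small_energy_test_function eps : 0 < eps -> exists g, [/\ test_fun E g,
    exists2 V, rel_compact_open E V & supp E g `<=` V & forall x, 0 <= g x <= 1] /\
  [/\ form0 mu E A g g <= eps, \int[mu]_(x in E) `|dotp (B x) (grad g x)| <= eps &
    \int[mu]_(x in sub 1) (g x - 1) ^+ 2 <= eps].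
Proof.
move=> eps0; have [S S0 HS] := @step'_bounded R.
have S20 : 0 <= S ^+ 2 by exact: sqr_ge0.
(* Makes [S^2 * (eps / k0)] and [S * (eps / k0)] at most [eps / 4]; twice the former plus the
   [eps / 2] spent on the approximation stays within [eps]. *)
pose k0 := 4 * (S ^+ 2 + S + 1).
have k00 : 0 < k0 by rewrite mulr_gt0// ltr_wpDl// addr_ge0.
have e0 : 0 < eps / k0 by rewrite divr_gt0.
have [N [D0 De Le]] := dyadic_ratio_small vol1_nd vol2_nd hv1_pos (fun r _ =>
  vol2_ge0 r) ha_infty ha_log e0.
set D := dyadic_S _ _ N in D0 De Le.
pose Vk k := vol1 (2 ^+ k.+1) + vol2 (2 ^+ k.+1).
have p2 k : (0 : R) < 2 ^+ k by rewrite exprn_gt0.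
have Vk0 k : 0 < Vk k by rewrite ltr_pwDl ?hv1_pos ?vol2_ge0.
(* With these weights [(S * w k / 2^k)^2 * Vk k] equals [S^2 * w k / D], and the drift terms add up
   to [S * dyadic_L N / D]. *)
pose w k := 4 ^+ k / Vk k / D.
have w0 k : 0 <= w k by rewrite !divr_ge0 ?exprn_ge0 ?(ltW (Vk0 k)) ?(ltW D0).
have w1 : \sum_(k < N) w k = 1 by rewrite -mulr_suml mulfV// gt_eqF.
have eps2 : 0 < eps / 2 by rewrite divr_gt0.
have [g [[tg sg g01] [g1 g2 g3]]] := cutoff_composition w0 w1 eps2.
have [_ en] := profile_energy N w0 S0 HS.
have [_ dr] := profile_drift N w0 S0 HS.
have four k : (4 : R) ^+ k = 2 ^+ k * 2 ^+ k by rewrite -exprMn; congr (_ ^+ _); ring.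
have en' : \sum_(k < N) (S * (w k / 2 ^+ k)) ^+ 2 * (vol1 (2 ^+ k.+1) - vol1 (2 ^+ k)) <= S ^+ 2
  * (eps / k0).
  apply: (@le_trans _ _ (\sum_(k < N) S ^+ 2 * (w k * D^-1))); last first.
    by rewrite -mulr_sumr -mulr_suml w1 mul1r ler_wpM2l.
  apply: ler_sum => k _; apply: (@le_trans _ _ ((S * (w k / 2 ^+ k)) ^+ 2 * Vk k)).
    rewrite ler_wpM2l ?sqr_ge0// /Vk lerBlDr -addrA lerDl addr_ge0 ?vol2_ge0//.
    by rewrite ltW// hv1_pos.
  rewrite le_eqVlt; apply/orP; left; apply/eqP.
  rewrite exprMn -mulrA; congr (_ * _); rewrite expr2 {2}/w four.
  by field; rewrite !gt_eqF.
have dr' : \sum_(k < N) (S * (w k / 2 ^+ k) / 2 ^+ k) * (vol2 (2 ^+ k.+1) - vol2 (2 ^+ k)) <= S *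
  (eps / k0).
  apply: (@le_trans _ _ (S * (dyadic_L vol1 vol2 N / D))); last by rewrite ler_wpM2l.
  rewrite le_eqVlt; apply/orP; left; apply/eqP.
  rewrite /dyadic_L mulr_suml mulr_sumr; apply: eq_bigr => k _; rewrite -/(Vk k) /w four.
  by field; rewrite !gt_eqF.
have bound x : 0 <= x -> x <= S ^+ 2 + S + 1 -> x * (eps / k0) <= eps / 4.
  move=> x0 xk; rewrite mulrA ler_pdivrMr// /k0 mulrC [leRHS](_ : _ = eps * (S ^+ 2 + S + 1));
    last by field.
  by rewrite (ler_wpM2l (ltW eps0)).
have b1 := bound _ S20 ltac:(by move: S0 S20; lra).
have b2 := bound _ S0 ltac:(by move: S0 S20; lra).
exists g; split; split => //.
- by exists (sub (2 ^+ N.+1)) => //; exact: hrho_sub.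
- apply: le_trans g1 _; move: en en' b1 eps0; move: (Rintegral _ _ _) => I; lra.
- apply: le_trans g2 _; move: dr dr' b2 eps0; move: (Rintegral _ _ _) => I; lra.
- by apply: le_trans g3 _; move: eps0; lra.
Qed.

End distance_function.

(** * Non-transience *)

Lemma mul_le_sqrD {R : realDomainType} (s y : R) : 0 <= s -> 0 <= y -> s * y <= s ^+ 2 + y ^+ 2.
Proof.
by move=> s0 y0; have := sqr_ge0 (s - y); have := mulr_ge0 s0 y0; rewrite sqrrB; lra.
Qed.

Section nontransience.
Context {R : realType} {d : nat}.
Local Notation Rd := 'rV[R]_d.
Local Notation F := (Rd -> R).
Variables (mu : {sigma_finite_measure set Rd -> \bar R}) (E : set Rd).
Variables (A : Rd -> 'M[R]_d) (B : Rd -> Rd).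
Hypothesis aeE : {ae mu, forall x, E x}.
Hypothesis mE : measurable E.
Hypothesis oE : open E \/ closed E.
Hypothesis muK : forall K, compact K -> K `<=` E -> (mu K < +oo)%E.
Hypothesis hA_loc : forall i j, L1loc mu E (fun x => A x i j).
Local Notation Q x xi := (dotp (mx_apply (A x) xi) xi).
Hypothesis hell : forall K, compact K -> K `<=` E -> exists2 nu : R, 0 < nu &
  forall x xi, K x -> enorm xi ^+ 2 <= nu * Q x xi /\ Q x xi <= nu * enorm xi ^+ 2.
Hypothesis hclosable : form0_closable mu E A.
Hypothesis hsector : strong_sector mu E A.
Hypothesis hexh : exists Kn : nat -> set Rd,
  [/\ forall n, compact (Kn n) /\ Kn n `<=` E, forall m n, (m <= n)%N -> Kn m `<=` Kn n &
      forall K, compact K -> K `<=` E -> exists n, K `<=` Kn n].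
Hypothesis hB_loc : forall i, L2loc mu E (fun x => B x ord0 i).
Hypothesis hB_div : divergence_free mu E B.
Variables (G T : R -> F -> F).
Hypothesis hG : sub_markovian_C0_resolvent mu 1 E G.
Hypothesis hL : bounded_dom_identities mu E A B (resolvent_generator mu E G).
Implicit Types (f g u : F).
Local Notation L1 f := (mu.-integrable setT (EFin \o f)).

Lemma resolvent_generator_resolvent a f : 0 < a -> L1 f ->
  resolvent_generator mu E G (G a f) (fun x => a * G a f x - f x).
Proof.
move=> a0 fi; have ui := resolvent_L1 aeE hG a0 fi.
have wi : L1 (fun x => a * G a f x - f x) by apply: integrable_realB => //; exact: integrable_realZ.
split; [exact/(Lp_on_L1 aeE)|exact/(Lp_on_L1 aeE)|move=> b b0].
have H1 := resolvent_equation aeE hG b0 a0 fi.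
have H2 := resolvent_lin aeE hG (b - a) b0 ui fi.
rewrite (_ : (fun x => b * G a f x - _) = fun x => (b - a) * G a f x + f x); last first.
  by apply/funext => x; ring.
by apply: filterS2 H1 H2 => x H1 H2 _; rewrite H2; move: H1; lra.
Qed.

(** Boundedness of [u = G a f] is used three times: to enter the identities of the generator, in the
    bound of the energy after dropping [a] times the integral of [u^2], and for the drift term once
    the derivative falls on [g]. *)
Lemma resolvent_test_estimate : exists2 S, 0 < S & forall a f g (M : R), 0 < a -> 0 < M -> L1 f ->
  (forall x, 0 <= f x) -> {ae mu, forall x, 0 < f x -> G a f x <= M} ->
  test_fun E g -> (exists2 V, rel_compact_open E V & supp E g `<=` V) -> (forall x,
    0 <= g x <= 1) ->
  \int[mu]_(x in E) (f x * g x) <=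
    S * (Num.sqrt (M * \int[mu]_(x in E) f x) * Num.sqrt (form0 mu E A g g))
    + M * \int[mu]_(x in E) `|dotp (B x) (grad g x)| + a * M * \int[mu]_(x in E) g x.
Proof.
have [S S0 HS] := form_sector aeE mE oE muK hA_loc hell hclosable hsector.
exists S => // a f g M a0 M0 fi f0 fM tg [V rV gV] g01.
have f0' : {ae mu, forall x, 0 <= f x} by exact: aeW.
have uM := maximum_principle aeE hG a0 M0 fi f0' fM.
have u0 := resolvent_ge0 aeE hG a0 fi f0'.
have ui := resolvent_L1 aeE hG a0 fi.
have gen := resolvent_generator_resolvent a0 fi.
set u := G a f in uM u0 ui gen *.
have uM' : {ae mu, forall x, `|u x| <= M}.
  by apply: filterS2 u0 uM => x x0 xM; rewrite ger0_norm.
have [du id1 id2] := hL gen (ex_intro _ M uM').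
have bg : ae_bounded mu g.
  by exists 1; apply: aeW => x; have /andP[g0 g1] := g01 x; rewrite ger0_norm.
have dg : form_dom_loc mu E A g.
  exists V => //; exists (fun=> g); exact: (test_form_approx aeE mE oE muK hA_loc).
have {}id1 := id1 g dg bg; rewrite (drift_by_parts mE oE muK hA_loc hell hexh hB_loc hB_div du
  tg) in id1.
have bcg := test_bounded_cpt oE tg.
have mg : measurable_fun setT g by case: bcg.
have mu_ := integrable_real_measurable ui.
have mf := integrable_real_measurable fi.
have toE h : L1 h -> mu.-integrable E (EFin \o h) by exact: integrableS.
have bgE : exists C : R, {ae mu, forall x, E x -> `|g x| <= C}.
  by case: bg => C HC; exists C; apply: filterS HC.
have buE : exists C : R, {ae mu, forall x, E x -> `|u x| <= C}.
  by exists M; apply: filterS uM' => x.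
have mgE : measurable_fun E g by exact: (measurable_funS measurableT).
have muE : measurable_fun E u by exact: (measurable_funS measurableT).
have fgi := ae_boundedM_integrable mE (toE _ fi) mgE bgE.
have ugi := ae_boundedM_integrable mE (toE _ ui) mgE bgE.
have fui := ae_boundedM_integrable mE (toE _ fi) muE buE.
have uui := ae_boundedM_integrable mE (toE _ ui) muE buE.
have gi : mu.-integrable E (EFin \o g) by exact: (bounded_cpt_int1 mE muK).
have auf h : mu.-integrable E (EFin \o (fun x => f x * h x)) ->
    mu.-integrable E (EFin \o (fun x => u x * h x)) ->
    \int[mu]_(x in E) ((a * u x - f x) * h x) =
    a * \int[mu]_(x in E) (u x * h x) - \int[mu]_(x in E) (f x * h x).
  move=> i1 i2; rewrite -RintegralZl// -RintegralB//; last exact: integrable_realZ.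
  by apply: eq_Rintegral => x _; ring.
rewrite auf// in id1; rewrite auf// in id2.
have I1 : \int[mu]_(x in E) (u x * g x) <= M * \int[mu]_(x in E) g x.
  rewrite -RintegralZl//; apply: le_ae_Rintegral => //; first exact: integrable_realZ.
  by apply: filterS uM => x xM _; have /andP[g0 _] := g01 x; rewrite ler_wpM2r.
have I2 : \int[mu]_(x in E) (f x * u x) <= M * \int[mu]_(x in E) f x.
  rewrite -RintegralZl//; last exact: toE.
  apply: le_ae_Rintegral => //; first by apply: integrable_realZ => //; exact: toE.
  by apply: filterS uM => x xM _; rewrite mulrC ler_wpM2r.
have I3 : 0 <= \int[mu]_(x in E) (u x * u x).
  by apply: Rintegral_ge0 => x _; rewrite -expr2 sqr_ge0.
have di : mu.-integrable E (EFin \o (fun x => dotp (B x) (grad g x))).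
  rewrite (_ : _ \o _ = fun x => (\sum_i (B x ord0 i * partial_derivative i g x)%:E)%E); last first.
    by apply/funext => x /=; rewrite sumEFin; congr EFin; apply: eq_bigr => i _; rewrite gradE.
  apply: integrable_sum => // i _.
  apply: (bounded_cpt_integrable mE); last exact: (test_partial_bounded_cpt oE).
  by move=> K cK KE; exact: (drift_sqr_integrable muK hB_loc).
have dui := ae_boundedM_integrable mE di muE buE.
have I4 : `|\int[mu]_(x in E) (dotp (B x) (grad g x) * u x)| <=
    M * \int[mu]_(x in E) `|dotp (B x) (grad g x)|.
  apply: le_trans (le_normr_Rintegral mE dui) _.
  rewrite -RintegralZl//; last exact: integrable_real_abs.
  apply: le_ae_Rintegral => //; first exact: integrable_real_abs.
    by apply: integrable_realZ => //; exact: integrable_real_abs.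
  by apply: filterS uM' => x xM _; rewrite normrM mulrC ler_wpM2r.
have I5 := HS u g du tg.
have I6 : Defs.form mu E A E u u <= M * \int[mu]_(x in E) f x.
  apply: le_trans id2 _; rewrite opprB lerBlDr; apply: le_trans I2 _.
  by rewrite lerDl mulr_ge0// ltW.
have I7 : Num.sqrt (Defs.form mu E A E u u) <= Num.sqrt (M * \int[mu]_(x in E) f x).
  exact: ler_wsqrtr.
have I8 := ler_wpM2l (ltW S0) (ler_wpM2r (sqrtr_ge0 (form0 mu E A g g)) I7).
have -> : \int[mu]_(x in E) (f x * g x) = Defs.form mu E A E u g +
    \int[mu]_(x in E) (dotp (B x) (grad g x) * u x) + a * \int[mu]_(x in E) (u x * g x).
  move: id1; move: (Defs.form _ _ _ _ _ _) (Rintegral _ _ _) (Rintegral _ _ _) (Rintegral _ _ _)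
    => x1 x2 x3 x4.
  lra.
apply: lerD; first apply: lerD.
- by apply: le_trans (ler_norm _) _; exact: le_trans I5 I8.
- by apply: le_trans (ler_norm _) _.
- by rewrite -mulrA ler_wpM2l// ltW.
Qed.

Hypothesis hT : sub_markovian_C0_semigroup mu 1 E T.
Hypothesis hTG : resolvent_of_semigroup mu E T G.

(** All parameters are tied to one [s]: with a test function for [eps = s^2] every error term is at
    most a constant times [s], whereas the integral of [f] is a fixed positive number. *)
Lemma not_transient_of_test_functions (S0 : set Rd) : measurable S0 -> S0 `<=` E ->
  (0 < mu S0)%E -> (mu S0 < +oo)%E ->
  (forall eps : R, 0 < eps -> exists g, [/\ test_fun E g,
      exists2 V, rel_compact_open E V & supp E g `<=` V & forall x, 0 <= g x <= 1] /\
    [/\ form0 mu E A g g <= eps, \int[mu]_(x in E) `|dotp (B x) (grad g x)| <= eps &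
      \int[mu]_(x in S0) (g x - 1) ^+ 2 <= eps]) ->
  ~ transient mu E T.
Proof.
move=> mS0 S0E S0_gt0 S0_fin Htest [h [/(Lp_on_L1 aeE) hi h0 hfin]].
have h0' : {ae mu, forall x, 0 < h x} by apply: filterS2 aeE h0 => x Ex; apply.
have hge0 : {ae mu, forall x, 0 <= h x} by apply: filterS h0' => x; exact: ltW.
pose a n : R := n.+1%:R^-1.
have a0 n : 0 < a n by rewrite invr_gt0.
have Gfin : {ae mu, forall x, exists m : nat, forall n, G (a n) h x <= m%:R}.
  have P := potentialP aeE hT hG hTG hi hge0.
  apply: filterS3 aeE hfin P => x Ex xfin [p0 _ pG].
  have {}xfin := xfin Ex.
  have pfin : potential mu E T h x \is a fin_num.
    rewrite ge0_fin_numE//.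
    by have /andP[p1 p2] := p0 0%N; exact: le_trans p2.
  exists (Num.truncn (fine (potential mu E T h x))).+1 => n.
  rewrite -lee_fin; apply: le_trans (pG n) _; rewrite -(fineK pfin) lee_fin ltW//.
  exact: truncnS_gt.
(* The points of [S0] at which all the resolvents are at most [m]. These sets exhaust [S0] up to a
   null set, so one of them has positive measure. *)
pose Sm (m : nat) := S0 `&` \bigcap_n [set x | G (a n) h x <= m%:R].
have mG n : measurable_fun setT (G (a n) h).
  by apply: integrable_real_measurable; exact: (resolvent_L1 aeE hG (a0 n) hi).
have mSm m : measurable (Sm m).
  apply: measurableI => //; apply: bigcapT_measurable => n.
  rewrite [X in measurable X](_ : _ = G (a n) h @^-1` `]-oo, m%:R]); last first.
    by apply/seteqP; split => x; rewrite /= in_itv.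
  by rewrite -[X in measurable X]setTI; exact: mG.
have [m Sm_gt0] : exists m, (0 < mu (Sm m))%E.
  apply: contrapT => /forallNP H; move: S0_gt0; rewrite ltNge => /negP; apply.
  have neg m : mu.-negligible (Sm m).
    exists (Sm m); split => //; apply/eqP; rewrite eq_le measure_ge0 andbT leNgt.
    exact/negP.
  suff : mu.-negligible S0 by move/negligibleP => ->.
  have : {ae mu, forall x, ~ S0 x}.
    have nU : {ae mu, forall x, ~ (\bigcup_k Sm k) x}.
      by apply: negligibleS (negligible_bigcup neg) => x /contrapT.
    apply: filterS2 Gfin nU => x [k Gk] nU Sx; apply: nU; exists k => //.
    by split => // n _; exact: Gk.
  by apply: negligibleS => x Sx; exact.
pose M : R := m.+1%:R.
have M0 : 0 < M by [].
(* [h] is positive only a.e.; the absolute value puts [f] in [0, 1] everywhere. *)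
pose f x := \1_(Sm m) x * Num.min `|h x| 1.
have f01 x : 0 <= f x <= 1.
  rewrite /f indicE; case: (_ \in _); last by rewrite mul0r lexx ler01.
  by rewrite mul1r le_min normr_ge0 ler01/= ge_min lexx orbT.
have mf : measurable_fun setT f.
  apply: measurable_funM; first exact: measurable_indic.
  apply: measurable_minr => //; apply: measurableT_comp => //.
  exact: integrable_real_measurable hi.
have fi : L1 f.
  apply: (@le_integrable_real _ _ _ mu _ _ (fun x => `|h x|)) => //;
    last exact: integrable_real_abs.
  move=> x _; have /andP[fx _] := f01 x; rewrite ger0_norm// /f indicE.
  case: (_ \in _); first by rewrite mul1r ge_min lexx.
  by rewrite mul0r.
have fh : {ae mu, forall x, f x <= h x}.
  apply: filterS hge0 => x hx; rewrite /f (ger0_norm hx) indicE; case: (_ \in _).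
    by rewrite mul1r ge_min lexx.
  by rewrite mul0r.
have fM n : {ae mu, forall x, 0 < f x -> G (a n) f x <= M}.
  apply: filterS (resolvent_le aeE hG (a0 n) fi hi fh) => x fhx.
  rewrite /f indicE; case: (boolP (x \in Sm m)); last by rewrite mul0r ltxx.
  move=> /set_mem[_ /(_ n Logic.I) /= Gm] _; apply: le_trans fhx _.
  by apply: le_trans Gm _; rewrite ler_nat.
have fiE : mu.-integrable E (EFin \o f) by exact: integrableS fi.
set F := \int[mu]_(x in E) f x.
have SmE x : Sm m x -> E x by move=> [/S0E].
have F0 : 0 < F.
  rewrite lt_neqAle Rintegral_ge0 ?andbT//; last by move=> x _; have /andP[] := f01 x.
  apply/negP => /eqP/esym F00.
  have := Rintegral_eq0_ae mE fiE (fun x _ => (andP (f01 x)).1) (eq_ind_r (fun y =>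
    y <= 0) (lexx 0) F00) => fz.
  have : {ae mu, forall x, ~ Sm m x}.
    apply: filterS2 h0' fz => x hx fz Sx; have := fz (SmE x Sx).
    rewrite /f indicE mem_set// mul1r gtr0_norm// => /eqP.
    by rewrite gt_eqF// lt_min hx ltr01.
  move=> nS; move: Sm_gt0; suff /negligibleP -> : mu.-negligible (Sm m) by rewrite ?ltxx.
  by apply: negligibleS nS => x Sx; exact.
have [S S00 HS] := resolvent_test_estimate.
pose c := fine (mu S0).
have key s : 0 < s -> s <= 1 -> F <= (S * Num.sqrt (M * F) + M + 1 + c + 1) * s.
  move=> s0 s1; have e0 : 0 < s ^+ 2 by rewrite exprn_gt0.
  have [g [[tg gV g01] [g1 g2 g3]]] := Htest _ e0.
  have gi : mu.-integrable E (EFin \o g) by apply: (bounded_cpt_int1 mE muK);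
    exact: (test_bounded_cpt oE).
  set I := \int[mu]_(x in E) g x.
  have I0 : 0 <= I by apply: Rintegral_ge0 => x _; have /andP[] := g01 x.
  (* The resolvent parameter is chosen after [g], because no bound on the integral of [g] uniform in
     [s] is available. *)
  have [n na] : exists n, a n * M * I <= s ^+ 2.
    have q0 : 0 < s ^+ 2 / (M * I + 1) by rewrite divr_gt0// ltr_wpDl// mulr_ge0// ltW.
    have [n _ /(_ n (leqnn n)) /= an] := near_infty_natSinv_lt (PosNum q0).
    exists n; rewrite -mulrA; move: an; rewrite -/(a n) ltr_pdivlMr ?ltr_wpDl ?mulr_ge0 ?(ltW M0)//.
    by move/ltW; apply: le_trans; rewrite ler_wpM2l ?(ltW (a0 n))// lerDl.
  have est := HS (a n) f g M (a0 n) M0 fi (fun x => (andP (f01 x)).1) (fM n) tg gV g01.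
  rewrite -/F -/I in est.
  have sq : Num.sqrt (form0 mu E A g g) <= s.
    by rewrite -[leRHS]ger0_norm ?(ltW s0)// -sqrtr_sqr ler_wsqrtr.
  have fgi : mu.-integrable E (EFin \o (fun x => f x * g x)).
    apply: ae_boundedM_integrable => //.
      by apply: (measurable_funS measurableT) => //; have [] := test_bounded_cpt oE tg.
    exists 1; apply: aeW => x _; have /andP[gx0 gx1] := g01 x; by rewrite ger0_norm.
  have low : F - \int[mu]_(x in E) (f x * g x) <= (c + 1) * s.
    rewrite /F -RintegralB//.
    rewrite (Rintegral_sub_support mu S0E); last first.
      move=> x _ nS; rewrite /f indicE memNset ?mul0r ?subrr//.
      by case=> /nS.
    have ci (k : R) : mu.-integrable S0 (EFin \o (fun=> k)).
      apply/integrableP; split; first exact/measurable_EFinP.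
      by rewrite integral_cst// lte_mul_pinfty// abse_ge0.
    have qi : mu.-integrable S0 (EFin \o (fun x => (g x - 1) ^+ 2)).
      apply: le_integrable_real (ci 1) => //.
        apply: measurable_funX; apply: measurable_funB => //.
        by apply: (measurable_funS measurableT) => //; have [] := test_bounded_cpt oE tg.
      move=> x _; rewrite ger0_norm ?sqr_ge0// -real_normK ?num_real// expr_le1//.
      have /andP[gx0 gx1] := g01 x.
      by rewrite ler_norml lerBrDr addNr gx0 lerBlDr (le_trans gx1)// lerDl.
    have i2 : mu.-integrable S0 (EFin \o (fun x => s^-1 * (g x - 1) ^+ 2)) by exact:
      integrable_realZ.
    (* Since [f <= 1], the integrand is at most [1 - g], and [s * (1 - g) <= s^2 + (1 - g)^2] is
       divided by [s]. *)
    apply: (@le_trans _ _ (\int[mu]_(x in S0) (s + s^-1 * (g x - 1) ^+ 2))).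
      apply: le_Rintegral => //.
      - by apply: integrableS (integrable_realB mE fiE fgi).
      - exact: (integrable_realD mS0 (ci s) i2).
      move=> x _; have /andP[fx0 fx1] := f01 x; have /andP[gx0 gx1] := g01 x.
      apply: (@le_trans _ _ (1 - g x)).
        by rewrite -[X in X - _ <= _]mulr1 -mulrBr ler_piMl// subr_ge0.
      rewrite -(ler_pM2l s0) [leRHS]mulrDr mulVKf ?gt_eqF//.
      have -> : (g x - 1) ^+ 2 = (1 - g x) ^+ 2 by rewrite -sqrrN opprB.
      by rewrite -expr2 mul_le_sqrD// ?subr_ge0// ltW.
    rewrite (RintegralD mS0 (ci s) i2) RintegralZl// Rintegral_cst// mulrDl mul1r [s * _]mulrC
      lerD//.
    by rewrite ler_pdivrMl// -expr2.
  have G1 : S * (Num.sqrt (M * F) * Num.sqrt (form0 mu E A g g)) <= S * Num.sqrt (M * F) * s.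
    by rewrite -mulrA (ler_wpM2l (ltW S00))// ler_wpM2l// sqrtr_ge0.
  have G2 : M * \int[mu]_(x in E) `|dotp (B x) (grad g x)| <= M * s.
    rewrite (ler_wpM2l (ltW M0))//; apply: le_trans g2 _.
    by rewrite expr2 ler_piMl// ltW.
  have G3 : s ^+ 2 <= s by rewrite expr2 ler_piMl// ltW.
  have combine (y1 y2 y3 y4 y5 : R) : F - y1 <= (c + 1) * s -> y1 <= y2 + y5 + y4 ->
      y2 <= y3 * s -> y5 <= M * s -> y4 <= s ^+ 2 -> s ^+ 2 <= s ->
      F <= (y3 + M + 1 + c + 1) * s.
    by move: (s ^+ 2) => z; lra.
  exact: combine low est G1 G2 na G3.
have [s [s0 s1 ss]] : exists s, [/\ 0 < s, s <= 1 & (S * Num.sqrt (M * F) + M + 1 + c + 1) * s < F].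
  set k := S * _ + _ + _ + _ + _.
  have k0 : 0 < k by rewrite ltr_wpDl// !addr_ge0 ?fine_ge0// ?mulr_ge0 ?sqrtr_ge0// ltW.
  exists (Num.min 1 (F / (2 * k))); split.
  - by rewrite lt_min ltr01 divr_gt0// mulr_gt0.
  - by rewrite ge_min lexx.
  - apply: (@le_lt_trans _ _ (k * (F / (2 * k)))); first by rewrite ler_wpM2l ?(ltW k0)// ge_min
    lexx orbT.
    by rewrite (_ : k * _ = F / 2) ?ltr_pdivrMr ?mulr_natr ?mulr2n ?ltrDl//; field; rewrite gt_eqF.
by have := key s s0 s1; rewrite leNgt ss.
Qed.

End nontransience.

Theorem theorem21 (R : realType) (d : nat)
  (E : set 'rV[R]_d)
  (phi : 'rV[R]_d -> R)
  (mu : {sigma_finite_measure set 'rV[R]_d -> \bar R})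
  (A : 'rV[R]_d -> 'M[R]_d)
  (B : 'rV[R]_d -> 'rV[R]_d)
  (GV : set 'rV[R]_d -> R -> ('rV[R]_d -> R) -> ('rV[R]_d -> R))
  (Gbar Tbar T : R -> ('rV[R]_d -> R) -> ('rV[R]_d -> R))
  (rho : 'rV[R]_d -> R) (grho : 'rV[R]_d -> 'rV[R]_d)
  (hE : open_or_closed_null_boundary E)
  (hphi_loc : L1loc (lebesgue_rV R d) E phi)
  (hphi_pos : {ae lebesgue_rV R d, forall x, E x -> 0 < phi x})
  (hmu : forall S : set 'rV[R]_d, measurable S ->
     mu S = (\int[lebesgue_rV R d]_(x in S `&` E) (phi x)%:E)%E)
  (hmu_supp : forall x (U : set 'rV[R]_d), E x -> open U -> U x -> (0 < mu U)%E)
  (hA_loc : forall i j, L1loc mu E (fun x => A x i j))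
  (hA_ell : locally_elliptic E A)
  (hclosable : form0_closable mu E A)
  (hsector : strong_sector mu E A)
  (hB_loc : forall i, L2loc mu E (fun x => B x ord0 i))
  (hB_div : divergence_free mu E B)
  (hdense : gen_dom_0b_dense mu E A)
  (hGV : local_resolvents mu E A B GV)
  (hGbar : sub_markovian_C0_resolvent mu 1 E Gbar)
  (hGbar_lim : limit_resolvent mu E GV Gbar)
  (hLbar_ext : extends_drift_operator mu E A B (resolvent_generator mu E Gbar))
  (hLbar_id : bounded_dom_identities mu E A B (resolvent_generator mu E Gbar))
  (hTbar : sub_markovian_C0_semigroup mu 1 E Tbar)
  (hTbar_G : resolvent_of_semigroup mu E Tbar Gbar)
  (hT : sub_markovian_C0_semigroup mu 2%:E E T)
  (hT_Tbar : forall t f, 0 < t -> Lp_on mu 1 E f -> Lp_on mu 2%:E E f ->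
     T t f = Tbar t f %[ae mu])
  (hrho_ge0 : forall x, E x -> 0 <= rho x)
  (hrho_cont : {within E, continuous rho})
  (hrho_grad : is_wgrad_loc mu E A rho grho)
  (hrho_grad_loc : forall i, Linfloc mu E (fun x => grho x ord0 i))
  (hrho_sub : forall r, 0 < r -> rel_compact_open E (sublevel E rho r))
  (hrho_cover : \bigcup_(r in [set r : R | 0 < r]) sublevel E rho r = E)
  (hv1_pos : forall r, 0 < r -> 0 < vol1 mu E A rho grho r)
  (ha_infty : vol_seq mu E A B rho grho n @[n --> \oo] --> +oo)
  (ha_log : ln (Num.max (vol2 mu E B rho grho n%:R) 1)
              / vol_seq mu E A B rho grho n @[n --> \oo] --> (0 : R)) :
  ~ transient mu E Tbar /\ (strictly_irreducible mu E T -> recurrent mu E Tbar).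
Proof.
have mE : measurable E.
  by case: hE => [/open_measurable_mx//|[/closed_measurable_rV]].
have oE : open E \/ closed E by case: hE => [|[]]; [left|right].
have aeE : {ae mu, forall x, E x}.
  exists (~` E); split => //; first exact: measurableC.
  by rewrite hmu ?setICl ?integral_set0//; exact: measurableC.
have muK (K : set 'rV[R]_d) : compact K -> K `<=` E -> (mu K < +oo)%E.
  move=> cK KE; rewrite hmu; last exact: compact_measurable_rV.
  rewrite (setIidl KE); have := hphi_loc K cK KE.
  by move=> /(integrable_lty (compact_measurable_rV cK)).
(* [rho] is bounded on compact sets, so every compact subset of [E] lies in a sublevel set;
   ellipticity on compact sets and the exhaustion [Kn] both come from this. *)
have sub_cpt (K : set 'rV[R]_d) : compact K -> K `<=` E ->
    exists n : nat, K `<=` sublevel E rho n.+1%:R.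
  move=> cK KE.
  have : compact (rho @` K) by apply: continuous_compact => //;
    exact: continuous_subspaceW hrho_cont.
  move=> /compact_bounded [M [_ HM]].
  exists (Num.truncn (M + 1)) => x Kx; split; first exact: KE.
  have := HM (M + 1) ltac:(by rewrite ltrDl) (rho x) ltac:(by exists x).
  move=> /= h; apply: le_lt_trans (truncnS_gt (M + 1)).
  exact: le_trans (ler_norm _) h.
have hell (K : set 'rV[R]_d) : compact K -> K `<=` E -> exists2 nu : R, 0 < nu &
    forall x xi, K x -> enorm xi ^+ 2 <= nu * dotp (mx_apply (A x) xi) xi /\
      dotp (mx_apply (A x) xi) xi <= nu * enorm xi ^+ 2.
  move=> cK KE; have [n Kn] := sub_cpt K cK KE.
  have [nu nu0 H] := hA_ell _ (hrho_sub _ (ltr0Sn R n)); exists nu => // x xi /Kn Vx.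
  by have := H x xi Vx; rewrite sym_part_quad ler_pdivrMl// => /andP.
have hexh : exists Kn : nat -> set 'rV[R]_d,
    [/\ forall n, compact (Kn n) /\ Kn n `<=` E, forall m n, (m <= n)%N -> Kn m `<=` Kn n &
      forall K, compact K -> K `<=` E -> exists n, K `<=` Kn n].
  exists (fun n => closure (sublevel E rho n.+1%:R)); split.
  - by move=> n; have [_ cK KE] := hrho_sub _ (ltr0Sn R n).
  - by move=> m n mn; apply: closureS; apply: sublevel_le; rewrite ler_nat.
  - move=> K cK KE; have [n Kn] := sub_cpt K cK KE.
    by exists n; apply: subset_trans Kn _; exact: subset_closure.
have mS := measurable_sublevel mE hrho_ge0 hrho_sub 1.
have [_ cS SE] := hrho_sub _ ltr01.
have sS : sublevel E rho 1 `<=` E by move=> x [].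
have nt : ~ transient mu E Tbar.
  apply: (not_transient_of_test_functions aeE mE oE muK hA_loc hell hclosable hsector hexh
    hB_loc hB_div hGbar hLbar_id hTbar hTbar_G mS sS).
  (* A null sublevel set would make v_1 vanish at 1. *)
  - rewrite lt0e measure_ge0 andbT; apply/eqP => m0.
    have := hv1_pos _ ltr01; rewrite /vol1 /Rintegral null_set_integral ?ltxx//.
    have := quad_rho_integrable hA_loc hrho_grad_loc cS SE.
    by move=> /(integrableS (compact_measurable_rV cS) mS (@subset_closure _ _)) /measurable_int.
  - apply: le_lt_trans (muK _ cS SE); apply: le_measure.
    + exact/mem_set.
    + by apply: mem_set; exact: compact_measurable_rV cS.
    + exact: subset_closure.
  - exact: (small_energy_test_function mE oE muK hA_loc hell hexh hB_loc hrho_ge0 hrho_cont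
      hrho_grad hrho_grad_loc hrho_sub hv1_pos ha_infty ha_log).
split => //; exact: (recurrent_of_irreducible aeE mE hGbar hTbar hTbar_G hT hT_Tbar nt).
Qed.
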